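(* Assume $\operatorname{char}\mathbb{K}=p>3$. Then $\{\mathcal{F}_n\}_{n=0}^{\infty}$ is the coradical filtration of $\overline{\mathcal{T}}_p(p;1,\ldots,1)^{cop}$ (and of $\overline{\mathcal{T}}_p(p;1,\ldots,1)$).
   Context: $\mathbb{K}$ is a field and $[a,b]=ab-ba$. On words in the letters $g,h$ use the lexicographic order with $g\prec h$ (a proper prefix of a word is smaller than the word). A Lyndon word is a nonempty word $\alpha$ which is a single letter or satisfies $\alpha\prec\gamma\beta$ for every factorization $\alpha=\beta\gamma$ into nonempty words. $\alpha(g)$ is the number of occurrences of $g$ in $\alpha$. The standard factorization of a Lyndon word $\alpha$ of length at least $2$ is $\alpha=\beta\gamma$ with $\beta,\gamma$ Lyndon and $\gamma$ of maximal length. Define $E_g=g$, $E_h=h$ and $E_\alpha=[E_\beta,E_\gamma]$ for the standard factorization $\alpha=\beta\gamma$. $\mathcal{T}=\mathbb{K}\langle g,h\rangle$ is the free algebra with bialgebra structure $\Delta(g)=g\otimes g$, $\Delta(h)=1\otimes h+h\otimes g$, $\epsilon(g)=1$, $\epsilon(h)=0$. $\overline{\mathcal{T}}=\mathcal{T}/\mathcal{I}$ is the quotient bialgebra by the ideal generated by all $E_\alpha$ with $\alpha$ Lyndon and $\alpha(g)\ge 2$. For $k\ge 0$, $\omega_k=gh^k$, $E_{\omega_0}=g$, $E_{\omega_k}=[E_{\omega_{k-1}},h]$, and $\mathcal{E}_{\omega_k}$ is the image of $E_{\omega_k}$ in a quotient. $\overline{\mathcal{T}}_p(p;1,\ldots,1)$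 (with $p-2$ ones) is the Hopf algebra quotient of $\overline{\mathcal{T}}$ by the ideal generated by $g^p-1$, $\mathcal{E}_{\omega_{p-1}}$, $h^p$ and $\mathcal{E}_{\omega_k}^p$ for $1\le k\le p-2$. The superscript $cop$ means the opposite coproduct. In this algebra put $y=h$, $x=g$, $x_m=\mathcal{E}_{\omega_m}g^{-1}$ for $m\ge 1$, and $z_n=x_n-\frac{(n+1)!}{2^n}x_1^n$ for $n\ge 2$. For $n\ge 0$ let $\mathcal{F}_n$ be the span of all elements $y^rz_{i_m}^{s_m}\cdots z_{i_2}^{s_2}x_1^{s_1}x^t$ with $i_m>\cdots>i_2\ge 2$, nonnegative exponents, and $r+(i_m-1)s_m+\cdots+(i_2-1)s_2+s_1\le n$. The coradical filtration of a coalgebra $C$ is given by $C_0=$ the coradical of $C$ (sum of simple subcoalgebras) and $C_n=\Delta^{-1}(C_{n-1}\otimes C+C\otimes C_0)$ for $n\ge 1$. *)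

(* Defs.v *)
From HB Require Import structures.
From mathcomp Require Import all_boot all_order all_algebra.
From mathcomp Require Import boolp classical_sets.
From mathcomp Require Import finmap monalg.

Set Implicit Arguments.
Unset Strict Implicit.
Unset Printing Implicit Defensive.

Import Order.TTheory GRing.Theory.
Import Quotient.

Local Open Scope classical_set_scope.
Local Open Scope ring_scope.
Local Open Scope quotient_scope.

Reserved Notation "a \ox b" (at level 40, left associativity).

Definition is_subspace (K : fieldType) (V : lmodType K) (U : set V) : Prop :=
  U 0 /\ forall (c : K) (u v : V), U u -> U v -> U (c *: u + v).

Definition lspan (K : fieldType) (V : lmodType K) (S : set V) : set V :=
  smallest (@is_subspace K V) S.

Lemma span_subspace (K : fieldType) (V : lmodType K) (S : set V) :
  is_subspace (lspan S).
Proof.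
split=> [U [[U0 _] _] //|c u v Su Sv U US].
by case: (US) => -[_ UL] _; apply: UL; [exact: Su|exact: Sv].
Qed.

Lemma sub_span (K : fieldType) (V : lmodType K) (S : set V) : S `<=` lspan S.
Proof. by move=> v Sv U [_]; apply. Qed.

Lemma span_min (K : fieldType) (V : lmodType K) (S U : set V) :
  is_subspace U -> S `<=` U -> lspan S `<=` U.
Proof. by move=> sU SU v; apply. Qed.

Record subspace (K : fieldType) (V : lmodType K) := Subspace {
  subspace_set :> V -> Prop;
  subspaceP : is_subspace subspace_set }.

Definition subspace_pred (K : fieldType) (V : lmodType K) (U : subspace V) :
  pred V := fun v => `[< U v >].

Lemma subspace_zmod_closed (K : fieldType) (V : lmodType K) (U : subspace V) :
  zmod_closed (subspace_pred U).
Proof.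
have [U0 UL] := subspaceP U; split=> [|u v /asboolP Uu /asboolP Uv].
  exact/asboolP.
by apply/asboolP; rewrite addrC -scaleN1r; apply: UL.
Qed.

Definition subspace_zmod (K : fieldType) (V : lmodType K) (U : subspace V) :
  zmodClosed V :=
  HB.pack (subspace_pred U)
    (GRing.isZmodClosed.Build V (subspace_pred U) (subspace_zmod_closed U)).

Definition quotsp (K : fieldType) (V : lmodType K) (U : subspace V) : Type :=
  {quot subspace_zmod U}.

HB.instance Definition _ (K : fieldType) (V : lmodType K) (U : subspace V) :=
  GRing.Zmodule.on (quotsp U).

Section QuotientSpace.
Variables (K : fieldType) (V : lmodType K) (U : subspace V).

Definition qproj (v : V) : quotsp U :=
  \pi_({quot subspace_zmod U}) v.
Definition qrepr (x : quotsp U) : V :=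
  repr (x : {quot subspace_zmod U}).

Lemma qreprK : cancel qrepr qproj.
Proof. exact: reprK. Qed.

Lemma qprojD : {morph qproj : u v / u + v}.
Proof. exact: raddfD. Qed.

Lemma qprojB : {morph qproj : u v / u - v}.
Proof. exact: raddfB. Qed.

Lemma qproj_eqP u v : qproj u = qproj v <-> U (u - v).
Proof.
have e : (u - v \in subspace_zmod U) = (qproj u == qproj v) by exact: idealrBE.
split=> [/eqP|Uuv]; first by rewrite -e => /asboolP.
by apply/eqP; rewrite -e; apply/asboolP.
Qed.

Lemma qproj_eq0 u : qproj u = 0 <-> U u.
Proof.
have -> : 0 = qproj 0 by apply: esym; exact: raddf0.
by rewrite qproj_eqP subr0.
Qed.

Definition qscale (c : K) (x : quotsp U) : quotsp U := qproj (c *: qrepr x).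

Lemma qscaleE c v : qscale c (qproj v) = qproj (c *: v).
Proof.
apply/qproj_eqP; rewrite -scalerBr -[_ *: _]addr0.
have [U0 UL] := subspaceP U; apply: UL => //.
by apply/qproj_eqP; rewrite qreprK.
Qed.

Lemma qscaleA c d x : qscale c (qscale d x) = qscale (c * d) x.
Proof. by rewrite -[x]qreprK !qscaleE scalerA. Qed.

Lemma qscale1 : left_id 1 qscale.
Proof. by move=> x; rewrite -[x]qreprK qscaleE scale1r. Qed.

Lemma qscaleDr : right_distributive qscale +%R.
Proof.
by move=> c x y; rewrite -[x]qreprK -[y]qreprK -qprojD !qscaleE scalerDr qprojD.
Qed.

Lemma qscaleDl x : {morph qscale^~ x : c d / c + d}.
Proof. by move=> c d; rewrite -[x]qreprK !qscaleE scalerDl qprojD. Qed.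

HB.instance Definition _ := GRing.Zmodule_isLmodule.Build K (quotsp U)
  qscaleA qscale1 qscaleDr qscaleDl.

Lemma qprojZ c v : qproj (c *: v) = c *: qproj v.
Proof. by rewrite -qscaleE. Qed.

End QuotientSpace.

Definition is_ideal (K : fieldType) (A : algType K) (J : set A) : Prop :=
  is_subspace J /\ forall a x, J x -> J (a * x) /\ J (x * a).

Definition ideal (K : fieldType) (A : algType K) (S : set A) : set A :=
  smallest (@is_ideal K A) S.

Lemma ideal_is_ideal (K : fieldType) (A : algType K) (S : set A) :
  is_ideal (ideal S).
Proof.
split; first split=> [J [[[J0 _] _] _] //|c u v Su Sv J JS].
  by case: (JS) => -[[_ JL] _] _; apply: JL; [exact: Su|exact: Sv].
by move=> a x Jx; split=> J JS; case: (JS) => -[_ JM] _;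
  have [] := JM a x (Jx _ JS).
Qed.

Lemma sub_ideal (K : fieldType) (A : algType K) (S : set A) : S `<=` ideal S.
Proof. by move=> v Sv U [_]; apply. Qed.

(* An algType satisfies 1 != 0, so only quotients by proper ideals are        *)
(* algebras.                                                                  *)
Record pideal (K : fieldType) (A : algType K) := PIdeal {
  pideal_set :> A -> Prop;
  pidealP : is_ideal pideal_set;
  pideal1 : ~ pideal_set 1 }.

Definition pideal_subspace (K : fieldType) (A : algType K) (J : pideal A) :
  subspace A := Subspace (pidealP J).1.

Definition algquot (K : fieldType) (A : algType K) (J : pideal A) : Type :=
  quotsp (pideal_subspace J).

HB.instance Definition _ (K : fieldType) (A : algType K) (J : pideal A) :=
  GRing.Lmodule.on (algquot J).

Section QuotientAlgebra.
Variables (K : fieldType) (A : algType K) (J : pideal A).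

Definition aproj (a : A) : algquot J := qproj (pideal_subspace J) a.
Definition arepr (x : algquot J) : A := qrepr x.

Lemma areprK : cancel arepr aproj.
Proof. exact: qreprK. Qed.

Lemma aproj_eqP a b : aproj a = aproj b <-> J (a - b).
Proof. exact: qproj_eqP. Qed.

Lemma aprojD : {morph aproj : a b / a + b}.
Proof. exact: qprojD. Qed.

Lemma aprojB : {morph aproj : a b / a - b}.
Proof. exact: qprojB. Qed.

Lemma aprojZ c a : aproj (c *: a) = c *: aproj a.
Proof. exact: qprojZ. Qed.

Lemma aproj_eq0 a : aproj a = 0 <-> J a.
Proof. exact: qproj_eq0. Qed.

Definition qmul (x y : algquot J) : algquot J := aproj (arepr x * arepr y).

Lemma qmulE a b : qmul (aproj a) (aproj b) = aproj (a * b).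
Proof.
have [[I0 IL] IM] := pidealP J.
have Ir c : J (arepr (aproj c) - c) by apply/aproj_eqP; rewrite areprK.
apply/aproj_eqP; set a' := arepr _; set b' := arepr _.
have -> : a' * b' - a * b = 1 *: ((a' - a) * b') + a * (b' - b).
  by rewrite scale1r mulrBl mulrBr addrA subrK.
by apply: IL; [have [] := IM b' _ (Ir a)|have [] := IM a _ (Ir b)].
Qed.

Lemma qmulA : associative qmul.
Proof.
by move=> x y z; rewrite -[x]areprK -[y]areprK -[z]areprK !qmulE mulrA.
Qed.

Lemma qmul1l : left_id (aproj 1) qmul.
Proof. by move=> x; rewrite -[x]areprK qmulE mul1r. Qed.

Lemma qmul1r : right_id (aproj 1) qmul.
Proof. by move=> x; rewrite -[x]areprK qmulE mulr1. Qed.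

Lemma qmulDl : left_distributive qmul +%R.
Proof.
move=> x y z; rewrite -[x]areprK -[y]areprK -[z]areprK -aprojD !qmulE.
by rewrite mulrDl aprojD.
Qed.

Lemma qmulDr : right_distributive qmul +%R.
Proof.
move=> x y z; rewrite -[x]areprK -[y]areprK -[z]areprK -aprojD !qmulE.
by rewrite mulrDr aprojD.
Qed.

Lemma qone_neq0 : aproj 1 != 0.
Proof. by apply/eqP => /aproj_eq0; apply: pideal1. Qed.

HB.instance Definition _ := GRing.Zmodule_isNzRing.Build (algquot J)
  qmulA qmul1l qmul1r qmulDl qmulDr qone_neq0.

Lemma aproj1 : aproj 1 = 1. Proof. by []. Qed.

Lemma aprojM : {morph aproj : a b / a * b}.
Proof. by move=> a b; rewrite -qmulE. Qed.

Lemma aprojX n : {morph aproj : a / a ^+ n}.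
Proof. by move=> a; elim: n => // n IHn; rewrite !exprS aprojM IHn. Qed.

Lemma qscaleAl (c : K) (x y : algquot J) : c *: (x * y) = (c *: x) * y.
Proof.
by rewrite -[x]areprK -[y]areprK -aprojM -!aprojZ scalerAl aprojM.
Qed.

Lemma qscaleAr (c : K) (x y : algquot J) : c *: (x * y) = x * (c *: y).
Proof.
by rewrite -[x]areprK -[y]areprK -aprojM -!aprojZ scalerAr aprojM.
Qed.

HB.instance Definition _ := GRing.Lmodule_isLalgebra.Build K (algquot J)
  qscaleAl.
HB.instance Definition _ := GRing.Lalgebra_isAlgebra.Build K (algquot J)
  qscaleAr.

End QuotientAlgebra.

Definition is_character (K : fieldType) (A : algType K) (phi : A -> K) : Prop :=
  [/\ forall c x y, phi (c *: x + y) = c * phi x + phi y,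
      {morph phi : x y / x * y} & phi 1 = 1].

Lemma character_ideal (K : fieldType) (A : algType K) (phi : A -> K) S :
  is_character phi -> (forall x, S x -> phi x = 0) ->
  forall x, ideal S x -> phi x = 0.
Proof.
move=> [phiL phiM phi1] S0 x Ix; apply: (Ix [set y | phi y = 0]).
split=> //; split; first split.
- by have := phiL (-1) 0 0; rewrite /= scaler0 addr0 mulN1r addNr.
- by move=> c u v u0 v0; rewrite /= phiL u0 v0 mulr0 addr0.
- by move=> a u u0; rewrite /= !phiM u0 mulr0 mul0r.
Qed.

Lemma character_proper (K : fieldType) (A : algType K) (phi : A -> K) S :
  is_character phi -> (forall x, S x -> phi x = 0) -> ~ ideal S 1.
Proof.
move=> chi S0 /(character_ideal chi S0); have [_ _ ->] := chi.
exact/eqP/oner_neq0.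
Qed.

Lemma character_quot (K : fieldType) (A : algType K) (phi : A -> K)
    (J : pideal A) :
  is_character phi -> (forall x, J x -> phi x = 0) ->
  is_character (phi \o @arepr K A J) /\
  forall a, phi (arepr (aproj J a)) = phi a.
Proof.
move=> [phiL phiM phi1] J0.
have E a : phi (arepr (aproj J a)) = phi a.
  have /J0 : J (arepr (aproj J a) - a) by apply/aproj_eqP; rewrite areprK.
  rewrite addrC -scaleN1r phiL mulN1r addrC => /eqP.
  by rewrite subr_eq0 => /eqP.
split=> //; split=> [c x y|x y|] /=.
- by rewrite -{1}[x]areprK -{1}[y]areprK -aprojZ -aprojD E phiL.
- by rewrite -{1}[x]areprK -{1}[y]areprK -aprojM E phiM.
- by rewrite -aproj1 E.
Qed.

Section LinearExtension.
Variables (K : fieldType) (X : choiceType) (W : lmodType K) (f : X -> W).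

Definition linext (u : {malg K[X]}) : W := \sum_(x <- msupp u) u@_x *: f x.

Lemma linextEw (d : {fset X}) u :
  (msupp u `<=` d)%fset -> linext u = \sum_(x <- d) u@_x *: f x.
Proof.
move=> le; apply: big_fset_incl => // x xd /mcoeff_outdom ->.
by rewrite scale0r.
Qed.

Lemma linext_linear c u v : linext (c *: u + v) = c *: linext u + linext v.
Proof.
pose d := (msupp u `|` msupp v)%fset.
have du : (msupp u `<=` d)%fset by exact: fsubsetUl.
have dv : (msupp v `<=` d)%fset by exact: fsubsetUr.
have dw : (msupp (c *: u + v) `<=` d)%fset.
  apply: fsubset_trans (msuppD_le _ _) _.
  by apply: fsetSU; exact: msuppZ_le.
rewrite (linextEw du) (linextEw dv) (linextEw dw) scaler_sumr -big_split /=.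
by apply: eq_bigr => x _; rewrite mcoeffD mcoeffZ scalerDl scalerA.
Qed.

Lemma linextU x : linext << x >> = f x.
Proof.
by rewrite (linextEw msuppU_le) big_seq_fset1 mcoeffUU scale1r.
Qed.

End LinearExtension.

Section Tensor.
Variables (K : fieldType) (A B : lmodType K).

Definition bilinear_rels : set {malg K[(A * B)%type]} :=
  [set r | (exists c a a' b,
              r = << (c *: a + a', b) >> - (c *: << (a, b) >> + << (a', b) >>))
        \/ (exists c a b b',
              r = << (a, c *: b + b') >> - (c *: << (a, b) >> + << (a, b') >>))].

Definition tensor : Type := quotsp (Subspace (span_subspace bilinear_rels)).

HB.instance Definition _ := GRing.Lmodule.on tensor.

Definition tens (a : A) (b : B) : tensor := qproj _ << (a, b) >>.

(* The linear map with a \ox b |-> f a b, for f bilinear. *)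
Definition tlift (W : lmodType K) (f : A -> B -> W) (t : tensor) : W :=
  linext (fun ab => f ab.1 ab.2) (qrepr t).

End Tensor.

Notation "a \ox b" := (tens a b) : ring_scope.

Definition bilinear_map (K : fieldType) (A B W : lmodType K)
    (f : A -> B -> W) : Prop :=
  (forall c a a' b, f (c *: a + a') b = c *: f a b + f a' b) /\
  (forall c a b b', f a (c *: b + b') = c *: f a b + f a b').

Section TensorTheory.
Variables (K : fieldType) (A B : lmodType K).
Local Notation AB := (tensor A B).

Lemma tens_bilinear : bilinear_map (@tens K A B).
Proof.
split=> [c a a' b|c a b b']; rewrite /tens -qprojZ -qprojD;
  apply/qproj_eqP; apply: sub_span; [left|right];
  by [exists c, a, a', b|exists c, a, b, b'].
Qed.

Lemma tliftE (W : lmodType K) (f : A -> B -> W) : bilinear_map f ->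
  forall u, tlift f (qproj _ u) = linext (fun ab => f ab.1 ab.2) u.
Proof.
move=> [fl fr] u; rewrite /tlift; set F := fun ab : A * B => _.
set v := qrepr _.
have vu : lspan (@bilinear_rels K A B) (v - u).
  by have /qproj_eqP := qreprK (qproj (Subspace (span_subspace
    (@bilinear_rels K A B))) u).
suff F0 : lspan (@bilinear_rels K A B) `<=` [set r | linext F r = 0].
  rewrite -[v](subrK u) -[v - u]scale1r linext_linear (F0 _ vu).
  by rewrite scaler0 add0r.
apply: span_min => [|r [[c [a [a' [b ->]]]]|[c [a [b [b' ->]]]]]] /=.
- split=> [|c r s /= r0 s0]; last by rewrite linext_linear r0 s0 scaler0 addr0.
  by rewrite /= /linext msupp0 big_seq_fset0.
- by rewrite addrC -scaleN1r !linext_linear !linextU /F/= fl scaleN1r addNr.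
- by rewrite addrC -scaleN1r !linext_linear !linextU /F/= fr scaleN1r addNr.
Qed.

Lemma tlift_tens (W : lmodType K) (f : A -> B -> W) : bilinear_map f ->
  forall a b, tlift f (a \ox b) = f a b.
Proof. by move=> bf a b; rewrite tliftE // linextU. Qed.

Lemma tlift_linear (W : lmodType K) (f : A -> B -> W) : bilinear_map f ->
  forall c t u, tlift f (c *: t + u) = c *: tlift f t + tlift f u.
Proof.
move=> bf c t u; rewrite -[t]qreprK -[u]qreprK -qprojZ -qprojD !tliftE //.
exact: linext_linear.
Qed.

Lemma tlift_lcomb (W : lmodType K) (f f' : A -> B -> W) c t :
  tlift (fun a b => c *: f a b + f' a b) t = c *: tlift f t + tlift f' t.
Proof.
rewrite /tlift /linext scaler_sumr -big_split; apply: eq_bigr => ab _ /=.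
by rewrite scalerDr !scalerA mulrC.
Qed.

Lemma tens_ind (P : AB -> Prop) :
  P 0 -> (forall c a b t, P t -> P (c *: (a \ox b) + t)) -> forall t, P t.
Proof.
move=> P0 PL t; rewrite -[t]qreprK; move: (qrepr t) => u.
rewrite [u]monalgE; elim: (enum_fset _) => [|[a b] s IHs].
  by rewrite big_nil; have /qproj_eq0 -> := (subspaceP (Subspace
    (span_subspace (@bilinear_rels K A B)))).1.
rewrite big_cons qprojD; have -> : << u@_(a, b) *g (a, b) >> =
    u@_(a, b) *: << (a, b) >>.
  by apply/malgP=> k; rewrite mcoeffZ !mcoeffU mulrnAr mulr1.
by rewrite qprojZ; apply: PL.
Qed.

Lemma tlift_ext (W : lmodType K) (f f' : AB -> W) :
  (forall c t u, f (c *: t + u) = c *: f t + f u) ->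
  (forall c t u, f' (c *: t + u) = c *: f' t + f' u) ->
  (forall a b, f (a \ox b) = f' (a \ox b)) -> f =1 f'.
Proof.
move=> lf lf' e; elim/tens_ind => [|c a b t IHt]; last by rewrite lf lf' e IHt.
have := lf (-1) 0 0; have := lf' (-1) 0 0.
by rewrite !scaler0 !addr0 !scaleN1r !addNr => -> ->.
Qed.

End TensorTheory.

Section TensorMaps.
Variables (K : fieldType).

(* tmap f g (a \ox b) = f a \ox g b for linear f and g. *)
Definition tmap (A B A' B' : lmodType K) (f : A -> A') (g : B -> B') :
  tensor A B -> tensor A' B' := tlift (fun a b => f a \ox g b).

Definition tswap (A B : lmodType K) : tensor A B -> tensor B A :=
  tlift (fun a b => b \ox a).

Lemma tmap_tens (A B A' B' : lmodType K) (f : A -> A') (g : B -> B') a b :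
  (forall (c : K) u v, f (c *: u + v) = c *: f u + f v) ->
  (forall (c : K) u v, g (c *: u + v) = c *: g u + g v) ->
  tmap f g (a \ox b) = f a \ox g b.
Proof.
move=> lf lg; have [tl tr] := tens_bilinear A' B'.
by apply: tlift_tens; split=> *; rewrite ?lf ?lg ?tl ?tr.
Qed.

Lemma tswap_tens (A B : lmodType K) (a : A) (b : B) :
  tswap (a \ox b) = b \ox a.
Proof. by apply: tlift_tens; have [tl tr] := tens_bilinear B A; split. Qed.

Variables (A B : algType K).

Definition tmul (t u : tensor A B) : tensor A B :=
  tlift (fun a b => tlift (fun a' b' => (a * a') \ox (b * b')) u) t.

Lemma tmul_bilinear2 (a : A) (b : B) :
  bilinear_map (fun a' b' => (a * a') \ox (b * b')).
Proof.
have [tl tr] := tens_bilinear A B.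
by split=> *; rewrite mulrDr -scalerAr ?tl ?tr.
Qed.

Lemma tmul_bilinear1 (u : tensor A B) :
  bilinear_map (fun a b => tlift (fun a' b' => (a * a') \ox (b * b')) u).
Proof.
have [tl tr] := tens_bilinear A B.
by split=> *; rewrite -tlift_lcomb; apply: eq_bigr => -[x y] _ /=;
  congr (_ *: _); rewrite mulrDl -scalerAl ?tl ?tr.
Qed.

Lemma tmul_tens (a a' : A) (b b' : B) :
  tmul (a \ox b) (a' \ox b') = (a * a') \ox (b * b').
Proof.
rewrite /tmul tlift_tens; last exact: tmul_bilinear1.
by rewrite tlift_tens //; exact: tmul_bilinear2.
Qed.

End TensorMaps.

Section Coradical.
Variables (K : fieldType) (C : lmodType K) (Delta : C -> tensor C C).

Definition tens_sub (U V : set C) : set (tensor C C) :=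
  lspan [set t | exists u v, [/\ U u, V v & t = u \ox v]].

Definition subcoalgebra (U : set C) : Prop :=
  is_subspace U /\ forall u, U u -> tens_sub U U (Delta u).

Definition simple_subcoalgebra (U : set C) : Prop :=
  [/\ subcoalgebra U, (exists2 u, U u & u <> 0) &
      forall V : set C, subcoalgebra V -> V `<=` U ->
        V = [set 0] \/ V = U].

Definition coradical : set C :=
  lspan (\bigcup_(U in simple_subcoalgebra) U).

Fixpoint coradical_filtration (n : nat) : set C :=
  match n with
  | 0 => coradical
  | m.+1 => Delta @^-1` lspan (tens_sub (coradical_filtration m) setT `|`
                              tens_sub setT coradical)
  end.

End Coradical.

Definition cop (K : fieldType) (C : lmodType K) (Delta : C -> tensor C C) :
  C -> tensor C C := fun c => tswap (Delta c).

(* The comultiplication induced on A / J by one on A, which does not depend   *)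
(* on the representatives when J is a coideal: see quot_comulE.               *)
Definition quot_comul (K : fieldType) (A : algType K) (J : pideal A)
    (Delta : A -> tensor A A) (x : algquot J) :
    tensor (algquot J) (algquot J) :=
  tmap (aproj J) (aproj J) (Delta (arepr x)).

Lemma quot_comulE (K : fieldType) (A : algType K) (J : pideal A)
    (Delta : A -> tensor A A) :
  (forall (c : K) a b, Delta (c *: a + b) = c *: Delta a + Delta b) ->
  (forall a, J a -> tmap (aproj J) (aproj J) (Delta a) = 0) ->
  forall a, quot_comul Delta (aproj J a) = tmap (aproj J) (aproj J) (Delta a)
    :> tensor (algquot J) (algquot J).
Proof.
move=> DL DJ a; rewrite /quot_comul; set b := arepr _.
have /DJ b0 : J (b - a) by apply/aproj_eqP; rewrite areprK.
have pL (c : K) u v : aproj J (c *: u + v) = c *: aproj J u + aproj J v.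
  by rewrite aprojD aprojZ.
have [tl tr] := tens_bilinear (algquot J) (algquot J).
have pb : bilinear_map (fun u v => aproj J u \ox aproj J v).
  by split=> *; rewrite pL ?tl ?tr.
rewrite -[b](subrK a) -[b - a]scale1r DL /tmap (tlift_linear pb).
by rewrite [X in 1 *: X + _]b0 scaler0 add0r.
Qed.

(* The letters g and h are false and true, so that g < h and the order of     *)
(* [seqlexi bool] is the lexicographic one, proper prefixes being smaller.    *)
Definition word_lt (u v : seq bool) : bool :=
  ((u : seqlexi bool) < (v : seqlexi bool))%O.

Definition lyndon (a : seq bool) : Prop :=
  a != [::] /\
  (size a = 1%N \/
   forall b c, b != [::] -> c != [::] -> a = b ++ c -> word_lt a (c ++ b)).

Definition standard_factorization (a b c : seq bool) : Prop :=
  [/\ a = b ++ c, lyndon b, lyndon c &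
      forall b' c', a = b' ++ c' -> lyndon b' -> lyndon c' ->
        (size c' <= size c)%N].

Definition comm_br (A : pzRingType) (a b : A) : A := a * b - b * a.

Lemma malg_scalerAr (R : comNzRingType) (M : monomType) (c : R)
    (a b : {malg R[M]}) :
  c *: (a * b) = a * (c *: b).
Proof.
apply/malgP=> k; rewrite mcoeffZ [(a * b)@__]mcoeffMl.
rewrite (mcoeffMlw k (fsubset_refl _) (msuppZ_le c b)) mulr_sumr.
apply: eq_bigr => i _; rewrite mulr_sumr; apply: eq_bigr => j _.
by rewrite mcoeffZ mulrnAr mulrCA.
Qed.

Section FreeAlgebra.
Variable K : fieldType.

Definition freealg : Type := {malg K[{fmonom bool}]}.

HB.instance Definition _ := GRing.Lalgebra.on freealg.

HB.instance Definition _ := GRing.Lalgebra_isAlgebra.Build K freealg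
  (@malg_scalerAr K _).

Definition gT : freealg := << fmu false >>.
Definition hT : freealg := << fmu true >>.

Definition comul_letter (i : bool) : tensor freealg freealg :=
  if i then 1 \ox hT + hT \ox gT else gT \ox gT.

(* comul_free is multiplicative: a word w_1 ... w_n is mapped to the product  *)
(* of the comul_letter w_i.                                                   *)
Definition comul_free : freealg -> tensor freealg freealg :=
  linext (fun w : {fmonom bool} =>
    foldr (fun i t => tmul (comul_letter i) t) (1 \ox 1) (w : seq bool)).

Definition counit_letter (i : bool) : K := if i then 0 else 1.

Definition counit_word (w : {fmonom bool}) : K :=
  \prod_(i <- (w : seq bool)) counit_letter i.

Lemma counit_word_multiplicative : mmorphism counit_word.
Proof.
split=> [u v|]; first by rewrite /counit_word fmM big_cat.
by rewrite /counit_word fm1 big_nil.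
Qed.

HB.instance Definition _ :=
  isMultiplicative.Build {fmonom bool} K counit_word counit_word_multiplicative.

Definition counit_free : freealg -> K := mmap idfun counit_word.

(* lyndon_elt alpha x means x = E_alpha. *)
Inductive lyndon_elt : seq bool -> freealg -> Prop :=
| LyndonG : lyndon_elt [:: false] gT
| LyndonH : lyndon_elt [:: true] hT
| LyndonBr a b c x y : lyndon a -> standard_factorization a b c ->
    lyndon_elt b x -> lyndon_elt c y -> lyndon_elt a (comm_br x y).

(* E_alpha for alpha = g h ^ k *)
Fixpoint E_omega (k : nat) : freealg :=
  if k is l.+1 then comm_br (E_omega l) hT else gT.

Definition relsI : set freealg :=
  [set x | exists a,
    [/\ lyndon a, (2 <= count_mem false a)%N & lyndon_elt a x]].

End FreeAlgebra.

Section Tbar.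
Variable K : fieldType.

Lemma counit_free_character : is_character (@counit_free K).
Proof.
split=> [c x y|x y|]; rewrite /counit_free.
- by rewrite mmapD mmapZ.
- exact: rmorphM.
- exact: rmorph1.
Qed.

Lemma character_comm_br (A : algType K) (phi : A -> K) x y :
  is_character phi -> phi (comm_br x y) = 0.
Proof.
move=> [phiL phiM _]; rewrite /comm_br addrC -scaleN1r phiL !phiM.
by rewrite mulN1r mulrC addNr.
Qed.

Lemma counit_relsI x : relsI x -> counit_free x = 0 :> K.
Proof.
case=> a [_ + ax]; case: ax => // *.
exact: character_comm_br counit_free_character.
Qed.

Definition ideal_I : pideal (freealg K) :=
  PIdeal (ideal_is_ideal (@relsI K))
    (character_proper counit_free_character counit_relsI).

Definition Tbar : algType K := algquot ideal_I.

Definition comul_bar : Tbar -> tensor Tbar Tbar := quot_comul (@comul_free K).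

Definition counit_bar : Tbar -> K := @counit_free K \o @arepr K _ ideal_I.

Definition g_bar : Tbar := aproj ideal_I (gT K).
Definition h_bar : Tbar := aproj ideal_I (hT K).
Definition E_bar (k : nat) : Tbar := aproj ideal_I (E_omega K k).

Lemma counit_bar_character : is_character counit_bar.
Proof.
by have [] := character_quot (J := ideal_I) counit_free_character
  (character_ideal counit_free_character counit_relsI).
Qed.

Lemma counit_barE a : counit_bar (aproj ideal_I a) = counit_free a.
Proof.
exact: (character_quot (J := ideal_I) counit_free_character
  (character_ideal counit_free_character counit_relsI)).2.
Qed.

End Tbar.

Section Tp.
Variables (K : fieldType) (p : nat) (charKp : p \in [pchar K]).

Definition relsp : set (Tbar K) :=
  [set r | [\/ r = g_bar K ^+ p - 1, r = E_bar K p.-1, r = h_bar K ^+ p |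
     exists2 k, (1 <= k <= p - 2)%N & r = E_bar K k ^+ p]].

Lemma counit_relsp x : relsp x -> counit_bar x = 0.
Proof.
have p_gt1 := prime_gt1 (pcharf_prime charKp).
have chi := counit_bar_character K; have [phiL phiM phi1] := chi.
have X n (a : Tbar K) : counit_bar (a ^+ n) = counit_bar a ^+ n.
  elim: n => [|n IHn]; first by rewrite !expr0; exact: phi1.
  by rewrite !exprS phiM IHn.
have E0 k : (0 < k)%N -> counit_bar (E_bar K k) = 0.
  case: k => // k _; rewrite /E_bar counit_barE.
  exact: character_comm_br (counit_free_character K).
have Xp (a : Tbar K) : counit_bar a = 0 -> counit_bar (a ^+ p) = 0.
  by move=> a0; rewrite X a0 expr0n; case: (p) p_gt1.
have letterE i : @counit_free K << fmu i >> = counit_letter K i.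
  by rewrite /counit_free mmapU /= mul1r /counit_word fmU big_seq1.
case=> [->|->|->|[k /andP[k_gt0 _] ->]].
- rewrite addrC -scaleN1r phiL X phi1 mulN1r counit_barE letterE /=.
  by rewrite expr1n addNr.
- by apply: E0; case: (p) p_gt1 => // -[].
- by apply: Xp; rewrite counit_barE letterE.
- exact/Xp/E0.
Qed.

Definition ideal_p : pideal (Tbar K) :=
  PIdeal (ideal_is_ideal relsp)
    (character_proper (counit_bar_character K) counit_relsp).

Definition Tp : algType K := algquot ideal_p.

Definition comul_p : Tp -> tensor Tp Tp := quot_comul (@comul_bar K).

Definition y_p : Tp := aproj ideal_p (h_bar K).
Definition x_p : Tp := aproj ideal_p (g_bar K).
Definition E_p (k : nat) : Tp := aproj ideal_p (E_bar K k).

(* The inverse of g, as g ^ p = 1. *)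
Definition ginv_p : Tp := x_p ^+ p.-1.

Lemma ginv_pP : x_p * ginv_p = 1 /\ ginv_p * x_p = 1.
Proof.
have p_gt0 := prime_gt0 (pcharf_prime charKp).
have e : aproj ideal_p (g_bar K ^+ p) = 1.
  by rewrite -aproj1; apply/aproj_eqP; apply: (sub_ideal (S := relsp));
    exact: Or41.
by rewrite /ginv_p -exprS -exprSr prednK // /x_p -aprojX e.
Qed.

Definition xE (m : nat) : Tp := E_p m * ginv_p.

Definition zE (n : nat) : Tp :=
  xE n - ((n.+1)`!%:R / 2%:R ^+ n) *: xE 1 ^+ n.

(* A monomial y^r z_(i_m)^(s_m) ... z_(i_2)^(s_2) x_1^s x^t is given by r, s, *)
(* t and the list l of the pairs (i_m, s_m), ..., (i_2, s_2).                 *)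
Definition z_indices (l : seq (nat * nat)) : bool :=
  sorted (fun i j => j < i)%N [seq q.1 | q <- l] && all (fun q => 2 <= q.1)%N l.

Definition monomial_p (r : nat) (l : seq (nat * nat)) (s t : nat) : Tp :=
  y_p ^+ r * (\prod_(q <- l) zE q.1 ^+ q.2) * xE 1 ^+ s * x_p ^+ t.

Definition monomial_weight (r : nat) (l : seq (nat * nat)) (s : nat) : nat :=
  (r + \sum_(q <- l) (q.1 - 1) * q.2 + s)%N.

Definition filt_F (n : nat) : set Tp :=
  lspan [set e | exists r l s t,
    [/\ z_indices l, (monomial_weight r l s <= n)%N & e = monomial_p r l s t]].

End Tp.

(* Main.v *)
Require Import Defs.
From HB Require Import structures.
From mathcomp Require Import all_boot all_order all_algebra.
From mathcomp Require Import boolp classical_sets.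
From mathcomp Require Import finmap monalg ring.

(** Write T_p for the quotient Hopf algebra, Delta for its coproduct, E_k for
    the iterated commutators of g with h, and C_n for its coradical
    filtration.

    The E_k commute, because the word g h^i g h^j with i < j is Lyndon with
    standard factorization (g h^i)(g h^j); conversely a morphism under which
    the images of the E_k commute kills every E_alpha in which g occurs at
    least twice.  Hence commuting of the E_k together with the finitely many
    relations defining T_p is a complete presentation.  The coproduct respects
    it: Delta(E_n) is the sum of the E_j (x) B_(n+1,j+1), where the B are
    partial Bell polynomials in the commuting E_k, and the B_(p,j) with
    1 < j < p vanish in characteristic p.

    The elements x_m are coordinates of Faa di Bruno type.  The z_n satisfy
    z_(k+1) = [z_k, h] + z_k x_1 + k c_k x_1^(k-1) z_2 with c_n = (n+1)!/2^n,
    and z_2 is skew primitive.  By induction Delta is filtered for the weights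
    1 of h and of x_1 and n-1 of z_n ([Delta_FF]), which gives that F_n is
    contained in C_n.

    For the other inclusion, let a functional f act by u |-> (id (x) f) Delta(u)
    and put B_0 = 0, B_(n+1) = the elements which every f vanishing on the
    powers of g sends into B_n ([annpow]).  If C_0 = F_0 and C_n = F_n = B_(n+1)
    then the definition of C_(n+1) gives that C_(n+1) is contained in B_(n+2),
    so that everything rests on B_(n+1) being contained in F_n ([annpow_FF]).
    Every element of T_p is a polynomial in h, z_(p-2), ..., z_2, x_1 and g,
    and those of B_(n+1) are treated one generator at a time ([peel]): for each
    of h, z_(p-2), ..., z_2, x_1 there is an operator which differentiates with
    respect to this generator, up to a nonzero constant, and which lowers the
    index of B by its weight.  For h it is the action of a functional dual to
    h.  For the others, functionals e_1 and e_2 act on the coordinates as the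
    vector fields t^2 d/dt and t^3 d/dt, and iterated commutators give nonzero
    multiples of the fields t^(N+1) d/dt for N <= p - 2.  The functionals
    needed are matrix entries of one representation of dimension 4, which
    exists because p > 3.

    Finally C_0 = F_0, because a nonzero right coideal contains some power of g
    ([right_coideal_grouplike]): an element of least filtration degree is a
    combination of powers of g, which are separated by the eigenvalues of the
    action of e_0.  The opposite coproduct has the same coradical; the action
    of functionals on the other side gives the same annihilators
    ([annpow_hitl]), because the two actions commute and functionals separate
    the elements of T_p. *)

Set Implicit Arguments.
Unset Strict Implicit.
Unset Printing Implicit Defensive.

Import Order.TTheory GRing.Theory.

Local Open Scope classical_set_scope.
Local Open Scope ring_scope.

(** * Linear maps, subspaces and the tensor product of algebras *)

Definition lin (K : fieldType) (V W : lmodType K) (f : V -> W) : Prop :=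
  forall c u v, f (c *: u + v) = c *: f u + f v.

Section LinearMaps.
Variables (K : fieldType) (V W : lmodType K) (f : V -> W).
Hypothesis lf : lin f.

Lemma lin0 : f 0 = 0.
Proof. by have := lf (-1) 0 0; rewrite !scaler0 addr0 scaleN1r addNr. Qed.

Lemma linD u v : f (u + v) = f u + f v.
Proof. by have := lf 1 u v; rewrite !scale1r. Qed.

Lemma linZ c u : f (c *: u) = c *: f u.
Proof. by have := lf c u 0; rewrite lin0 !addr0. Qed.

Lemma linB u v : f (u - v) = f u - f v.
Proof. by rewrite linD -scaleN1r linZ scaleN1r. Qed.

Lemma lin_sum (I : Type) (r : seq I) (F : I -> V) :
  f (\sum_(i <- r) F i) = \sum_(i <- r) f (F i).
Proof.
by elim: r => [|i r IH]; rewrite ?big_nil ?lin0 // !big_cons linD IH.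
Qed.

End LinearMaps.

Section AlgebraLinear.
Variables (K : fieldType) (A : algType K).

Lemma mull_lin (w : A) : lin (fun t : A => t * w).
Proof. by move=> c u v; rewrite mulrDl -scalerAl. Qed.

Lemma mulr_lin (w : A) : lin (fun t : A => w * t).
Proof. by move=> c u v; rewrite mulrDr; congr (_ + _); rewrite [RHS]scalerAr. Qed.

End AlgebraLinear.

Section Subspaces.
Variables (K : fieldType) (V : lmodType K) (U : set V).
Hypothesis sU : is_subspace U.

Lemma subspaceZ c u : U u -> U (c *: u).
Proof. by case: sU => U0 UL Uu; rewrite -[_ *: _]addr0; apply: UL. Qed.

Lemma subspaceD u v : U u -> U v -> U (u + v).
Proof. by case: sU => U0 UL Uu Uv; rewrite -[u]scale1r; apply: UL. Qed.

Lemma subspaceB u v : U u -> U v -> U (u - v).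
Proof. by move=> Uu Uv; apply: subspaceD => //; rewrite -scaleN1r; apply: subspaceZ. Qed.

Lemma subspace_sum (I : Type) (r : seq I) (F : I -> V) :
  (forall i, U (F i)) -> U (\sum_(i <- r) F i).
Proof.
move=> UF; elim: r => [|i r IH]; first by rewrite big_nil; case: sU.
by rewrite big_cons; apply: subspaceD.
Qed.

End Subspaces.

Lemma mem_lspan (K : fieldType) (V : lmodType K) (S : set V) (v : V) :
  S v -> lspan S v.
Proof. by move=> Sv U [_ SU]; exact: SU. Qed.

Lemma preim_subspace (K : fieldType) (V W : lmodType K) (f : V -> W)
    (U : set W) : lin f -> is_subspace U -> is_subspace (f @^-1` U).
Proof.
move=> lf [U0 UL]; split=> [|c u v Uu Uv] /=; first by rewrite (lin0 lf).
by rewrite lf; apply: UL.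
Qed.

Lemma scaler_exchange (K : fieldType) (V : lmodType K) (c d : K) (x y z w : V) :
  d *: (c *: x + y) + (c *: z + w) = c *: (d *: x + z) + (d *: y + w).
Proof. by rewrite !scalerDr !scalerA [d * c]mulrC addrACA. Qed.

(** A bilinear product on a module spanned by pure tensors satisfies the ring
    axioms as soon as the pure tensors do; the module [T] is abstract so that
    conversion cannot unfold the quotient which defines the tensor product. *)
Section BilinearRing.
Variables (K : fieldType) (A B : algType K) (T : lmodType K).
Variables (tns : A -> B -> T) (m : T -> T -> T).
Hypothesis tns_ind : forall P : T -> Prop,
  P 0 -> (forall c a b t, P t -> P (c *: tns a b + t)) -> forall t, P t.
Hypothesis ml : forall u, lin (m^~ u).
Hypothesis mr : forall a b, lin (m (tns a b)).
Hypothesis mt : forall a a' b b',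
  m (tns a b) (tns a' b') = tns (a * a') (b * b').

Lemma bilin_linr t : lin (m t).
Proof.
move=> c u v; elim/tns_ind: t => [|d a b t IH].
  by rewrite !(lin0 (ml _)) scaler0 addr0.
rewrite !ml IH mr; exact: scaler_exchange.
Qed.

Lemma bilin_mulA : associative m.
Proof.
have mR := bilin_linr.
move=> t u v; elim/tns_ind: t => [|c a b t IH]; first by rewrite !(lin0 (ml _)).
rewrite !ml {}IH; congr (c *: _ + _).
elim/tns_ind: u => [|{}c a' b' u IH].
  by rewrite (lin0 (ml v)) !(lin0 (mR _)) (lin0 (ml v)).
rewrite ml !mR ml {}IH; congr (c *: _ + _).
elim/tns_ind: v => [|{}c a'' b'' v IH]; first by rewrite !(lin0 (mR _)).
by rewrite !mR {}IH !mt !mulrA.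
Qed.

Lemma bilin_mul1t : left_id (tns 1 1) m.
Proof.
have mR := bilin_linr.
elim/tns_ind => [|c a b t IH]; first by rewrite (lin0 (mR _)).
by rewrite mR IH mt !mul1r.
Qed.

Lemma bilin_mult1 : right_id (tns 1 1) m.
Proof.
elim/tns_ind => [|c a b t IH]; first by rewrite (lin0 (ml _)).
by rewrite ml IH mt !mulr1.
Qed.

Lemma bilin_mulDl : left_distributive m +%R.
Proof. by move=> t u v; rewrite (linD (ml v)). Qed.

Lemma bilin_scaleAl c t u : c *: m t u = m (c *: t) u.
Proof. by rewrite (linZ (ml u)). Qed.

Lemma bilin_scaleAr c t u : c *: m t u = m t (c *: u).
Proof. by rewrite (linZ (bilin_linr t)). Qed.

Lemma bilin_mulDr : right_distributive m +%R.
Proof. by move=> t u v; rewrite (linD (bilin_linr t)). Qed.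

End BilinearRing.

Section TensorRing.
Variables (K : fieldType) (A B : algType K).
Implicit Types t u v : tensor A B.

Lemma tmul_linl u : lin (fun t => tmul t u).
Proof. exact: tlift_linear (tmul_bilinear1 u). Qed.

Lemma tmul_lin_tens (a : A) (b : B) : lin (tmul (a \ox b)).
Proof.
move=> c u v; have E w : tmul (a \ox b) w = _ := tlift_tens (tmul_bilinear1 w) a b.
rewrite (E (c *: u + v)) (E u) (E v); exact: (tlift_linear (tmul_bilinear2 a b)).
Qed.

Lemma tmul_linr t : lin (tmul t).
Proof. exact: (bilin_linr (@tens_ind K A B) tmul_linl tmul_lin_tens). Qed.

Lemma tmulA : associative (@tmul K A B).
Proof.
exact: (bilin_mulA (@tens_ind K A B) tmul_linl tmul_lin_tens (@tmul_tens K A B)).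
Qed.

Lemma tmul1t : left_id (1 \ox 1) (@tmul K A B).
Proof.
exact: (bilin_mul1t (@tens_ind K A B) tmul_linl tmul_lin_tens (@tmul_tens K A B)).
Qed.

Lemma tmult1 : right_id (1 \ox 1) (@tmul K A B).
Proof. exact: (bilin_mult1 (@tens_ind K A B) tmul_linl (@tmul_tens K A B)). Qed.

Lemma tmulDl : left_distributive (@tmul K A B) +%R.
Proof. exact: (bilin_mulDl tmul_linl). Qed.

Lemma tmulDr : right_distributive (@tmul K A B) +%R.
Proof. exact: (bilin_mulDr (@tens_ind K A B) tmul_linl tmul_lin_tens). Qed.

Lemma tscaleAl c t u : c *: tmul t u = tmul (c *: t) u.
Proof. exact: (bilin_scaleAl tmul_linl). Qed.

Lemma tscaleAr c t u : c *: tmul t u = tmul t (c *: u).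
Proof. exact: (bilin_scaleAr (@tens_ind K A B) tmul_linl tmul_lin_tens). Qed.

End TensorRing.

Section TensorAlgebra.
Variables (K : fieldType) (A : algType K) (eps : A -> K).
Hypothesis chi : is_character eps.

Lemma tens_one_neq0 : (1 : A) \ox (1 : A) != 0.
Proof.
have [epsL epsM eps1] := chi.
have bf : bilinear_map (fun a b => (eps a * eps b : K^o)).
  split=> [c a a' b|c a b b'].
    by rewrite epsL mulrDl -mulrA.
  by rewrite epsL mulrDr mulrCA.
apply/eqP => /(congr1 (tlift (fun a b => (eps a * eps b : K^o)))).
rewrite (tlift_tens bf) (lin0 (tlift_linear bf)) eps1 mulr1.
exact/eqP/oner_neq0.
Qed.

End TensorAlgebra.

(** A (x) A as an algebra: the character ensures 1 (x) 1 != 0, which an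
    [algType] demands. *)
Definition tensor_alg (K : fieldType) (A : algType K) (eps : A -> K)
  (chi : is_character eps) : Type := tensor A A.

Section TensorAlgebraInstances.
Variables (K : fieldType) (A : algType K) (eps : A -> K).
Hypothesis chi : is_character eps.
Local Notation T := (tensor_alg chi).

HB.instance Definition _ := GRing.Lmodule.on T.
HB.instance Definition _ := GRing.Zmodule_isNzRing.Build T (@tmulA K A A)
  (@tmul1t K A A) (@tmult1 K A A) (@tmulDl K A A) (@tmulDr K A A)
  (tens_one_neq0 chi).
HB.instance Definition _ := GRing.Lmodule_isLalgebra.Build K T
  (@tscaleAl K A A).
HB.instance Definition _ := GRing.Lalgebra_isAlgebra.Build K T
  (@tscaleAr K A A).

End TensorAlgebraInstances.

(** * Iterated commutators *)

Section Commutators.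
Variable R : pzRingType.
Implicit Types u v h : R.

Lemma comm_brM h u v : comm_br (u * v) h = u * comm_br v h + comm_br u h * v.
Proof. by rewrite /comm_br mulrBr mulrBl !mulrA addrA subrK. Qed.

Lemma comm_brD h u v : comm_br (u + v) h = comm_br u h + comm_br v h.
Proof. by rewrite /comm_br mulrDl mulrDr opprD addrACA. Qed.

Lemma comm_br1 h : comm_br 1 h = 0.
Proof. by rewrite /comm_br mul1r mulr1 subrr. Qed.

Lemma comm_br0 h : comm_br 0 h = 0.
Proof. by rewrite /comm_br mul0r mulr0 subrr. Qed.

Lemma comm_brMn h u n : comm_br (u *+ n) h = comm_br u h *+ n.
Proof. by rewrite /comm_br mulrnAl mulrnAr mulrnBl. Qed.

Definition ad_iter g h n : R := iter n (fun u => comm_br u h) g.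

Lemma ad_iterS g h n : ad_iter g h n.+1 = comm_br (ad_iter g h n) h.
Proof. by []. Qed.

End Commutators.

Arguments ad_iter : simpl never.

Section EAlgebra.
Variables (K : fieldType) (A : algType K) (g h : A).
Local Notation E := (ad_iter g h).

(** This subalgebra is stable under commutation with h, and it is commutative
    once the E_k commute. *)
Inductive Ealg : A -> Prop :=
| Ealg1 : Ealg 1
| EalgL c u v : Ealg u -> Ealg v -> Ealg (c *: u + v)
| EalgE k u : Ealg u -> Ealg (u * E k).

Hypothesis EC : forall i j, E i * E j = E j * E i.

Lemma Ealg_subspace : is_subspace Ealg.
Proof.
split; last exact: EalgL.
by rewrite -(addNr (1 : A)) -scaleN1r; apply: EalgL; exact: Ealg1.
Qed.

Lemma EalgM u v : Ealg u -> Ealg v -> Ealg (u * v).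
Proof.
move=> Su; elim=> [|c v1 v2 _ IH1 _ IH2|k v1 _ IH]; first by rewrite mulr1.
  by rewrite mulrDr -scalerAr; apply: EalgL.
by rewrite mulrA; apply: EalgE.
Qed.

Lemma Ealg_E k : Ealg (E k).
Proof. by rewrite -[E k]mul1r; apply/EalgE/Ealg1. Qed.

Lemma EalgX n u : Ealg u -> Ealg (u ^+ n).
Proof.
by move=> Su; elim: n => [|n IH]; [exact: Ealg1|rewrite exprS; exact: EalgM].
Qed.

Lemma EalgC u v : Ealg u -> Ealg v -> u * v = v * u.
Proof.
move=> + Sv; elim=> [|c u1 u2 _ IH1 _ IH2|k u1 _ IH].
- by rewrite mul1r mulr1.
- by rewrite mulrDl mulrDr -scalerAl -scalerAr IH1 IH2.
rewrite -mulrA; have -> : E k * v = v * E k; last by rewrite mulrA IH mulrA.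
elim: Sv => [|c v1 v2 _ IH1 _ IH2|l v1 _ IHv]; first by rewrite mul1r mulr1.
  by rewrite mulrDl mulrDr -scalerAl -scalerAr IH1 IH2.
by rewrite mulrA IHv -mulrA EC mulrA.
Qed.

Lemma comm_brZ c u : comm_br (c *: u) h = c *: comm_br u h.
Proof. by rewrite /comm_br -scalerAl -scalerAr scalerBr. Qed.

Lemma comm_br_sum n (F : 'I_n -> A) :
  comm_br (\sum_(j < n) F j) h = \sum_(j < n) comm_br (F j) h.
Proof. by rewrite /comm_br mulr_suml mulr_sumr -sumrB. Qed.

Lemma Ealg_comm_br u : Ealg u -> Ealg (comm_br u h).
Proof.
elim=> [|c u1 u2 _ IH1 _ IH2|k u1 Su IH].
- by rewrite comm_br1; case: Ealg_subspace.
- by rewrite comm_brD comm_brZ; apply: EalgL.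
rewrite comm_brM; apply: (subspaceD Ealg_subspace); last exact: EalgE.
exact: EalgM Su (Ealg_E k.+1).
Qed.

(** The partial Bell polynomials B_(n, j) in the E's: with D = comm_br _ h,
    the n-th iterate of 1 (x) D + D (x) g maps u (x) 1 to the sum of the
    D^j(u) (x) B_(n, j). *)
Fixpoint bell (n j : nat) : A :=
  match n, j with
  | 0, 0 => 1
  | 0, _ => 0
  | m.+1, 0 => comm_br (bell m 0) h
  | m.+1, i.+1 => comm_br (bell m i.+1) h + bell m i * g
  end.

Lemma Ealg_bell n j : Ealg (bell n j).
Proof.
elim: n j => [|n IH] [|j] /=; first exact: Ealg1; first by case: Ealg_subspace.
  exact: Ealg_comm_br.
apply: (subspaceD Ealg_subspace); first exact: Ealg_comm_br.
exact: EalgM (IH _) (Ealg_E 0).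
Qed.

Lemma bell0 n : bell n.+1 0 = 0.
Proof. by elim: n => [|n IH] /=; rewrite ?comm_br1 // -/(bell n.+1 0) IH comm_br0. Qed.

Lemma bell1 n : bell n.+1 1 = E n.
Proof.
elim: n => [|n IH]; first by rewrite /= comm_br0 add0r mul1r.
by rewrite -[LHS]/(comm_br (bell n.+1 1) h + bell n.+1 0 * g) IH bell0 mul0r addr0.
Qed.

Lemma bell_gt n j : (n < j)%N -> bell n j = 0.
Proof.
elim: n j => [|n IH] [|j] //= lt; rewrite !IH ?comm_br0 ?mul0r ?addr0 //.
exact: ltnW.
Qed.

Lemma bellS n j : bell n.+1 j.+1 = comm_br (bell n j.+1) h + bell n j * g.
Proof. by []. Qed.

Arguments bell : simpl never.

(** With phi the series of the E_j t^(j+1)/(j+1)!, the exponential generating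
    function of the B_(n, k) is phi^k/k!; comparing coefficients in
    (k+1) phi^(k+1)/(k+1)! = phi phi^k/k! gives this recursion. *)
Lemma bell_rec n k :
  bell n k.+1 *+ k.+1 = \sum_(j < n) (E j * bell (n - j.+1) k) *+ 'C(n, j.+1).
Proof.
elim: n k => [|n IH] k; first by rewrite big_ord0 mul0rn.
pose Y m : A := if k is l.+1 then bell m l else 0.
have XS m : bell m.+1 k = comm_br (bell m k) h + Y m * g.
  rewrite /Y; case: (k) => [|l]; last exact: bellS.
  by rewrite mul0r addr0.
have XY m : (m <= n)%N -> comm_br (bell m k) h = bell m.+1 k - Y m * g.
  by move=> _; rewrite XS addrK.
have kX : bell n k *+ k = \sum_(j < n) (E j * Y (n - j.+1)%N) *+ 'C(n, j.+1).
  rewrite /Y; case: (k) => [|l]; last exact: IH.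
  by rewrite big1 // => j _; rewrite mulr0 mul0rn.
have SY m : Ealg (Y m).
  by rewrite /Y; case: (k) => [|l]; [case: Ealg_subspace|exact: Ealg_bell].
have -> : bell n.+1 k.+1 *+ k.+1 =
    comm_br (bell n k.+1 *+ k.+1) h + (bell n k *+ k) * g + bell n k * g.
  by rewrite bellS mulrnDl comm_brMn mulrnAl -addrA -mulrSr.
rewrite IH kX comm_br_sum mulr_suml.
under [\sum_(j < n) comm_br _ _]eq_bigr => j _.
  rewrite comm_brMn comm_brM XY ?leq_subr // mulrBr mulrnDl mulrnBl.
  rewrite mulrA addrAC; over.
rewrite sumrB.
under [X in _ - X]eq_bigr => j _ do rewrite -mulrnAl.
rewrite subrK big_split /=.
under [in RHS]eq_bigr => j _ do rewrite binS mulrnDr.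
rewrite big_split /= [in X in _ = X + _]big_ord_recr /= bin_small // mulr0n addr0.
rewrite [in X in _ = _ + X]big_ord_recl /= bin0 subn1 /= mulr1n.
rewrite [in RHS]addrA [in RHS]addrAC; congr (_ + _ + _).
- by apply: eq_bigr => j _; rewrite subSS subnSK.
- exact: EalgC (Ealg_bell _ _) (Ealg_E 0).
Qed.

Variable p : nat.
Hypothesis charKp : p \in [pchar K].

Lemma mulrn_charA (V : lmodType K) (u : V) : u *+ p = 0.
Proof. by rewrite -scaler_nat (pcharf0 charKp) scale0r. Qed.

Lemma natr_neq0 n : (0 < n < p)%N -> n%:R != 0 :> K.
Proof.
move=> /andP[n0 np]; rewrite -(dvdn_pcharf charKp).
by apply/negP => /(dvdn_leq n0); rewrite leqNgt np.
Qed.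

Lemma mulrn_dvdp (V : lmodType K) (u : V) m : (p %| m)%N -> u *+ m = 0.
Proof. by case/dvdnP=> q ->; rewrite mulrnA mulrn_charA. Qed.

(** The binomial coefficients C(p, j+1) in [bell_rec] are divisible by p,
    except for j = p-1, where the factor B_(0, k) = 0 appears. *)
Lemma bell_p j : E p.-1 = 0 -> (j < p)%N -> bell p j = 0.
Proof.
have pP := pcharf_prime charKp; have p0 := prime_gt0 pP.
move=> E0; case: j => [|[|k]] kp; first by rewrite -(prednK p0) bell0.
  by rewrite -(prednK p0) bell1.
have : bell p k.+2 *+ k.+2 = 0.
  rewrite bell_rec big1 // => j _.
  have [jp|jp] := eqVneq j.+1 p.
    by rewrite jp subnn mulr0 mul0rn.
  by rewrite mulrn_dvdp // prime_dvd_bin //= ltn_neqAle jp ltn_ord.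
move/eqP; rewrite -scaler_nat scaler_eq0 (negPf (natr_neq0 _)) //=.
by move/eqP.
Qed.

End EAlgebra.

Arguments bell : simpl never.

(** * The relations among the coproducts of the generators *)

Section TensorRelations.
Variables (K : fieldType) (A T : algType K) (tns : A -> A -> T) (g h : A).
Hypothesis tnsB : bilinear_map tns.
Hypothesis tnsM : forall a a' b b',
  tns a b * tns a' b' = tns (a * a') (b * b').
Hypothesis tns1 : tns 1 1 = 1.
Hypothesis EC : forall i j,
  ad_iter g h i * ad_iter g h j = ad_iter g h j * ad_iter g h i.
Local Notation E := (ad_iter g h).
Local Notation G := (tns g g).
Local Notation H := (tns 1 h + tns h g).

Lemma tns_linl b : lin (tns^~ b).
Proof. by case: tnsB => tl _ c u v; exact: tl. Qed.
Lemma tns_linr a : lin (tns a).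
Proof. by case: tnsB => _ tr c u v; exact: tr. Qed.

Definition Etens : set T :=
  lspan [set t | exists u v, [/\ Ealg g h u, Ealg g h v & t = tns u v]].

Lemma Etens_subspace : is_subspace Etens.
Proof. exact: span_subspace. Qed.

Lemma Etens_tns u v : Ealg g h u -> Ealg g h v -> Etens (tns u v).
Proof. by move=> Su Sv U [_ SU]; apply: SU; exists u, v. Qed.

Lemma EtensC t u : Etens t -> Etens u -> t * u = u * t.
Proof.
move=> Tt; have cU (w : T) : @is_subspace K T [set t | t * w = w * t].
  split=> [|c x y /= Ex Ey] /=; first by rewrite mul0r mulr0.
  by rewrite (mull_lin w c x y) (mulr_lin w c x y) Ex Ey.
have cV (w : T) : @is_subspace K T [set t | w * t = t * w].
  split=> [|c x y /= Ex Ey] /=; first by rewrite mul0r mulr0.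
  by rewrite (mull_lin w c x y) (mulr_lin w c x y) Ex Ey.
apply: (span_min (cV t)) => _ [a [b [Sa Sb ->]]] /=.
move: t Tt; apply: (span_min (cU _)) => _ [a' [b' [Sa' Sb' ->]]] /=.
by rewrite !tnsM (EalgC EC Sa Sa') (EalgC EC Sb Sb').
Qed.

Lemma comm_br_tns u v : Ealg g h v ->
  comm_br (tns u v) H = tns u (comm_br v h) + tns (comm_br u h) (v * g).
Proof.
move=> Sv; rewrite /comm_br mulrDr mulrDl !tnsM mulr1 mul1r.
rewrite (EalgC EC Sv (Ealg_E g h 0)).
by rewrite (linB (tns_linl _)) (linB (tns_linr _)) opprD addrACA.
Qed.

(** The first factor E_0 = g of the starting point g (x) g stands for D(u) with
    a fictitious u, whence the shift by one in the indices of B. *)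
Lemma ad_iter_tns n :
  ad_iter G H n = \sum_(j < n.+1) tns (E j) (bell g h n.+1 j.+1).
Proof.
elim: n => [|n IH].
  by rewrite big_ord_recl big_ord0 addr0 bell1.
rewrite ad_iterS IH comm_br_sum.
under eq_bigr => j _ do rewrite (comm_br_tns _ (Ealg_bell g h n.+1 j.+1)).
under [RHS]eq_bigr => j _ do rewrite bellS (linD (tns_linr _)).
rewrite !big_split /=; congr (_ + _).
  by rewrite [RHS]big_ord_recr /= (@bell_gt _ _ _ _ n.+1 n.+2) // comm_br0
    (lin0 (tns_linr _)) addr0.
rewrite [RHS]big_ord_recl /= bell0 mul0r (lin0 (tns_linr _)) add0r.
by apply: eq_bigr => j _; rewrite /bump add1n.
Qed.

Lemma Etens_ad_iter n : Etens (ad_iter G H n).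
Proof.
rewrite ad_iter_tns; apply: (subspace_sum Etens_subspace) => j.
by apply: Etens_tns; [exact: Ealg_E|exact: Ealg_bell].
Qed.

Lemma ad_iter_tnsC i j :
  ad_iter G H i * ad_iter G H j = ad_iter G H j * ad_iter G H i.
Proof. by apply: EtensC; exact: Etens_ad_iter. Qed.

Lemma tnsX a b n : tns a b ^+ n = tns (a ^+ n) (b ^+ n).
Proof. by elim: n => [|n IH]; rewrite ?expr0 // !exprS IH tnsM. Qed.

Variable p : nat.
Hypothesis charKp : p \in [pchar K].
Hypothesis Ep0 : E p.-1 = 0.

Lemma ad_iter_tns_p : ad_iter G H p.-1 = 0.
Proof.
have p0 := prime_gt0 (pcharf_prime charKp).
rewrite ad_iter_tns prednK // big1 // => j _.
have [jp|jp] := eqVneq (j : nat) p.-1; first by rewrite jp Ep0 (lin0 (tns_linl _)).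
rewrite (bell_p EC charKp Ep0) ?(lin0 (tns_linr _)) //.
by rewrite -ltn_predRL ltn_neqAle jp -ltnS prednK // ltn_ord.
Qed.

(** In characteristic p the p-th power is additive on commuting elements. *)
Lemma frobenius_sum0 n (F : 'I_n -> T) : (forall j, Etens (F j)) ->
  (forall j, F j ^+ p = 0) -> (\sum_(j < n) F j) ^+ p = 0.
Proof.
have charT : p \in [pchar T] by rewrite (pchar_lalg T).
elim: n F => [|n IH] F TF F0.
  by rewrite big_ord0 expr0n; case: p (prime_gt0 (pcharf_prime charKp)).
rewrite big_ord_recr /= -(pFrobenius_autE charT) pFrobenius_autD_comm.
  by rewrite !pFrobenius_autE F0 addr0 IH.
by apply: EtensC => //; exact: (subspace_sum Etens_subspace).
Qed.

Lemma ad_iter_tns_exp k : (0 < k)%N -> (forall j, (0 < j <= k)%N -> E j ^+ p = 0) ->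
  ad_iter G H k ^+ p = 0.
Proof.
move=> k0 E0; rewrite ad_iter_tns; apply: frobenius_sum0 => j.
  by apply: Etens_tns; [exact: Ealg_E|exact: Ealg_bell].
rewrite tnsX; case: j => -[|j] /= jk.
  by rewrite bell1 (E0 k) ?k0 ?leqnn // (lin0 (tns_linr _)).
by rewrite (E0 j.+1) ?(lin0 (tns_linl _)) //= -ltnS.
Qed.

(** The n-th iterate, applied to 1 (x) 1, of t |-> [t, 1 (x) h] + t (h (x) g). *)
Definition bell_tns n : T := \sum_(j < n.+1) tns (h ^+ j) (bell g h n j).

Lemma bell_tnsS n :
  bell_tns n * H = tns 1 h * bell_tns n + bell_tns n.+1.
Proof.
have D u v : tns u v * tns 1 h = tns 1 h * tns u v + tns u (comm_br v h).
  by rewrite !tnsM mulr1 mul1r -(linD (tns_linr u)) /comm_br addrC subrK.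
rewrite mulrDr /bell_tns !mulr_suml mulr_sumr.
under eq_bigr => j _ do rewrite D.
rewrite big_split /= -addrA; congr (_ + _).
rewrite [in RHS]big_ord_recl /=.
under [in RHS]eq_bigr => j _ do rewrite bellS (linD (tns_linr _)).
rewrite big_split /= addrA; congr (_ + _).
  rewrite [in RHS]big_ord_recr /= (@bell_gt _ _ _ _ n n.+1) // comm_br0.
  rewrite (lin0 (tns_linr _)) addr0 big_ord_recl /=; congr (_ + _).
by apply: eq_bigr => j _; rewrite tnsM -exprSr /bump add1n.
Qed.

(** Right multiplication by H is the sum of left multiplication by 1 (x) h and
    of the operator iterated in [bell_tns]; these two commute. *)
Lemma exp_coproduct n : H ^+ n =
  \sum_(i < n.+1) (tns 1 (h ^+ i) * bell_tns (n - i)) *+ 'C(n, i).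
Proof.
elim: n => [|n IH].
  rewrite big_ord_recl big_ord0 addr0 expr0 mulr1n /bell_tns big_ord_recl.
  by rewrite big_ord0 addr0 !expr0 /bell /= tns1 mulr1.
have aX i : tns 1 (h ^+ i) * tns 1 h = tns 1 (h ^+ i.+1).
  by rewrite tnsM mulr1 exprSr.
rewrite exprSr IH mulr_suml.
under eq_bigr => i _ do
  rewrite mulrnAl -mulrA bell_tnsS mulrDr mulrnDl mulrA aX.
rewrite big_split /= [RHS]big_ord_recl /=.
under [in RHS]eq_bigr => i _ do rewrite /bump add1n binS mulrnDr subSS.
rewrite big_split /= [in RHS]addrA [in LHS]addrC; congr (_ + _).
rewrite [in RHS]big_ord_recr /= (@bin_small n n.+1) // mulr0n addr0 big_ord_recl /= !bin0.
rewrite subn0; congr (_ + _).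
by apply: eq_bigr => i _; rewrite /bump add1n subnSK.
Qed.

Lemma coproduct_exp_p : h ^+ p = 0 -> H ^+ p = 0.
Proof.
have pP := pcharf_prime charKp; have p0 := prime_gt0 pP.
move=> hp; rewrite exp_coproduct big1 // => i _.
have [ip|ip] := eqVneq (i : nat) p.
  by rewrite ip hp (lin0 (tns_linr _)) mul0r mul0rn.
have [i0|i0] := posnP i; last first.
  rewrite (mulrn_dvdp charKp) // prime_dvd_bin // i0 /=.
  by rewrite ltn_neqAle ip -ltnS ltn_ord.
rewrite i0 subn0 /bell_tns big1 ?mulr0 ?mul0rn // => j _.
have [jp|jp] := eqVneq (j : nat) p; first by rewrite jp hp (lin0 (tns_linl _)).
rewrite (bell_p EC charKp Ep0) ?(lin0 (tns_linr _)) //.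
by rewrite ltn_neqAle jp -ltnS ltn_ord.
Qed.

End TensorRelations.

(** * The relations defining the first quotient *)

Local Notation g_h k := (false :: nseq k true).

Lemma word_lt_cons x y u v :
  word_lt (x :: u) (y :: v) = (x <= y)%O && ((y <= x)%O ==> word_lt u v).
Proof. exact: ltxi_cons. Qed.

Lemma word_ltxx u : word_lt u u = false.
Proof. exact: Order.POrderTheory.ltxx. Qed.

(** Rotating to a letter g would give a smaller word. *)
Lemma lyndon_first_g c : lyndon (true :: c) -> false \notin c.
Proof.
case=> _ ly; apply/negP => /splitPr E; case: c / E ly => c1 c2 [|].
  by rewrite /= size_cat /= addnS.
by move=> /(_ (true :: c1) (false :: c2)) /= /(_ isT isT erefl); rewrite word_lt_cons.
Qed.

Lemma lyndon_nseq_h m : lyndon (nseq m true) -> m = 1%N.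
Proof.
case: m => [|[|m]] [_] //= [//|/(_ [:: true] (nseq m.+1 true) isT isT erefl)].
by rewrite -[_ ++ [:: true]](nseqD m.+1 1) addn1 word_ltxx.
Qed.

Lemma lyndon_g_h k : lyndon (g_h k).
Proof.
split=> //; case: k => [|k]; [by left|right] => -[|b0 b] [|x c] // _ _ /= [<- E].
have : all id (b ++ x :: c) by rewrite -E /= all_nseq orbT.
by rewrite all_cat /= => /and3P[_ -> _]; rewrite word_lt_cons.
Qed.

Lemma split_at_g i j b c : nseq i true ++ g_h j = b ++ false :: c ->
  b = nseq i true /\ c = nseq j true.
Proof.
elim: i b => [|i IH] [|x b] //=.
- by case=> ->.
- case=> _ E; have : all id (nseq j true) by rewrite all_nseq orbT.
  by rewrite E all_cat /= andbF.
- by case=> <- /IH[-> ->].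
Qed.

Lemma word_lt_nseq i m u v :
  word_lt (nseq i true ++ false :: u) (nseq (i + m.+1) true ++ v).
Proof. by elim: i => [|i IH]; rewrite /= word_lt_cons. Qed.

Lemma lyndon_g_h2 i j : (i < j)%N -> lyndon (g_h i ++ g_h j).
Proof.
move=> lt; split=> //; right=> -[|b0 b] [|x c] // _ _ [<- E].
rewrite !cat_cons word_lt_cons; case: x E => /= E; first by [].
have [-> ->] := split_at_g E.
by rewrite -(subnKC lt) addSnnS; exact: word_lt_nseq.
Qed.

Lemma std_g_h k : standard_factorization (g_h k.+1) (g_h k) [:: true].
Proof.
split; rewrite -?[true :: nseq k true]/(nseq k.+1 true).
- by rewrite /= -[_ ++ _](nseqD k 1) addn1.
- exact: lyndon_g_h.
- by split=> //; left.
move=> [|b0 b] c; first by move=> _ [].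
case=> _ E _; have : all (pred1 true) (b ++ c) by rewrite -E /= all_nseq orbT.
by rewrite all_cat => /andP[_ /all_pred1P {1}->] /lyndon_nseq_h ->.
Qed.

(** A proper suffix longer than g h^j begins with h and still contains a g,
    hence is not Lyndon. *)
Lemma std_g_h2 i j : standard_factorization (g_h i ++ g_h j) (g_h i) (g_h j).
Proof.
split=> //; [exact: lyndon_g_h|exact: lyndon_g_h|].
move=> [|b0 b] c; first by move=> _ [].
case=> _ E _ lc; rewrite leqNgt; apply/negP => lt.
have sb : (size b < i)%N.
  have /eqP := congr1 size E; rewrite !size_cat !size_nseq => /eqP Es.
  by rewrite -(ltn_add2r (size (g_h j))) Es ltn_add2l.
move: lc; have -> : c = true :: nseq (i - size b).-1 true ++ g_h j.
  rewrite -(drop_size_cat c (erefl (size b))) -E drop_cat size_nseq sb.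
  by rewrite drop_nseq -cat_cons; case: (i - size b)%N (subn_gt0 (size b) i) => [|m]; rewrite sb.
by move/lyndon_first_g; rewrite mem_cat inE eqxx orbT.
Qed.

Lemma lyndon_elt_E (K : fieldType) k : lyndon_elt (g_h k) (E_omega K k).
Proof.
elim: k => [|k IH]; first exact: LyndonG.
exact: LyndonBr (lyndon_g_h _) (std_g_h k) IH (LyndonH K).
Qed.

Lemma relsI_comm_br (K : fieldType) i j : (i < j)%N ->
  @relsI K (comm_br (E_omega K i) (E_omega K j)).
Proof.
move=> lt; exists (g_h i ++ g_h j); split; first exact: lyndon_g_h2.
  by rewrite /= count_cat /= !add1n !addnS.
exact: LyndonBr (lyndon_g_h2 lt) (std_g_h2 i j) (lyndon_elt_E K i) (lyndon_elt_E K j).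
Qed.

(** A Lyndon word without g is the letter h, and one with a single g begins
    with it. *)
Lemma lyndon_elt_few_g (K : fieldType) a x : @lyndon_elt K a x ->
  (count_mem false a = 0 -> a = [:: true] /\ x = hT K)%N /\
  (count_mem false a = 1 -> exists k, a = g_h k /\ x = E_omega K k)%N.
Proof.
elim=> {a x} [||a b c x y la [Ea _ _ _] _ [b0 b1] _ [c0 c1]].
- by split=> // _; exists 0.
- by split.
rewrite Ea in la *; rewrite count_cat; split.
  move=> /eqP; rewrite addn_eq0 => /andP[/eqP /b0[Eb _] /eqP /c0[Ec _]].
  by move: la; rewrite Eb Ec => /(@lyndon_nseq_h 2).
case Cb: (count_mem false b) => [|[|m]]; case Cc: (count_mem false c) => [|[|n]] // _.
  have [[Eb _] [k [Ec _]]] := (b0 Cb, c1 Cc).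
  by move: la; rewrite Eb Ec => /lyndon_first_g; rewrite inE eqxx.
have [[k [-> ->]] [-> ->]] := (b1 Cb, c0 Cc); exists k.+1; split=> //.
by rewrite /= -[_ ++ _](nseqD k 1) addn1.
Qed.

(** By induction on the standard factorization: one of the two factors contains
    g at least twice and is killed, or both contain it once and are among the
    E_k. *)
Lemma relsI_kernel (K : fieldType) (B : pzRingType) (phi : freealg K -> B) :
  {morph phi : u v / u - v} -> {morph phi : u v / u * v} ->
  (forall i j, phi (E_omega K i) * phi (E_omega K j) =
               phi (E_omega K j) * phi (E_omega K i)) ->
  forall x, relsI x -> phi x = 0.
Proof.
move=> phiB phiM phiC x [a [_ + ax]].
have phi_br u v : phi (comm_br u v) = phi u * phi v - phi v * phi u.
  by apply: (etrans (phiB (u * v) (v * u))); rewrite (phiM u v) (phiM v u).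
elim: ax => {a x} // a b c x y _ [-> _ _ _] bx IHb cy IHc.
rewrite count_cat phi_br => le2.
have [b2|] := leqP 2 (count_mem false b); first by rewrite IHb // mul0r mulr0 subrr.
have [c2|] := leqP 2 (count_mem false c); first by rewrite IHc // mul0r mulr0 subrr.
have [_ b1] := lyndon_elt_few_g bx; have [_ c1] := lyndon_elt_few_g cy.
move: le2 b1 c1; case: (count_mem _ b) => [|[|//]]; case: (count_mem _ c) => [|[|//]] //.
by move=> _ /(_ erefl)[i [_ ->]] /(_ erefl)[j [_ ->]] _ _; rewrite phiC subrr.
Qed.

(** * Morphisms out of the free algebra *)

Section SpanningFamily.
Variables (K : fieldType) (V W : lmodType K) (I : Type) (b : I -> V).
Hypothesis b_ind : forall P : V -> Prop,
  P 0 -> (forall c i t, P t -> P (c *: b i + t)) -> forall u, P u.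

Lemma lin_ext_spanning (F F' : V -> W) : lin F -> lin F' ->
  (forall i, F (b i) = F' (b i)) -> F =1 F'.
Proof.
move=> FL FL' e; elim/b_ind => [|c i u IH]; first by rewrite !lin0.
by rewrite FL FL' IH e.
Qed.

End SpanningFamily.

Section SpanningFamilyAlgebra.
Variables (K : fieldType) (A B : algType K) (I : Type) (b : I -> A).
Hypothesis b_ind : forall P : A -> Prop,
  P 0 -> (forall c i t, P t -> P (c *: b i + t)) -> forall u, P u.
Variable phi : A -> B.
Hypothesis phiL : lin phi.
Hypothesis phib : forall i j, phi (b i * b j) = phi (b i) * phi (b j).

Lemma morphM_spanning : {morph phi : u v / u * v}.
Proof.
move=> u v; elim/b_ind: u => [|c i u IH]; first by rewrite mul0r (lin0 phiL) mul0r.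
rewrite (mull_lin v c (b i) u) !phiL IH mulrDl -scalerAl.
congr (c *: _ + _); elim/b_ind: v {IH} => [|{}c j v IH].
  by rewrite mulr0 (lin0 phiL) mulr0.
by rewrite (mulr_lin (b i) c (b j) v) !phiL IH phib (mulr_lin _ c).
Qed.

Lemma morph_comm_br : {morph phi : u v / u * v} ->
  forall u v, phi (comm_br u v) = comm_br (phi u) (phi v).
Proof. by move=> phiM u v; rewrite /comm_br (linB phiL) !phiM. Qed.

End SpanningFamilyAlgebra.

Section FreeAlgebraEvaluation.
Variable K : fieldType.
Local Notation F := (freealg K).

Lemma free_word_ind (P : F -> Prop) :
  P 0 -> (forall c (w : {fmonom bool}) t, P t -> P (c *: (<< w >> : F) + t)) ->
  forall u, P u.
Proof.
move=> P0 PL u; rewrite [u]monalgE; elim: (enum_fset _) => [|w s IHs].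
  by rewrite big_nil.
rewrite big_cons; have -> : << u@_w *g w >> = u@_w *: << w >> :> {malg K[_]}; last exact: PL.
by apply/malgP=> k; rewrite mcoeffZ !mcoeffU mulrnAr mulr1.
Qed.

Lemma word_mul (v w : {fmonom bool}) : (<< v >> : F) * << w >> = << mmul v w >>.
Proof. by rewrite [LHS]malgM_def fgmulUU mulr1. Qed.

Lemma word_ind (P : {fmonom bool} -> Prop) :
  P mone -> (forall w i, P w -> P (mmul w (fmu i))) -> forall w, P w.
Proof.
move=> P1 PS [s]; elim/last_ind: s => [|s i IH]; first by rewrite -fmoneE.
have -> : FMonom (rcons s i) = mmul (FMonom s) (fmu i); last exact: PS.
by apply/eqP; rewrite fmP fmM fmU /= cats1.
Qed.

Lemma freealg_ind (P : F -> Prop) :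
  P 1 -> (forall c u v, P u -> P v -> P (c *: u + v)) ->
  (forall u, P u -> P (u * gT K)) -> (forall u, P u -> P (u * hT K)) ->
  forall u, P u.
Proof.
move=> P1 PL Pg Ph; have P0 : P 0.
  by rewrite -(addNr (1 : F)) -scaleN1r; apply: PL.
elim/free_word_ind => // c w t Pt; apply: PL => //.
elim/word_ind: w => [|w i IH] //; rewrite -word_mul.
by case: i; [apply: Ph|apply: Pg].
Qed.

Section Eval.
Variables (B : algType K) (L : bool -> B).

Definition alg_eval : F -> B :=
  linext (fun w : {fmonom bool} => foldr (fun i t => L i * t) 1 (w : seq bool)).

Lemma alg_eval_lin : lin alg_eval.
Proof. exact: linext_linear. Qed.

Lemma alg_eval_word (w : {fmonom bool}) :
  alg_eval << w >> = foldr (fun i t => L i * t) 1 (w : seq bool).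
Proof. exact: linextU. Qed.

Lemma alg_evalM : {morph alg_eval : u v / u * v}.
Proof.
apply: (morphM_spanning free_word_ind alg_eval_lin) => v w.
rewrite word_mul !alg_eval_word fmM foldr_cat.
by elim: (v : seq bool) => [|i s IHs] /=; rewrite ?mul1r // IHs mulrA.
Qed.

Lemma alg_eval1 : alg_eval 1 = 1.
Proof. by rewrite alg_eval_word fm1. Qed.

Lemma alg_eval_letter i : alg_eval << fmu i >> = L i.
Proof. by rewrite alg_eval_word fmU /= mulr1. Qed.

Lemma alg_eval_E k : alg_eval (E_omega K k) = ad_iter (L false) (L true) k.
Proof.
elim: k => [|k IH]; first exact: alg_eval_letter.
rewrite ad_iterS -IH -(alg_eval_letter true).
exact: (morph_comm_br alg_eval_lin alg_evalM).
Qed.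

End Eval.
End FreeAlgebraEvaluation.

(** * The coproduct on the quotients of the free algebra *)

(** A map of tensor products is multiplicative as soon as it is so on pure
    tensors; the modules are abstract so that conversion cannot unfold the quotients. *)
Section BilinearMorphism.
Variables (K : fieldType) (A A' : algType K) (T T' : lmodType K).
Variables (tns : A -> A -> T) (m : T -> T -> T).
Variables (tns' : A' -> A' -> T') (m' : T' -> T' -> T').
Hypothesis tns_ind : forall P : T -> Prop,
  P 0 -> (forall c a b t, P t -> P (c *: tns a b + t)) -> forall t, P t.
Hypothesis ml : forall u, lin (m^~ u).
Hypothesis mr : forall t, lin (m t).
Hypothesis ml' : forall u, lin (m'^~ u).
Hypothesis mr' : forall t, lin (m' t).
Hypothesis mt : forall a a' b b', m (tns a b) (tns a' b') = tns (a * a') (b * b').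
Hypothesis mt' : forall a a' b b', m' (tns' a b) (tns' a' b') = tns' (a * a') (b * b').
Variables (f : A -> A') (F : T -> T').
Hypothesis fM : {morph f : a b / a * b}.
Hypothesis FL : lin F.
Hypothesis Ft : forall a b, F (tns a b) = tns' (f a) (f b).

Lemma bilin_morphM t u : F (m t u) = m' (F t) (F u).
Proof.
elim/tns_ind: t => [|c a b t IH].
  by rewrite (lin0 (ml u)) (lin0 FL) (lin0 (ml' _)).
rewrite ml !FL ml' IH; congr (c *: _ + _).
elim/tns_ind: u {IH} => [|{}c a' b' u IH].
  by rewrite (lin0 (mr _)) (lin0 FL) (lin0 (mr' _)).
by rewrite mr !FL mr' IH mt !Ft mt' !fM.
Qed.

End BilinearMorphism.

Section TensorMap.
Variables (K : fieldType) (A A' : algType K) (f : A -> A').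
Hypothesis fL : lin f.
Hypothesis fM : {morph f : a b / a * b}.

Lemma tmap_lin : lin (tmap f f).
Proof.
have [tl tr] := tens_bilinear A' A'.
by apply: tlift_linear; split=> [c a a' b|c a b b']; rewrite fL ?tl ?tr.
Qed.

Lemma tmapE a b : tmap f f (a \ox b) = f a \ox f b.
Proof. exact: (tmap_tens a b fL fL). Qed.

Lemma tmapM t u : tmap f f (tmul t u) = tmul (tmap f f t) (tmap f f u).
Proof.
exact: (bilin_morphM (@tens_ind K A A) (@tmul_linl K A A) (@tmul_linr K A A)
  (@tmul_linl K A' A') (@tmul_linr K A' A') (@tmul_tens K A A)
  (@tmul_tens K A' A') fM tmap_lin tmapE).
Qed.

End TensorMap.

Lemma tmap_comp (K : fieldType) (A A' A'' : algType K) (f : A' -> A'')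
    (f' : A -> A') : lin f -> lin f' ->
  forall t, tmap f f (tmap f' f' t) = tmap (f \o f') (f \o f') t.
Proof.
move=> fL fL'; have cL : lin (f \o f') by move=> c u v /=; rewrite fL' fL.
apply: tlift_ext => [c u v||a b].
- rewrite (tmap_lin fL' c u v).
  exact: (tmap_lin fL c (tmap f' f' u) (tmap f' f' v)).
- exact: (tmap_lin cL).
by rewrite (tmapE fL') (tmapE fL) (tmapE cL).
Qed.

Section QuotientMorphism.
Variables (K : fieldType) (A : algType K) (J : pideal A).

Lemma aproj_lin : lin (aproj J).
Proof. by move=> c u v; rewrite aprojD aprojZ. Qed.

Lemma aproj_ad_iter g h k :
  aproj J (ad_iter g h k) = ad_iter (aproj J g) (aproj J h) k.
Proof.
elim: k => // k IH; rewrite !ad_iterS -IH.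
exact: (morph_comm_br aproj_lin (@aprojM K A J)).
Qed.

End QuotientMorphism.

Lemma ideal_kernel (K : fieldType) (A B : algType K) (phi : A -> B) (S : set A) :
  lin phi -> {morph phi : u v / u * v} -> (forall x, S x -> phi x = 0) ->
  forall x, ideal S x -> phi x = 0.
Proof.
move=> phiL phiM S0 x Ix; apply: (Ix [set y | phi y = 0]).
split=> //; split; first split.
- exact: lin0 phiL.
- by move=> c u v u0 v0; rewrite /= phiL u0 v0 scaler0 addr0.
- by move=> a u u0; rewrite /= !phiM u0 mulr0 mul0r.
Qed.

Section GrouplikeSkewPrimitive.
Variables (K : fieldType) (A : algType K) (eps : A -> K).
Hypothesis chi : is_character eps.
Variables (g h : A).
Local Notation T := (tensor_alg chi).

Definition coprod_letter (i : bool) : T :=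
  if i then (1 \ox h + h \ox g : tensor A A) else g \ox g.

(** The morphism from the free algebra to A (x) A under which the first letter
    is grouplike and the second one skew-primitive. *)
Definition coprod_eval : freealg K -> T := alg_eval coprod_letter.

Lemma coprod_eval_lin : lin coprod_eval.
Proof. exact: alg_eval_lin. Qed.

Lemma coprod_evalM : {morph coprod_eval : u v / u * v}.
Proof. exact: alg_evalM. Qed.

Lemma tensor_algM a a' b b' : (a \ox b : T) * (a' \ox b') = (a * a') \ox (b * b').
Proof. exact: tmul_tens. Qed.

Variable f : freealg K -> A.
Hypothesis fL : lin f.
Hypothesis fM : {morph f : a b / a * b}.
Hypothesis f1 : f 1 = 1.
Hypothesis fg : f (gT K) = g.
Hypothesis fh : f (hT K) = h.

Lemma comul_free_lin : lin (@comul_free K).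
Proof. exact: linext_linear. Qed.

Lemma tmap_comul_free : tmap f f \o @comul_free K =1 coprod_eval.
Proof.
apply: (lin_ext_spanning (@free_word_ind K)) => [c u v||w] /=.
- by rewrite (comul_free_lin c u v) (tmap_lin fL c (comul_free u) (comul_free v)).
- exact: coprod_eval_lin.
rewrite /coprod_eval alg_eval_word /comul_free linextU.
elim: (w : seq bool) => [|i s IHs]; first by rewrite [LHS](tmapE fL) f1.
rewrite [LHS](tmapM fL fM) [X in tmul _ X]IHs; congr (tmul _ _).
case: i => /=; last by rewrite (tmapE fL) fg.
rewrite (linD (tmap_lin fL) (1 \ox hT K) (hT K \ox gT K)).
apply: (f_equal2 +%R); apply: (etrans (tmapE fL _ _)).
  exact: (f_equal2 (@tens K A A) f1 fh).
exact: (f_equal2 (@tens K A A) fh fg).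
Qed.

End GrouplikeSkewPrimitive.

Lemma E_omega_ad (K : fieldType) k : E_omega K k = ad_iter (gT K) (hT K) k.
Proof. by elim: k => // k IH; rewrite ad_iterS -IH. Qed.

Section CoproductRelations.
Variables (K : fieldType) (A : algType K) (eps : A -> K).
Hypothesis chi : is_character eps.
Variables (g h : A).
Hypothesis EC : forall i j,
  ad_iter g h i * ad_iter g h j = ad_iter g h j * ad_iter g h i.
Local Notation T := (tensor_alg chi).
Local Notation Phi := (coprod_eval chi g h).

Let tB : @bilinear_map K A A T (@tens K A A) := tens_bilinear A A.
Let tM := tensor_algM chi.
Let t1 : (1 \ox 1 : T) = 1 := erefl.

Lemma coprod_eval_E k :
  Phi (E_omega K k) = ad_iter (g \ox g : T) ((1 \ox h : T) + (h \ox g : T)) k.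
Proof. exact: alg_eval_E. Qed.

Lemma coprod_eval_relsI x : relsI x -> Phi x = 0.
Proof.
apply: relsI_kernel; [|exact: coprod_evalM|].
  by move=> u v; exact: (linB (@coprod_eval_lin K A eps chi g h)).
by move=> i j; rewrite !coprod_eval_E; exact: (ad_iter_tnsC tB tM EC).
Qed.

Variable p : nat.
Hypothesis charKp : p \in [pchar K].
Hypothesis Ep0 : ad_iter g h p.-1 = 0.

Lemma coprod_evalX u n : Phi (u ^+ n) = Phi u ^+ n.
Proof.
elim: n => [|n IH]; first by rewrite !expr0; exact: alg_eval1.
by rewrite !exprS -IH; exact: coprod_evalM.
Qed.

Lemma coprod_eval_g_exp : g ^+ p = 1 -> Phi (gT K ^+ p - 1) = 0.
Proof.
move=> gp; rewrite (linB (@coprod_eval_lin K A eps chi g h)) coprod_evalX.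
rewrite {1}/coprod_eval alg_eval_letter /coprod_letter [Phi 1]alg_eval1.
by rewrite (tnsX tM t1) gp t1 subrr.
Qed.

Lemma coprod_eval_E_last : Phi (E_omega K p.-1) = 0.
Proof. by rewrite coprod_eval_E; exact: (ad_iter_tns_p tB tM EC charKp Ep0). Qed.

Lemma coprod_eval_h_exp : h ^+ p = 0 -> Phi (hT K ^+ p) = 0.
Proof.
move=> hp; rewrite coprod_evalX {1}/coprod_eval alg_eval_letter.
exact: (coproduct_exp_p tB tM t1 EC charKp Ep0 hp).
Qed.

Lemma coprod_eval_E_exp k : (0 < k)%N ->
  (forall j, (0 < j <= k)%N -> ad_iter g h j ^+ p = 0) ->
  Phi (E_omega K k ^+ p) = 0.
Proof.
move=> k0 E0; rewrite coprod_evalX coprod_eval_E.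
exact: (ad_iter_tns_exp tB tM t1 EC charKp k0 E0).
Qed.

End CoproductRelations.

Section Tbar_Tp.
Variables (K : fieldType).
Local Notation piI := (aproj (ideal_I K)).
Local Notation chi_bar := (counit_bar_character K).

Lemma E_barE k : E_bar K k = ad_iter (g_bar K) (h_bar K) k.
Proof. by rewrite /E_bar E_omega_ad; exact: aproj_ad_iter. Qed.

Lemma E_barC i j : ad_iter (g_bar K) (h_bar K) i * ad_iter (g_bar K) (h_bar K) j =
  ad_iter (g_bar K) (h_bar K) j * ad_iter (g_bar K) (h_bar K) i.
Proof.
wlog lt : i j / (i < j)%N.
  move=> W; have [/W //|/W -> //|-> //] := ltngtP i j.
rewrite -!E_barE; apply/eqP; rewrite -subr_eq0; apply/eqP.
have : piI (comm_br (E_omega K i) (E_omega K j)) = 0.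
  by apply/aproj_eq0; apply: (sub_ideal (S := @relsI K)); exact: relsI_comm_br.
by move=> <-; rewrite (morph_comm_br (@aproj_lin _ _ _) (@aprojM _ _ _)).
Qed.

Lemma comul_barE u : comul_bar (piI u) = coprod_eval chi_bar (g_bar K) (h_bar K) u.
Proof.
have E := tmap_comul_free (f := piI) chi_bar (@aproj_lin _ _ _)
  (@aprojM _ _ _) (@aproj1 _ _ _) (erefl (g_bar K)) (erefl (h_bar K)).
apply: etrans (E u); apply: (quot_comulE (Delta := @comul_free K)).
  exact: comul_free_lin.
move=> a Ia; apply: etrans (E a) _.
exact: (ideal_kernel (coprod_eval_lin chi_bar _ _) (coprod_evalM chi_bar _ _)
  (coprod_eval_relsI chi_bar E_barC) Ia).
Qed.

Lemma comul_bar_lin : lin (@comul_bar K).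
Proof.
move=> c x y; rewrite -[x]areprK -[y]areprK -(aproj_lin (ideal_I K)) !comul_barE.
exact: coprod_eval_lin.
Qed.

Variables (p : nat) (charKp : p \in [pchar K]).
Local Notation J := (ideal_p charKp).
Local Notation pi := (aproj J \o piI).

Lemma counit_p_character :
  is_character (@counit_bar K \o @arepr K _ J).
Proof.
exact: (character_quot (J := J) chi_bar
  (character_ideal chi_bar (@counit_relsp K p charKp))).1.
Qed.

Lemma pi_lin : lin pi.
Proof. by move=> c u v /=; rewrite !aproj_lin. Qed.

Lemma piM : {morph pi : u v / u * v}.
Proof. by move=> u v /=; rewrite !aprojM. Qed.

Lemma E_pE k : E_p charKp k = ad_iter (x_p charKp) (y_p charKp) k.
Proof. by rewrite /E_p E_barE; exact: aproj_ad_iter. Qed.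

Lemma E_pC i j : ad_iter (x_p charKp) (y_p charKp) i * ad_iter (x_p charKp) (y_p charKp) j =
  ad_iter (x_p charKp) (y_p charKp) j * ad_iter (x_p charKp) (y_p charKp) i.
Proof.
rewrite -!E_pE /E_p !E_barE -(@aprojM _ _ J (ad_iter _ _ i)).
by rewrite E_barC; exact: (@aprojM _ _ J).
Qed.

Lemma relsp_eq0 r : relsp p r -> aproj J r = 0.
Proof. by move=> ?; apply/aproj_eq0; exact: (sub_ideal (S := @relsp K p)). Qed.

Lemma x_p_exp : x_p charKp ^+ p = 1.
Proof.
apply/eqP; rewrite -subr_eq0; apply/eqP; rewrite -aprojX -aproj1 -aprojB.
by apply: relsp_eq0; exact: Or41.
Qed.

Lemma E_p_last : ad_iter (x_p charKp) (y_p charKp) p.-1 = 0.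
Proof. by rewrite -E_pE; apply: relsp_eq0; exact: Or42. Qed.

Lemma y_p_exp : y_p charKp ^+ p = 0.
Proof. by rewrite -aprojX; apply: relsp_eq0; exact: Or43. Qed.

Lemma E_p_exp k : (1 <= k <= p - 2)%N ->
  ad_iter (x_p charKp) (y_p charKp) k ^+ p = 0.
Proof.
move=> kp; rewrite -E_pE -aprojX; apply: relsp_eq0.
by apply: Or44; exists k.
Qed.

Local Notation TP := (tensor_alg counit_p_character).
Local Notation Phi := (coprod_eval counit_p_character (x_p charKp) (y_p charKp)).

Definition comul_bar_p (x : Tbar K) : TP := tmap (aproj J) (aproj J) (comul_bar x).

Lemma comul_bar_pE u : comul_bar_p (piI u) = Phi u.
Proof.
have E := tmap_comul_free (f := piI) chi_bar (@aproj_lin _ _ _)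
  (@aprojM _ _ _) (@aproj1 _ _ _) (erefl (g_bar K)) (erefl (h_bar K)).
have Ep := tmap_comul_free (f := pi) counit_p_character pi_lin piM
  (erefl 1) (erefl (x_p charKp)) (erefl (y_p charKp)).
rewrite /comul_bar_p comul_barE -[coprod_eval _ _ _ u]E -[Phi u]Ep.
exact: (tmap_comp (@aproj_lin _ _ J) (@aproj_lin _ _ (ideal_I K))).
Qed.

Lemma comul_bar_p_lin : lin comul_bar_p.
Proof.
move=> c x y; rewrite -[x]areprK -[y]areprK -(aproj_lin (ideal_I K)) !comul_bar_pE.
exact: coprod_eval_lin.
Qed.

Lemma comul_bar_pM : {morph comul_bar_p : x y / x * y}.
Proof.
move=> x y; rewrite -[x]areprK -[y]areprK -(@aprojM _ _ (ideal_I K)) !comul_bar_pE.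
exact: coprod_evalM.
Qed.

Lemma comul_bar_p_relsp r : relsp p r -> comul_bar_p r = 0.
Proof.
case=> [->|->|->|[k kp ->]].
- have -> : g_bar K ^+ p - 1 = piI (gT K ^+ p - 1) by rewrite aprojB aprojX.
  rewrite comul_bar_pE; exact: (coprod_eval_g_exp _ _ x_p_exp).
- rewrite comul_bar_pE; exact: (coprod_eval_E_last _ E_pC charKp E_p_last).
- rewrite -aprojX comul_bar_pE.
  exact: (coprod_eval_h_exp _ E_pC charKp E_p_last y_p_exp).
rewrite -aprojX comul_bar_pE; case/andP: kp => k0 kp.
apply: (coprod_eval_E_exp _ E_pC charKp k0) => j /andP[j0 jk].
by apply: E_p_exp; rewrite j0 (leq_trans jk).
Qed.

Lemma comul_pE u : comul_p (pi u) = Phi u.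
Proof.
apply: etrans (comul_bar_pE u); apply: (quot_comulE (Delta := @comul_bar K)).
  exact: comul_bar_lin.
move=> a; exact: (ideal_kernel comul_bar_p_lin comul_bar_pM comul_bar_p_relsp).
Qed.

End Tbar_Tp.

(** * A four-dimensional representation *)

(** On a space of dimension 4 the commutators E_1 and E_2 are the matrix units
    (2, 0) and (3, 0), and the further ones vanish.  This is just enough to
    read off the counit, a functional dual to h and three functionals that
    detect g, E_1 and E_2; since h^3 = 0 and E_3 = 0, the relations hold
    for p > 3. *)
Section Representation.
Variable K : fieldType.
Local Notation M4 := 'M[K]_4.
Local Notation o0 := (@Ordinal 4 0 isT).
Local Notation o1 := (@Ordinal 4 1 isT).
Local Notation o2 := (@Ordinal 4 2 isT).
Local Notation o3 := (@Ordinal 4 3 isT).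

Definition rep_g : M4 := 1 + delta_mx o1 o0.
Definition rep_h : M4 := - (delta_mx o2 o1 + delta_mx o3 o2).

Lemma delta_mul (i j k l : 'I_4) :
  (delta_mx i j : M4) * delta_mx k l = if j == k then delta_mx i l else 0.
Proof.
rewrite [LHS]mul_delta_mx_cond; case: eqP => _ //.
Qed.

Lemma comm_br_delta (i : 'I_4) : comm_br (delta_mx i o0 : M4) rep_h =
  (if i == o1 then delta_mx o2 o0 else 0) + (if i == o2 then delta_mx o3 o0 else 0).
Proof.
rewrite /comm_br /rep_h mulrN mulNr opprK mulrDr mulrDl !delta_mul /=.
by rewrite addr0 oppr0 add0r (eq_sym o1) (eq_sym o2).
Qed.

Lemma rep_E0 : ad_iter rep_g rep_h 0 = 1 + delta_mx o1 o0.
Proof. by []. Qed.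

Lemma rep_E1 : ad_iter rep_g rep_h 1 = delta_mx o2 o0.
Proof. by rewrite ad_iterS comm_brD comm_br1 comm_br_delta /= add0r addr0. Qed.

Lemma rep_E2 : ad_iter rep_g rep_h 2 = delta_mx o3 o0.
Proof. by rewrite ad_iterS rep_E1 comm_br_delta /= add0r. Qed.

Lemma rep_E_ge3 k : (2 < k)%N -> ad_iter rep_g rep_h k = 0.
Proof.
case: k => [|[|[|k]]] // _; elim: k => [|k IH].
  by rewrite ad_iterS rep_E2 comm_br_delta /= add0r.
by rewrite ad_iterS IH comm_br0.
Qed.

Lemma rep_E_delta k : (0 < k)%N -> exists2 c : K, True & exists i : 'I_4,
  i != o0 /\ ad_iter rep_g rep_h k = c *: delta_mx i o0.
Proof.
case: k => [|[|[|k]]] // _.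
- by exists 1 => //; exists o2; rewrite rep_E1 scale1r.
- by exists 1 => //; exists o3; rewrite rep_E2 scale1r.
- by exists 0 => //; exists o1; rewrite rep_E_ge3 // scale0r.
Qed.

Lemma rep_EM i j : (0 < j)%N ->
  ad_iter rep_g rep_h i * ad_iter rep_g rep_h j = 
  (if i == 0%N then ad_iter rep_g rep_h j else 0).
Proof.
move=> /rep_E_delta[c _ [k [k0 ->]]]; rewrite -scalerAr.
case: i => [|i]; first by rewrite rep_E0 mulrDl mul1r delta_mul eq_sym (negPf k0) addr0.
have /rep_E_delta[d _ [l [l0 ->]]] : (0 < i.+1)%N by [].
by rewrite -scalerAl delta_mul eq_sym (negPf k0) !scaler0.
Qed.

Lemma rep_EM0 j : (0 < j)%N ->
  ad_iter rep_g rep_h j * ad_iter rep_g rep_h 0 = ad_iter rep_g rep_h j.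
Proof.
move=> /rep_E_delta[c _ [k [k0 ->]]].
by rewrite -scalerAl rep_E0 mulrDr mulr1 delta_mul addr0.
Qed.

Lemma rep_EC i j : ad_iter rep_g rep_h i * ad_iter rep_g rep_h j =
  ad_iter rep_g rep_h j * ad_iter rep_g rep_h i.
Proof.
case: i j => [|i] [|j] //; first by rewrite rep_EM // rep_EM0.
  by rewrite rep_EM0 // rep_EM.
by rewrite !rep_EM.
Qed.

Variable p : nat.
Hypothesis charKp : p \in [pchar K].
Hypothesis p_gt3 : (3 < p)%N.

Lemma rep_g_exp : rep_g ^+ p = 1.
Proof.
have charM : p \in [pchar M4] by rewrite (pchar_lalg M4).
rewrite -(pFrobenius_autE charM) pFrobenius_autD_comm; last exact: commr_sym (commr1 _).
rewrite !pFrobenius_autE expr1n; case: (p) p_gt3 => [|[|q]] // _.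
by rewrite 2!exprS mulrA delta_mul mul0r addr0.
Qed.

Lemma rep_h_exp : rep_h ^+ p = 0.
Proof.
have h2 : rep_h ^+ 2 = delta_mx o3 o1.
  rewrite expr2 /rep_h mulrNN mulrDr !mulrDl !delta_mul /=.
  by rewrite !add0r addr0.
have h3 : rep_h ^+ 3 = 0.
  by rewrite exprS h2 /rep_h mulNr mulrDl !delta_mul /= addr0 oppr0.
by rewrite -(subnKC p_gt3) exprD exprS h3 mulr0 mul0r.
Qed.

Lemma rep_E_last : ad_iter rep_g rep_h p.-1 = 0.
Proof. by rewrite rep_E_ge3 //; case: (p) p_gt3. Qed.

Lemma rep_E_exp k : (0 < k)%N -> ad_iter rep_g rep_h k ^+ p = 0.
Proof.
move=> k0; case: (p) p_gt3 => [|[|q]] // _.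
by rewrite 2!exprS mulrA rep_EM // eqn0Ngt k0 mul0r.
Qed.

End Representation.

(** By [relsI_kernel], a pair of elements satisfying the commutation relations
    and the relations with exponent p defines a morphism on the quotient. *)
Section Factor.
Variables (K : fieldType) (p : nat) (charKp : p \in [pchar K]).
Variables (B : algType K) (L : bool -> B).
Local Notation G := (L false).
Local Notation H := (L true).
Hypothesis EC : forall i j, ad_iter G H i * ad_iter G H j = ad_iter G H j * ad_iter G H i.
Hypothesis Gp : G ^+ p = 1.
Hypothesis Ep : ad_iter G H p.-1 = 0.
Hypothesis Hp : H ^+ p = 0.
Hypothesis Ekp : forall k, (0 < k <= p - 2)%N -> ad_iter G H k ^+ p = 0.

Lemma lin_arepr (A : algType K) (J : pideal A) (phi : A -> B) : lin phi ->
  (forall a, J a -> phi a = 0) -> forall a, phi (arepr (aproj J a)) = phi a.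
Proof.
move=> phiL J0 a; apply/eqP; rewrite -subr_eq0 -(linB phiL); apply/eqP/J0.
by apply/aproj_eqP; rewrite areprK.
Qed.

Definition lift_bar (x : Tbar K) : B := alg_eval L (arepr x).

Lemma lift_barE u : lift_bar (aproj (ideal_I K) u) = alg_eval L u.
Proof.
apply: lin_arepr; first exact: alg_eval_lin.
apply: (ideal_kernel (alg_eval_lin L) (@alg_evalM _ _ L)).
apply: relsI_kernel; [|exact: alg_evalM|].
  by move=> u' v; exact: (linB (@alg_eval_lin K B L)).
by move=> i j; rewrite !alg_eval_E EC.
Qed.

Lemma lift_bar_lin : lin lift_bar.
Proof.
move=> c x y; rewrite -[x]areprK -[y]areprK -(aproj_lin (ideal_I K)) !lift_barE.
exact: alg_eval_lin.
Qed.

Lemma lift_barM : {morph lift_bar : x y / x * y}.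
Proof.
move=> x y; rewrite -[x]areprK -[y]areprK -(@aprojM _ _ (ideal_I K)) !lift_barE.
exact: alg_evalM.
Qed.

Definition lift_p (x : Tp charKp) : B := lift_bar (arepr x).

Lemma lift_pE x : lift_p (aproj (ideal_p charKp) x) = lift_bar x.
Proof.
have lift_barX u n : lift_bar (u ^+ n) = lift_bar u ^+ n.
  elim: n => [|n IH]; first by rewrite !expr0 -(@aproj1 _ _ (ideal_I K)) lift_barE alg_eval1.
  by rewrite !exprS lift_barM IH.
have lg : lift_bar (g_bar K) = G by rewrite lift_barE alg_eval_letter.
have lh : lift_bar (h_bar K) = H by rewrite lift_barE alg_eval_letter.
have lE k : lift_bar (E_bar K k) = ad_iter G H k by rewrite lift_barE alg_eval_E.
apply: lin_arepr; first exact: lift_bar_lin.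
apply: (ideal_kernel lift_bar_lin lift_barM) => r [->|->|->|[k kp ->]].
- by rewrite (linB lift_bar_lin) lift_barX lg Gp -(@aproj1 _ _ (ideal_I K)) lift_barE alg_eval1 subrr.
- by rewrite lE.
- by rewrite lift_barX lh.
- by rewrite lift_barX lE Ekp.
Qed.

Lemma lift_p_lin : lin lift_p.
Proof.
move=> c x y; rewrite -[x]areprK -[y]areprK -(aproj_lin (ideal_p charKp)) !lift_pE.
exact: lift_bar_lin.
Qed.

Lemma lift_pM : {morph lift_p : x y / x * y}.
Proof.
move=> x y; rewrite -[x]areprK -[y]areprK -(@aprojM _ _ (ideal_p charKp)) !lift_pE.
exact: lift_barM.
Qed.

Lemma lift_p1 : lift_p 1 = 1.
Proof. by rewrite -(@aproj1 _ _ (ideal_p charKp)) lift_pE -(@aproj1 _ _ (ideal_I K)) lift_barE alg_eval1. Qed.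

Lemma lift_px : lift_p (x_p charKp) = G.
Proof. by rewrite lift_pE lift_barE alg_eval_letter. Qed.

Lemma lift_py : lift_p (y_p charKp) = H.
Proof. by rewrite lift_pE lift_barE alg_eval_letter. Qed.

End Factor.

(** * The generators of the filtration *)

Section Generators.
Variables (K : fieldType) (p : nat) (charKp : p \in [pchar K]) (p_gt3 : (3 < p)%N).
Variables (A : algType K) (g h : A).
Local Notation E := (ad_iter g h).
Hypothesis EC : forall i j, E i * E j = E j * E i.
Hypothesis gp : g ^+ p = 1.

Lemma comm_brX u n : Ealg g h u ->
  comm_br (u ^+ n) h = (u ^+ n.-1 * comm_br u h) *+ n.
Proof.
move=> Su; elim: n => [|n IH]; first by rewrite comm_br1.
rewrite exprS comm_brM IH; case: n {IH} => [|n].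
  by rewrite mulr0n mulr0 add0r expr0 mulr1 mul1r.
rewrite mulrnAr mulrA -exprS [RHS]mulrSr; congr (_ + _).
by rewrite (EalgC EC (Ealg_comm_br Su) (EalgX n.+1 Su)).
Qed.

Definition gi : A := g ^+ p.-1.
Definition xg (m : nat) : A := E m * gi.
Definition zc (n : nat) : K := (n.+1)`!%:R / 2%:R ^+ n.
Definition zg (n : nat) : A := xg n - zc n *: xg 1 ^+ n.

Lemma p_gt0 : (0 < p)%N. Proof. by case: (p) p_gt3. Qed.

Lemma g_gi : g * gi = 1. Proof. by rewrite /gi -exprS prednK // p_gt0. Qed.

Lemma Ealg_g : Ealg g h g. Proof. exact: (Ealg_E g h 0). Qed.
Lemma Ealg_gi : Ealg g h gi. Proof. exact: EalgX Ealg_g. Qed.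
Lemma Ealg_xg m : Ealg g h (xg m).
Proof. exact: EalgM (Ealg_E _ _ _) Ealg_gi. Qed.
Lemma Ealg_zg n : Ealg g h (zg n).
Proof.
apply: (subspaceB (Ealg_subspace g h)); first exact: Ealg_xg.
by apply: (subspaceZ (Ealg_subspace g h)); apply: EalgX; exact: Ealg_xg.
Qed.

Lemma xg_g m : xg m * g = E m.
Proof. by rewrite /xg -mulrA (EalgC EC Ealg_gi Ealg_g) g_gi mulr1. Qed.

Lemma xg0 : xg 0 = 1. Proof. exact: g_gi. Qed.

Lemma comm_br_gi : comm_br gi h = - (gi * xg 1).
Proof.
have : comm_br (gi * g) h = 0.
  by rewrite (EalgC EC Ealg_gi Ealg_g) g_gi comm_br1.
rewrite comm_brM => /eqP; rewrite addr_eq0 => /eqP E0.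
have -> : comm_br gi h = comm_br gi h * g * gi by rewrite -mulrA g_gi mulr1.
by rewrite -[comm_br gi h * g]opprK -E0 mulNr -mulrA.
Qed.

Lemma comm_br_xg m : comm_br (xg m) h = xg m.+1 - xg m * xg 1.
Proof. by rewrite comm_brM comm_br_gi mulrN addrC mulrA. Qed.

Lemma two_neq0 : 2%:R != 0 :> K.
Proof. by rewrite (natr_neq0 charKp) // (ltn_trans _ p_gt3). Qed.

Lemma zcS n : zc n.+1 = zc n * (n.+2)%:R / 2%:R.
Proof.
rewrite /zc factS natrM exprSr invfM [LHS]mulrA; congr (_ / _).
by rewrite -mulrA mulrC.
Qed.

Lemma zc2 : zc 2 = 3%:R / 2%:R.
Proof.
rewrite /zc /= (_ : 3`! = 3 * 2)%N // natrM expr2 invfM mulrA mulfK //.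
exact: two_neq0.
Qed.

Lemma zg1 : zg 1 = 0.
Proof. by rewrite /zg /zc (_ : 2`! = 2)%N // expr1 expr1 divff ?two_neq0 // scale1r subrr. Qed.

Lemma comm_br_x1 : comm_br (xg 1) h = zg 2 + 2%:R^-1 *: xg 1 ^+ 2.
Proof.
rewrite comm_br_xg /zg zc2 -addrA; congr (_ + _); rewrite -expr2.
rewrite -scaleNr -scalerDl (_ : - (3%:R / 2%:R) + 2%:R^-1 = -1 :> K) ?scaleN1r //.
apply: (mulIf two_neq0); rewrite mulrDl mulNr divfK ?two_neq0 // mulVf ?two_neq0 //.
by rewrite -[3%N]/(2 + 1)%N natrD opprD subrK mulN1r.
Qed.

Lemma zg_rec_lin (V : zmodType) (X P Y Z C W : V) :
  X - P - (Y - Z) + (P - C) + (Y - W) = X - (C + W - Z).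
Proof.
rewrite !opprB !opprD.
rewrite (AC ((2*2)*2*2) (1*3*6*8*(2*5)*(4*7))) /= !addNr !addr0.
by rewrite !addrA.
Qed.

(** Every term on the right has weight k in the filtration.  The constants
    (n+1)!/2^n are those for which no multiple of x_1^(k+1), which has weight
    k + 1, is left over. *)
Lemma zg_rec k : (0 < k)%N ->
  zg k.+1 = comm_br (zg k) h + zg k * xg 1 +
            (k%:R * zc k) *: (xg 1 ^+ k.-1 * zg 2).
Proof.
case: k => // k _; set c := zc k.+1; set n := _ * c.
have x1C := EalgC EC (Ealg_xg 1); have Sx := Ealg_xg.
have dz : comm_br (zg k.+1) h = xg k.+2 - xg k.+1 * xg 1 -
    (n *: (xg 1 ^+ k * xg 2) - n *: xg 1 ^+ k.+2).
  rewrite /zg -scaleNr comm_brD comm_brZ comm_br_xg comm_brX //.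
  rewrite comm_br_xg mulrBr -expr2 -exprD addn2 /=.
  by rewrite -scaler_nat scalerA mulNr scaleNr [c * _]mulrC scalerBr.
have zx : zg k.+1 * xg 1 = xg k.+1 * xg 1 - c *: xg 1 ^+ k.+2.
  by rewrite mulrBl -scalerAl -exprSr.
have xz : n *: (xg 1 ^+ k * zg 2) =
    n *: (xg 1 ^+ k * xg 2) - (n * zc 2) *: xg 1 ^+ k.+2.
  by rewrite mulrBr -scalerAr -exprD addn2 scalerBr scalerA.
rewrite dz zx xz zg_rec_lin -scalerDl -scalerBl; congr (_ - _ *: _).
rewrite zcS zc2 -/c /n -[k.+3%N]/(2 + k.+1)%N natrD.
by field; exact: two_neq0.
Qed.

End Generators.

(** * The filtration *)

Section Filtration.
Variables (K : fieldType) (p : nat) (charKp : p \in [pchar K]) (p_gt3 : (3 < p)%N).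
Variables (A : algType K) (g h : A).
Local Notation E := (ad_iter g h).
Hypothesis EC : forall i j, E i * E j = E j * E i.
Hypothesis gp : g ^+ p = 1.
Local Notation x := (xg p g h).
Local Notation z := (zg p g h).

(** U_1 = x_1 and U_i = z_i for i >= 2, of weight wt i. *)
Definition Ug (i : nat) : A := if (i <= 1)%N then x 1 else z i.
Definition wt (i : nat) : nat := maxn 1 i.-1.
Local Notation U := Ug.

Lemma wtSS k : wt k.+2 = k.+1.
Proof. by rewrite /wt maxnE subn1. Qed.

(** [FS] is the part of the filtration in the subalgebra generated by the E_k,
    and [FF] is the filtration itself.  Generating them by multiplications,
    instead of as spans of ordered monomials, turns the stability under
    products and commutators into inductions. *)
Inductive FS : nat -> A -> Prop :=
| FS1 n : FS n 1
| FSL n c u v : FS n u -> FS n v -> FS n (c *: u + v)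
| FSg n u : FS n u -> FS n (u * g)
| FSU m n i u : (0 < i)%N -> (m + wt i <= n)%N -> FS m u -> FS n (u * U i).

Inductive FF (n : nat) : A -> Prop :=
| FFL c u v : FF n u -> FF n v -> FF n (c *: u + v)
| FFh r m s : FS m s -> (r + m <= n)%N -> FF n (h ^+ r * s).

Lemma FS_subspace n : is_subspace (FS n).
Proof.
split; last by move=> c u v; exact: FSL.
by rewrite -(addNr (1 : A)) -scaleN1r; apply: FSL; exact: FS1.
Qed.

Lemma FS_mono m n u : (m <= n)%N -> FS m u -> FS n u.
Proof.
move=> + Su; elim: Su n => {m u} [m|m c u v _ IHu _ IHv|m u _ IH|k m i u i0 km Su _] n mn.
- exact: FS1.
- by apply: FSL; [exact: IHu|exact: IHv].
- exact/FSg/IH.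
- exact: (FSU i0 (leq_trans km mn) Su).
Qed.

Lemma Ealg_U i : Ealg g h (U i).
Proof. by rewrite /U; case: ifP => _; [exact: Ealg_xg|exact: Ealg_zg]. Qed.

Lemma FSM m n u v : FS m u -> FS n v -> FS (m + n) (u * v).
Proof.
move=> Su; elim=> {n v} [n|n c v1 v2 _ IH1 _ IH2|n v _ IH|k n i v i0 kn _ IH].
- by rewrite mulr1; apply: FS_mono Su; rewrite leq_addr.
- by rewrite mulrDr -scalerAr; exact: FSL.
- by rewrite mulrA; exact: FSg.
- by rewrite mulrA; apply: (FSU i0 _ IH); rewrite -addnA leq_add2l.
Qed.

Lemma FS_U i : (0 < i)%N -> FS (wt i) (U i).
Proof. by move=> i0; rewrite -[U i]mul1r; apply: (FSU i0 _ (FS1 0)). Qed.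

Lemma FS_x1 : FS 1 (x 1).
Proof. exact: (@FS_U 1). Qed.

Lemma FS_x1X k : FS k (x 1 ^+ k).
Proof.
elim: k => [|k IH]; first exact: FS1.
by rewrite exprSr -addn1; exact: FSM IH FS_x1.
Qed.

Lemma FS_z k : (0 < k)%N -> FS k.-1 (z k).
Proof.
case: k => [|[|k]] // _; first by rewrite zg1 //; case: (FS_subspace 0).
by have := @FS_U k.+2 isT; rewrite wtSS.
Qed.

(** This is where the choice of the z_n matters: by [zg_rec], commutation with h
    raises the weight of z_n by one only. *)
Lemma FS_comm_br n u : FS n u -> FS n.+1 (comm_br u h).
Proof.
have sub := FS_subspace.
have FSZ m c v : FS m v -> FS m (c *: v) by exact: (subspaceZ (sub m)).
elim=> {n u} [n|n c u v _ IHu _ IHv|n u Su IH|m n i u i0 mn Su IH].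
- by rewrite comm_br1; case: (sub n.+1).
- by rewrite comm_brD comm_brZ; exact: FSL.
- rewrite comm_brM; apply: (subspaceD (sub n.+1)); last exact: FSg.
  have -> : comm_br g h = x 1 * g by rewrite xg_g.
  by rewrite mulrA; apply: FSg; rewrite -addn1; exact: FSM Su FS_x1.
rewrite comm_brM; apply: (subspaceD (sub n.+1)); last first.
  by apply: (FSU i0 _ IH); rewrite addSn ltnS.
suff dU : FS (wt i).+1 (comm_br (U i) h).
  by apply: FS_mono (FSM Su dU); rewrite addnS ltnS.
case: i i0 {mn} => [|[|k]] // _.
  rewrite /U /= (comm_br_x1 charKp p_gt3 EC gp).
  apply: (subspaceD (sub 2)); first exact: FS_mono (FS_z _).
  exact/FSZ/FS_x1X.
rewrite /U wtSS /=; have -> : comm_br (z k.+2) h = z k.+3 -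
    (z k.+2 * x 1 + (k.+2%:R * zc K k.+2) *: (x 1 ^+ k.+1 * z 2)).
  by rewrite (zg_rec charKp p_gt3 EC gp (ltn0Sn k.+1)) -[X in X - _]addrA addrK.
apply: (subspaceB (sub k.+2)); first exact: (@FS_z k.+3).
apply: (subspaceD (sub k.+2)).
  by apply: FS_mono (FSM (@FS_z k.+2 isT) FS_x1); rewrite addn1.
by apply: FSZ; apply: FS_mono (FSM (FS_x1X _) (@FS_z 2 isT)); rewrite addn1.
Qed.

Lemma FF_FS n s : FS n s -> FF n s.
Proof. by move=> Fs; rewrite -[s]mul1r -(expr0 h); apply: FFh Fs _. Qed.

Lemma FF_subspace n : is_subspace (FF n).
Proof. by split; [case: (FS_subspace n) => /FF_FS|move=> c u v; exact: FFL]. Qed.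

Lemma FF_mono m n u : (m <= n)%N -> FF m u -> FF n u.
Proof.
move=> mn; elim=> [c v w _ IHv _ IHw|r k s Fs rk]; first exact: FFL.
exact: FFh Fs (leq_trans rk mn).
Qed.

Lemma FF_hl n r u : FF n u -> FF (n + r) (h ^+ r * u).
Proof.
elim=> [c v w _ IHv _ IHw|r' k s Fs rk]; first by rewrite mulrDr -scalerAr; exact: FFL.
by rewrite mulrA -exprD; apply: FFh Fs _; rewrite addnC addnA addnAC leq_add2r addnC.
Qed.

Lemma FF_h n u : FF n u -> FF n.+1 (u * h).
Proof.
elim=> [c v w _ IHv _ IHw|r k s Fs rk]; first by rewrite mulrDl -scalerAl; exact: FFL.
have -> : h ^+ r * s * h = h ^+ r.+1 * s + h ^+ r * comm_br s h.
  by rewrite exprSr -!mulrA -mulrDr /comm_br addrC subrK.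
apply: (subspaceD (FF_subspace _)); first exact: FFh Fs _.
by apply: FFh (FS_comm_br Fs) _; rewrite addnS.
Qed.

Lemma FF_mulFS m n u s : FF m u -> FS n s -> FF (m + n) (u * s).
Proof.
move=> Fu Fs; elim: Fu => [c v w _ IHv _ IHw|r k s' Fs' rk].
  by rewrite mulrDl -scalerAl; exact: FFL.
by rewrite -mulrA; apply: FFh (FSM Fs' Fs) _; rewrite addnA leq_add2r.
Qed.

Lemma FFM m n u v : FF m u -> FF n v -> FF (m + n) (u * v).
Proof.
move=> Fu; elim=> [c v1 v2 _ IH1 _ IH2|r k s Fs rk].
  by rewrite mulrDr -scalerAr; exact: FFL.
have Fur : FF (m + r) (u * h ^+ r).
  elim: (r) => [|r' IH]; first by rewrite mulr1 addn0.
  by rewrite exprSr mulrA addnS; exact: FF_h.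
rewrite mulrA; apply: FF_mono (FF_mulFS Fur Fs).
by rewrite -addnA leq_add2l.
Qed.

Lemma FF1 n : FF n 1.
Proof. exact/FF_FS/FS1. Qed.

Lemma FF_g n u : FF n u -> FF n (u * g).
Proof.
move=> Fu; rewrite -[n]addn0; apply: FF_mulFS Fu _.
by rewrite -[g]mul1r; exact/FSg/FS1.
Qed.

Lemma FF_gX n t : FF n (g ^+ t).
Proof. by elim: t => [|t IH]; rewrite ?exprSr; [exact: FF1|exact: FF_g]. Qed.

Definition monomial r (l : seq (nat * nat)) s t : A :=
  h ^+ r * (\prod_(q <- l) z q.1 ^+ q.2) * x 1 ^+ s * g ^+ t.

Definition mon_span n : set A :=
  lspan [set e | exists r l s t,
    [/\ z_indices l, (monomial_weight r l s <= n)%N & e = monomial r l s t]].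

Lemma z_indices_cons q l : z_indices (q :: l) =
  [&& (2 <= q.1)%N, all (fun j => j < q.1)%N [seq q.1 | q <- l] & z_indices l].
Proof.
rewrite /z_indices /= path_sortedE; last by move=> i j k /= ij ki; exact: ltn_trans ki ij.
by rewrite -!andbA; do !bool_congr.
Qed.

(** The second clause of the conclusion is what the induction needs to keep the
    indices decreasing. *)
Lemma z_insert k l : (2 <= k)%N -> z_indices l -> exists l',
  [/\ z_indices l',
      forall b, (k < b)%N -> all (fun j => j < b)%N [seq q.1 | q <- l] ->
        all (fun j => j < b)%N [seq q.1 | q <- l'],
      (\sum_(q <- l') (q.1 - 1) * q.2 = \sum_(q <- l) (q.1 - 1) * q.2 + k.-1)%N &
      \prod_(q <- l') z q.1 ^+ q.2 = \prod_(q <- l) z q.1 ^+ q.2 * z k].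
Proof.
have Sp l0 : Ealg g h (\prod_(q <- l0) z q.1 ^+ q.2).
  elim: l0 => [|q l0 IH]; rewrite ?big_nil ?big_cons; first exact: Ealg1.
  exact: EalgM (EalgX _ (Ealg_zg p g h _)) IH.
move=> k2; elim: l => [|[i e] l IH].
  move=> _; exists [:: (k, 1%N)]; split.
  - by rewrite z_indices_cons /= k2.
  - by move=> b kb /=; rewrite kb.
  - by rewrite big_cons !big_nil /= muln1 addn0 add0n subn1.
  - by rewrite big_cons !big_nil /= mulr1 mul1r.
rewrite z_indices_cons /= => /and3P[i2 il zl].
have [ik|ki|eik] := ltngtP i k.
- exists ((k, 1%N) :: (i, e) :: l); split.
  + rewrite !z_indices_cons /= k2 ik i2 il zl /= !andbT.
    by apply: sub_all il => j ji; exact: ltn_trans ji ik.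
  + by move=> b kb /= ->; rewrite kb.
  + by rewrite big_cons /= muln1 addnC subn1.
  + by rewrite big_cons /= (EalgC EC (Sp _) (Ealg_zg p g h k)).
- have [l' [zl' ltl' sl' pl']] := IH zl; exists ((i, e) :: l'); split.
  + by rewrite z_indices_cons /= i2 zl' ltl'.
  + by move=> b kb /= /andP[-> /(ltl' b kb)].
  + by rewrite !big_cons sl' /= addnA.
  + by rewrite !big_cons pl' mulrA.
- rewrite -eik; exists ((i, e.+1) :: l); split.
  + by rewrite z_indices_cons /= i2 il.
  + by move=> b kb.
  + by rewrite !big_cons /= mulnS subn1 addnC addnA addnAC; congr (_ + _)%N; rewrite addnC.
  + rewrite !big_cons /= exprSr -!mulrA; congr (_ * _).
    by rewrite (EalgC EC (Ealg_zg p g h i) (Sp l)).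
Qed.

Lemma FS_mon_span n s : FS n s ->
  lspan [set e | exists l s t,
    [/\ z_indices l, (monomial_weight 0 l s <= n)%N & e = monomial 0 l s t]] s.
Proof.
have zEC k := EalgC EC (Ealg_zg p g h k).
have xC := EalgC EC (Ealg_xg p g h 1); have gC := EalgC EC (Ealg_g g h).
elim=> {n s} [n|n c u v _ IHu _ IHv|n u _ IH|m n i u i0 mn _ IH].
- apply: mem_lspan; exists [::], 0, 0; split=> //.
    by rewrite /monomial_weight big_nil.
  by rewrite /monomial big_nil !expr0 !mulr1.
- by have [_ L] := span_subspace [set e | exists l s t,
    [/\ z_indices l, (monomial_weight 0 l s <= n)%N & e = monomial 0 l s t]]; exact: L.
- move: u IH; apply: span_min.
    have := preim_subspace (mull_lin g) (span_subspace _); exact.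
  move=> _ [l [s [t [zl wl ->]]]] /=; apply: mem_lspan; exists l, s, t.+1; split=> //.
  by rewrite /monomial exprSr mulrA.
move: u IH; apply: span_min.
  have := preim_subspace (mull_lin (U i)) (span_subspace _); exact.
move=> _ [l [s [t [zl wl ->]]]] /=; apply: mem_lspan.
have SgX r : Ealg g h (g ^+ r) by exact: EalgX (Ealg_g _ _).
have SxX r : Ealg g h (x 1 ^+ r) by exact: EalgX (Ealg_xg p g h _).
case: i i0 mn => [|[|k]] // _ mn.
  exists l, s.+1, t; split=> //.
    by apply: leq_trans mn; rewrite /monomial_weight addnS addn1 ltnS.
  rewrite /monomial /U /= -!mulrA; do 2 congr (_ * _).
  by rewrite exprSr -mulrA; congr (_ * _); rewrite -xC.
have [l' [zl' _ sl' pl']] := z_insert (isT : 2 <= k.+2)%N zl.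
exists l', s, t; split=> //.
  apply: leq_trans mn; rewrite /monomial_weight sl' wtSS.
  by rewrite !add0n addnAC leq_add2r.
rewrite /monomial pl' /U /= -!mulrA; do 2 congr (_ * _).
by rewrite mulrA zEC //; exact: EalgM.
Qed.

Lemma FF_mon_span n : FF n = mon_span n.
Proof.
apply/seteqP; split=> u.
  elim=> [c v w _ IHv _ IHw|r m s Fs rm].
    by have [_ L] := span_subspace [set e | exists r l s t, [/\ z_indices l,
      (monomial_weight r l s <= n)%N & e = monomial r l s t]]; exact: L.
  move: s {Fs}(FS_mon_span Fs); apply: span_min.
    have := preim_subspace (mulr_lin (h ^+ r)) (span_subspace _); exact.
  move=> _ [l [s [t [zl wl ->]]]] /=; apply: mem_lspan; exists r, l, s, t; split=> //.
    apply: leq_trans rm; move: wl; rewrite /monomial_weight add0n -addnA.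
    by rewrite leq_add2l.
  by rewrite /monomial expr0 mul1r !mulrA.
move: u; apply: (span_min (FF_subspace n)) => _ [r [l [s [t [zl wl ->]]]]].
have Fz : FS (\sum_(q <- l) (q.1 - 1) * q.2) (\prod_(q <- l) z q.1 ^+ q.2).
  elim: l {wl} zl => [|q l IH]; first by rewrite !big_nil => _; exact: FS1.
  rewrite z_indices_cons => /and3P[q2 _ /IH Fl]; rewrite !big_cons.
  apply: FSM Fl; elim: (q.2) => [|e IHe]; first by rewrite muln0; exact: FS1.
  by rewrite mulnS exprS; apply: FSM IHe; rewrite subn1; apply: FS_z; exact: ltnW.
have -> : monomial r l s t = h ^+ r * ((\prod_(q <- l) z q.1 ^+ q.2) * x 1 ^+ s * g ^+ t).
  by rewrite /monomial !mulrA.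
apply: (@FFh n r (\sum_(q <- l) (q.1 - 1) * q.2 + s)%N); last by rewrite addnA.
elim: t => [|t IH]; first by rewrite mulr1; exact: FSM Fz (FS_x1X s).
by rewrite exprSr mulrA; exact: FSg.
Qed.

End Filtration.

(** * Decomposition along one generator *)

Section Decomposition.
Variables (K : fieldType) (p : nat) (charKp : p \in [pchar K]) (p_gt3 : (3 < p)%N).
Variables (A : algType K) (g h : A).
Local Notation E := (ad_iter g h).
Hypothesis EC : forall i j, E i * E j = E j * E i.
Hypothesis gp : g ^+ p = 1.
Hypothesis Ep0 : E p.-1 = 0.
Hypothesis hp : h ^+ p = 0.
Hypothesis Ekp : forall k, (0 < k <= p - 2)%N -> E k ^+ p = 0.
Hypothesis A_ind : forall P : A -> Prop, P 1 ->
  (forall c u v, P u -> P v -> P (c *: u + v)) ->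
  (forall u, P u -> P (u * g)) -> (forall u, P u -> P (u * h)) -> forall u, P u.
Local Notation x := (xg p g h).
Local Notation z := (zg p g h).
Local Notation U := (Ug p g h).

Lemma p2_gt0 : (0 < p - 2)%N.
Proof. by rewrite subn_gt0; exact: ltnW. Qed.

Lemma E_ge k : (p.-1 <= k)%N -> E k = 0.
Proof.
move=> /subnK <-; elim: (k - p.-1)%N => // m IH.
by rewrite addSn ad_iterS IH comm_br0.
Qed.

(** These subalgebras exhaust the one generated by the E_k by adding a single
    generator at a time ([Ealg_SN], [SN_Dec]). *)
Inductive SN (N : nat) : A -> Prop :=
| SN1 : SN N 1
| SNL c u v : SN N u -> SN N v -> SN N (c *: u + v)
| SNg u : SN N u -> SN N (u * g)
| SNU i u : (0 < i <= N)%N -> SN N u -> SN N (u * U i).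

Lemma SN_subspace N : is_subspace (SN N).
Proof.
split; last by move=> c u v; exact: SNL.
by rewrite -(addNr (1 : A)) -scaleN1r; apply: SNL; exact: SN1.
Qed.

Lemma SN_Ealg N u : SN N u -> Ealg g h u.
Proof.
elim=> {u} [|c u v _ IHu _ IHv|u _ IH|i u _ _ IH].
- exact: Ealg1.
- exact: EalgL.
- exact: EalgM IH (Ealg_g g h).
- exact: EalgM IH (Ealg_U p g h i).
Qed.

Lemma SN_mulx N u k : (0 < N)%N -> SN N u -> SN N (u * x 1 ^+ k).
Proof.
move=> N0 Su; elim: k => [|k IH]; first by rewrite mulr1.
by rewrite exprSr mulrA; apply: (@SNU _ 1).
Qed.

Lemma Ealg_SN u : Ealg g h u -> SN (p - 2) u.
Proof.
have N0 := p2_gt0.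
elim=> {u} [|c u v _ IHu _ IHv|k u _ IH]; [exact: SN1|exact: SNL|].
have [kp|kp] := leqP k (p - 2); last first.
  have pk : (p.-1 <= k)%N by move: kp; case: (p) p_gt3 => [|[|q]] // _; rewrite subn2.
  by rewrite (E_ge pk) mulr0; case: (SN_subspace (p - 2)).
case: k kp => [|k] kp; first exact: SNg.
rewrite -(xg_g p_gt3 EC gp) mulrA; apply: SNg.
case: k kp => [|k] kp; first exact: (@SNU _ 1).
have -> : x k.+2 = z k.+2 + zc K k.+2 *: x 1 ^+ k.+2 by rewrite subrK.
rewrite mulrDr addrC -scalerAr; apply: SNL; first exact: SN_mulx.
exact: (@SNU _ k.+2).
Qed.

Lemma SN0_gX u : SN 0 u -> lspan [set e | exists t, e = g ^+ t] u.
Proof.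
elim=> {u} [|c u v _ IHu _ IHv|u _ IH|[|i] u //].
- by apply: mem_lspan; exists 0; rewrite expr0.
- by have [_ L] := span_subspace [set e : A | exists t, e = g ^+ t]; exact: L.
move: u IH; apply: span_min.
  have := preim_subspace (mull_lin g) (span_subspace _); exact.
by move=> _ [t ->] /=; apply: mem_lspan; exists t.+1; rewrite exprSr.
Qed.

(** Polynomials in v of degree less than p with coefficients in T. *)
Definition Dec (v : A) (T : set A) (u : A) : Prop :=
  exists2 t : nat -> A, (forall j, T (t j)) & u = \sum_(j < p) v ^+ j * t j.

Section Dec.
Variables (v : A) (T : set A).
Hypothesis sT : is_subspace T.
Hypothesis vp : v ^+ p = 0.

Lemma Dec_subspace : is_subspace (Dec v T).
Proof.
split; first by exists (fun=> 0); [case: sT|rewrite big1 // => j _; rewrite mulr0].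
move=> c _ _ [t Tt ->] [t' Tt' ->]; exists (fun j => c *: t j + t' j).
  by move=> j; case: sT => _ L; exact: L.
rewrite scaler_sumr -big_split; apply: eq_bigr => j _ /=.
by rewrite mulrDr -scalerAr.
Qed.

Lemma Dec_single j t : T t -> Dec v T (v ^+ j * t).
Proof.
move=> Tt; have [jp|pj] := ltnP j p; last first.
  rewrite -(subnKC pj) exprD vp !mul0r; by case: Dec_subspace.
exists (fun i => if i == j then t else 0); first by move=> i; case: ifP => // _; case: sT.
rewrite (bigD1 (Ordinal jp)) //= eqxx big1 ?addr0 // => i.
by rewrite -val_eqE /= => /negPf ->; rewrite mulr0.
Qed.

Lemma Dec_sum n (j : 'I_n -> nat) (t : 'I_n -> A) : (forall i, T (t i)) ->
  Dec v T (\sum_(i < n) v ^+ j i * t i).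
Proof. by move=> Tt; apply: (subspace_sum Dec_subspace) => i; exact: Dec_single. Qed.

End Dec.

Lemma U_exp_p i : (0 < i <= p - 2)%N -> U i ^+ p = 0.
Proof.
have charA : p \in [pchar A] by rewrite (pchar_lalg A).
have xp k : (0 < k <= p - 2)%N -> x k ^+ p = 0.
  move=> kp; rewrite exprMn_comm ?Ekp ?mul0r //.
  by rewrite /GRing.comm (EalgC EC (Ealg_E g h k) (Ealg_gi p g h)).
have x1p : x 1 ^+ p = 0 by apply: xp; exact: p2_gt0.
move=> ip; rewrite /Ug; case: ifP => // _; rewrite -(pFrobenius_autE charA).
rewrite pFrobenius_autB_comm; last first.
  rewrite /GRing.comm -scalerAl -scalerAr (EalgC EC (Ealg_xg p g h i)) //.
  exact: EalgX (Ealg_xg p g h 1).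
rewrite !pFrobenius_autE xp // sub0r exprZn -exprM mulnC exprM x1p expr0n.
by case: (i) ip => // i' _; rewrite scaler0 oppr0.
Qed.

(** The powers of U_(N+1) are collected in front by commutativity, and those
    with exponent at least p vanish. *)
Lemma SN_Dec N u : (N.+1 <= p - 2)%N -> SN N.+1 u -> Dec (U N.+1) (SN N) u.
Proof.
move=> Np; have Up : U N.+1 ^+ p = 0 by exact: U_exp_p.
have sub := SN_subspace N; have dsub := Dec_subspace (U N.+1) sub.
elim=> {u} [|c u v _ IHu _ IHv|u _ [t St ->]|i u iN _ [t St ->]].
- by rewrite -[1]mul1r -(expr0 (U N.+1)); apply: Dec_single => //; exact: SN1.
- by case: dsub => _ L; exact: L.
- exists (fun j => t j * g); first by move=> j; exact: SNg.
  by rewrite mulr_suml; apply: eq_bigr => j _; rewrite mulrA.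
have [iN'|] := leqP i N.
  exists (fun j => t j * U i); first by move=> j; apply: SNU => //; case/andP: iN => ->.
  by rewrite mulr_suml; apply: eq_bigr => j _; rewrite mulrA.
case/andP: iN => _ iN Ni; have -> : i = N.+1 by apply/eqP; rewrite eqn_leq iN.
rewrite mulr_suml (eq_bigr (fun j : 'I_p => U N.+1 ^+ j.+1 * t j)); last first.
  move=> j _; rewrite exprSr -!mulrA; congr (_ * _).
  by rewrite (EalgC EC (SN_Ealg (St j)) (Ealg_U p g h N.+1)).
exact: Dec_sum.
Qed.

Lemma h_Dec u : Dec h (Ealg g h) u.
Proof.
have sub := Ealg_subspace g h; have dsub := Dec_subspace h sub.
elim/A_ind: u => [|c u v IHu IHv|u [t St ->]|u [t St ->]].
- by rewrite -[1]mul1r -(expr0 h); apply: Dec_single => //; exact: Ealg1.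
- by case: dsub => _ L; exact: L.
- exists (fun j => t j * g); first by move=> j; exact: EalgM (Ealg_g g h).
  by rewrite mulr_suml; apply: eq_bigr => j _; rewrite mulrA.
rewrite mulr_suml (eq_bigr (fun j : 'I_p => h ^+ j.+1 * t j + h ^+ j * comm_br (t j) h)).
  rewrite big_split; apply: (subspaceD dsub); first exact: Dec_sum.
  by apply: Dec_sum => // i; exact: Ealg_comm_br.
by move=> j _; rewrite exprSr -!mulrA -mulrDr /comm_br addrC subrK.
Qed.

Lemma FF_exhaust u : exists n, FF p g h n u.
Proof.
elim/A_ind: u => [|c u v [m Fu] [n Fv]|u [n Fu]|u [n Fu]].
- by exists 0; exact: FF1.
- exists (maxn m n); apply: FFL; first exact: FF_mono (leq_maxl _ _) Fu.
  exact: FF_mono (leq_maxr _ _) Fv.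
- by exists n; exact: FF_g.
- by exists n.+1; exact: (FF_h charKp p_gt3 EC gp).
Qed.

End Decomposition.

(** * Contractions of the coproduct *)

Definition functional (K : fieldType) (A : lmodType K) (f : A -> K) : Prop :=
  forall c u v, f (c *: u + v) = c * f u + f v.

Section Functionals.
Variables (K : fieldType) (A : algType K) (f : A -> K).
Hypothesis ff : functional f.

Lemma functional_lin : lin (f : A -> K^o).
Proof. by move=> c u v; exact: ff. Qed.

Lemma functional_mulr a : functional (fun u => f (u * a)).
Proof. by move=> c u v; rewrite mulrDl -scalerAl ff. Qed.

Lemma functional0 : f 0 = 0.
Proof. exact: (lin0 functional_lin). Qed.

Lemma functionalZ c u : f (c *: u) = c * f u.
Proof. exact: (linZ functional_lin). Qed.

Lemma functionalD u v : f (u + v) = f u + f v.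
Proof. exact: (linD functional_lin). Qed.

Lemma functionalB u v : f (u - v) = f u - f v.
Proof. exact: (linB functional_lin). Qed.

End Functionals.

(** [T] plays the role of A (x) A and [contr f], [contl f] that of id (x) f and
    f (x) id.  Of the functionals, [eps] is the counit, [tau] is dual to h, and
    [ef k] is an eps-derivation on the subalgebra generated by the E_k which
    detects E_k, for k <= 2. *)
Section Coalgebra.
Variables (K : fieldType) (p : nat) (charKp : p \in [pchar K]) (p_gt3 : (3 < p)%N).
Variables (A T : algType K) (tns : A -> A -> T) (g h : A).
Hypothesis tnsB : bilinear_map tns.
Hypothesis tnsM : forall a a' b b', tns a b * tns a' b' = tns (a * a') (b * b').
Hypothesis tns1 : tns 1 1 = 1.
Hypothesis tns_ind : forall P : T -> Prop,
  P 0 -> (forall c a b t, P t -> P (c *: tns a b + t)) -> forall t, P t.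
Local Notation E := (ad_iter g h).
Hypothesis EC : forall i j, E i * E j = E j * E i.
Hypothesis gp : g ^+ p = 1.
Hypothesis Ep0 : E p.-1 = 0.
Hypothesis hp : h ^+ p = 0.
Hypothesis Ekp : forall k, (0 < k <= p - 2)%N -> E k ^+ p = 0.
Hypothesis A_ind : forall P : A -> Prop, P 1 ->
  (forall c u v, P u -> P v -> P (c *: u + v)) ->
  (forall u, P u -> P (u * g)) -> (forall u, P u -> P (u * h)) -> forall u, P u.
Variable Delta : A -> T.
Hypothesis DeltaL : lin Delta.
Hypothesis Delta1 : Delta 1 = 1.
Hypothesis DeltaM : {morph Delta : u v / u * v}.
Hypothesis Deltag : Delta g = tns g g.
Hypothesis Deltah : Delta h = tns 1 h + tns h g.
Variables contr contl : (A -> K) -> T -> A.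
Hypothesis contrL : forall f, functional f -> lin (contr f).
Hypothesis contlL : forall f, functional f -> lin (contl f).
Hypothesis contrE : forall f, functional f -> forall a b, contr f (tns a b) = f b *: a.
Hypothesis contlE : forall f, functional f -> forall a b, contl f (tns a b) = f a *: b.
Variables (eps tau : A -> K) (ef : nat -> A -> K).
Hypothesis eps_fun : functional eps.
Hypothesis eps1 : eps 1 = 1.
Hypothesis eps_g : forall u, eps (u * g) = eps u.
Hypothesis eps_h : forall u, eps (u * h) = 0.
Hypothesis tau_fun : functional tau.
Hypothesis tau1 : tau 1 = 0.
Hypothesis tau_g : forall u, tau (u * g) = tau u.
Hypothesis tau_h : forall u, tau (u * h) = eps u.
Hypothesis ef_fun : forall k, functional (ef k).
Hypothesis ef1 : forall k, ef k 1 = 0.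
Hypothesis efM : forall k u v, Ealg g h u -> Ealg g h v ->
  ef k (u * v) = ef k u * eps v + eps u * ef k v.
Hypothesis ef_g : forall k, ef k g = (k == 0%N)%:R.
Hypothesis ef_br0 : forall u, ef 0 (comm_br u h) = 0.
Hypothesis ef_brS : forall k u, (k <= 1)%N ->
  ef k.+1 (comm_br u h) = k.+2%:R * ef k u.

Definition hitr f u := contr f (Delta u).
Definition hitl f u := contl f (Delta u).

Lemma hitr_lin f : functional f -> lin (hitr f).
Proof. by move=> ff c u v; rewrite /hitr DeltaL (contrL ff). Qed.

Lemma hitl_lin f : functional f -> lin (hitl f).
Proof. by move=> ff c u v; rewrite /hitl DeltaL (contlL ff). Qed.

Lemma contr_mul f t a b : functional f ->
  contr f (t * tns a b) = contr (fun y => f (y * b)) t * a.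
Proof.
move=> ff; have fb := functional_mulr ff b; elim/tns_ind: t => [|c a' b' t IH].
  by rewrite mul0r (lin0 (contrL ff)) (lin0 (contrL fb)) mul0r.
rewrite (mull_lin (tns a b) c) (contrL ff) (contrL fb) IH mulrDl -scalerAl.
by rewrite tnsM (contrE ff) (contrE fb) -scalerAl.
Qed.

Lemma contl_mul f t a b : functional f ->
  contl f (t * tns a b) = contl (fun y => f (y * a)) t * b.
Proof.
move=> ff; have fb := functional_mulr ff a; elim/tns_ind: t => [|c a' b' t IH].
  by rewrite mul0r (lin0 (contlL ff)) (lin0 (contlL fb)) mul0r.
rewrite (mull_lin (tns a b) c) (contlL ff) (contlL fb) IH mulrDl -scalerAl.
by rewrite tnsM (contlE ff) (contlE fb) -scalerAl.
Qed.

Lemma hitr1 f : functional f -> hitr f 1 = f 1 *: 1.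
Proof. by move=> ff; rewrite /hitr Delta1 -tns1 (contrE ff). Qed.

Lemma hitl1 f : functional f -> hitl f 1 = f 1 *: 1.
Proof. by move=> ff; rewrite /hitl Delta1 -tns1 (contlE ff). Qed.

Lemma hitr_mulg f u : functional f -> hitr f (u * g) = hitr (fun y => f (y * g)) u * g.
Proof. by move=> ff; rewrite /hitr DeltaM Deltag contr_mul. Qed.

Lemma hitl_mulg f u : functional f -> hitl f (u * g) = hitl (fun y => f (y * g)) u * g.
Proof. by move=> ff; rewrite /hitl DeltaM Deltag contl_mul. Qed.

Lemma fun_mulr1 (f : A -> K) : (fun y => f (y * 1)) = f.
Proof. by apply: funext => y; rewrite mulr1. Qed.

Lemma hitr_mulh f u : functional f ->
  hitr f (u * h) = hitr (fun y => f (y * h)) u + hitr (fun y => f (y * g)) u * h.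
Proof.
move=> ff; rewrite /hitr DeltaM Deltah mulrDr (linD (contrL ff)) !contr_mul //.
by rewrite mulr1.
Qed.

Lemma hitl_mulh f u : functional f ->
  hitl f (u * h) = hitl f u * h + hitl (fun y => f (y * h)) u * g.
Proof.
move=> ff; rewrite /hitl DeltaM Deltah mulrDr (linD (contlL ff)) !contl_mul //.
by rewrite fun_mulr1.
Qed.

(** This is coassociativity; it is inherited from the generators. *)
Lemma hitl_hitr f e u : functional f -> functional e -> hitl f (hitr e u) = hitr e (hitl f u).
Proof.
move=> ff fe; move: f e ff fe; elim/A_ind: u => [|c u v IHu IHv|u IH|u IH] f e ff fe.
- rewrite (hitr1 fe) (hitl1 ff) (linZ (hitl_lin ff)) (linZ (hitr_lin fe)).
  by rewrite (hitl1 ff) (hitr1 fe) !scalerA mulrC.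
- by rewrite (hitr_lin fe) (hitl_lin ff) (hitl_lin ff) (hitr_lin fe) IHu ?IHv.
- rewrite (hitr_mulg _ fe) (hitl_mulg _ ff) (hitl_mulg _ ff) (hitr_mulg _ fe).
  by rewrite IH //; exact: functional_mulr.
have fg := functional_mulr ff g; have fh := functional_mulr ff h.
have eg := functional_mulr fe g; have eh := functional_mulr fe h.
rewrite (hitr_mulh _ fe) (hitl_mulh _ ff) (linD (hitl_lin ff)) (linD (hitr_lin fe)).
by rewrite (hitl_mulh _ ff) (hitr_mulh _ fe) (hitr_mulg _ fe) !IH // addrA.
Qed.

Lemma hitr_eps u : hitr eps u = u.
Proof.
have eg : (fun y => eps (y * g)) = eps by apply: funext => y; exact: eps_g.
have eh : (fun y => eps (y * h)) = (fun _ : A => 0) by apply: funext => y; exact: eps_h.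
have f0 : functional (fun _ : A => 0 : K) by move=> c v w; rewrite mulr0 addr0.
have R0 v : hitr (fun _ : A => 0) v = 0.
  rewrite /hitr; elim/tns_ind: (Delta v) => [|c a b t IH]; first by rewrite (lin0 (contrL f0)).
  by rewrite (contrL f0) IH (contrE f0) scale0r scaler0 addr0.
elim/A_ind: u => [|c u v IHu IHv|u IH|u IH].
- by rewrite (hitr1 eps_fun) eps1 scale1r.
- by rewrite (hitr_lin eps_fun) IHu IHv.
- by rewrite (hitr_mulg _ eps_fun) eg IH.
- by rewrite (hitr_mulh _ eps_fun) eg eh R0 IH add0r.
Qed.

Lemma eps_hitl f u : functional f -> eps (hitl f u) = f u.
Proof.
move: f; elim/A_ind: u => [|c u v IHu IHv|u IH|u IH] f ff.
- by rewrite (hitl1 ff) (functionalZ eps_fun) eps1 mulr1.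
- by rewrite (hitl_lin ff) eps_fun IHu ?IHv ?ff.
- by rewrite (hitl_mulg _ ff) eps_g IH //; exact: functional_mulr.
rewrite (hitl_mulh _ ff) (functionalD eps_fun) eps_h add0r eps_g IH //.
exact: functional_mulr.
Qed.

Lemma eps_gval : eps g = 1.
Proof. by rewrite -[g]mul1r eps_g. Qed.

Lemma epsM : {morph eps : u v / u * v}.
Proof.
move=> u; elim/A_ind => [|c v w IHv IHw|v IH|v IH].
- by rewrite eps1 !mulr1.
- by rewrite mulrDr -scalerAr !eps_fun IHv IHw mulrDr mulrCA.
- by rewrite mulrA !eps_g.
- by rewrite mulrA !eps_h mulr0.
Qed.

Lemma hitr_gX f t : functional f -> hitr f (g ^+ t) = f (g ^+ t) *: g ^+ t.
Proof.
move: f; elim: t => [|t IH] f ff; first by rewrite hitr1.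
rewrite exprSr hitr_mulg // IH; last exact: functional_mulr.
by rewrite -scalerAl.
Qed.

(** ** The derivation dual to h *)

Lemma hitr_tau_g u : hitr tau (u * g) = hitr tau u * g.
Proof. by rewrite hitr_mulg //; congr (hitr _ u * g); apply: funext => y; exact: tau_g. Qed.

Lemma hitr_tau_h u : hitr tau (u * h) = u + hitr tau u * h.
Proof.
rewrite hitr_mulh //; congr (_ + hitr _ u * h); last by apply: funext => y; exact: tau_g.
rewrite -[RHS]hitr_eps; congr (hitr _ u); apply: funext => y; exact: tau_h.
Qed.

Lemma hitr_tau_E u k : hitr tau (u * E k) = hitr tau u * E k.
Proof.
elim: k u => [|k IH] u; first exact: hitr_tau_g.
have lt := hitr_lin tau_fun.
rewrite ad_iterS /comm_br mulrBr (linB lt) mulrA hitr_tau_h IH mulrA IH hitr_tau_h.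
by rewrite mulrBr !mulrA mulrDl opprD addrA addrAC [_ + _ - _]addrC addrA addKr.
Qed.

Lemma hitr_tau_Ealg u s : Ealg g h s -> hitr tau (u * s) = hitr tau u * s.
Proof.
have lt := hitr_lin tau_fun.
elim=> {s} [|c v w _ IHv _ IHw|k v _ IH]; first by rewrite !mulr1.
  by rewrite !mulrDr -!scalerAr lt IHv IHw.
by rewrite mulrA hitr_tau_E IH mulrA.
Qed.

Lemma hitr_tau_hX r s : Ealg g h s ->
  hitr tau (h ^+ r * s) = (h ^+ r.-1 * s) *+ r.
Proof.
move=> Ss; rewrite (hitr_tau_Ealg _ Ss) -mulrnAl; congr (_ * _).
elim: r => [|r IH]; first by rewrite (hitr1 tau_fun) tau1 scale0r.
rewrite exprSr hitr_tau_h IH; case: r {IH} => [|r]; first by rewrite mul0r addr0.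
by rewrite mulrnAl -exprSr -mulrS.
Qed.

(** ** Derivations dual to the x_m *)

Definition is_der (D : A -> A) : Prop :=
  [/\ lin D, forall u, Ealg g h u -> Ealg g h (D u) &
      forall u v, Ealg g h u -> Ealg g h v -> D (u * v) = D u * v + u * D v].

Local Notation ETs := (Etens tns g h).

Lemma Delta_E k : Delta (E k) = ad_iter (tns g g) (tns 1 h + tns h g) k.
Proof.
elim: k => [|k IHk]; first exact: Deltag.
by rewrite !ad_iterS -IHk /comm_br (linB DeltaL) !DeltaM Deltah.
Qed.

Lemma Etens_Delta u : Ealg g h u -> ETs (Delta u).
Proof.
have sE := Etens_subspace tns g h.
elim=> {u} [|c u v _ IHu _ IHv|k u _ IH].
- by rewrite Delta1 -tns1; apply: Etens_tns; exact: Ealg1.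
- by rewrite DeltaL; case: sE => _ Ladd; exact: Ladd.
rewrite DeltaM Delta_E.
have : ETs (ad_iter (tns g g) (tns 1 h + tns h g) k) by exact: Etens_ad_iter.
move: (ad_iter _ _ k) => w Ew; move: (Delta u) IH => t Et.
move: w Ew; apply: span_min.
  exact: (preim_subspace (mulr_lin t) sE).
move=> _ [a [b [Sa Sb ->]]] /=; move: t Et; apply: span_min.
  exact: (preim_subspace (mull_lin (tns a b)) sE).
move=> _ [a' [b' [Sa' Sb' ->]]] /=; rewrite tnsM.
by apply: Etens_tns; exact: EalgM.
Qed.

Lemma contr_eps_der k t u : ETs t -> ETs u -> contr (ef k) (t * u) =
  contr (ef k) t * contr eps u + contr eps t * contr (ef k) u.
Proof.
have lk := contrL (ef_fun k); have le := contrL eps_fun.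
move=> Et; move: u; apply: span_min.
  split=> [|c u v /= Eu Ev] /=.
    by rewrite mulr0 (lin0 lk) (lin0 le) !mulr0 addr0.
  rewrite (mulr_lin t c u v) !lk le Eu Ev !mulrDr -!scalerAr scalerDr.
  by rewrite -!addrA; congr (_ + _); rewrite addrCA.
move=> _ [a' [b' [Sa' Sb' ->]]] /=; move: t Et; apply: span_min.
  split=> [|c u v /= Eu Ev] /=.
    by rewrite mul0r (lin0 lk) (lin0 le) !mul0r addr0.
  rewrite (mull_lin (tns a' b') c u v) !lk le Eu Ev !mulrDl -!scalerAl scalerDr.
  by rewrite -!addrA; congr (_ + _); rewrite addrCA.
move=> _ [a [b [Sa Sb ->]]] /=.
rewrite tnsM !(contrE (ef_fun k)) !(contrE eps_fun) efM // scalerDl.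
by rewrite -!scalerAl -!scalerAr !scalerA.
Qed.

(** [ef k] is a derivation along the counit, which acts as the identity. *)
Lemma hitr_ef_der k : is_der (hitr (ef k)).
Proof.
split; first exact: (hitr_lin (ef_fun k)).
  move=> u /Etens_Delta; rewrite /hitr; move: (Delta u); apply: span_min.
    exact: (preim_subspace (contrL (ef_fun k)) (Ealg_subspace g h)).
  move=> _ [a [b [Sa Sb ->]]] /=; rewrite (contrE (ef_fun k)).
  exact: (subspaceZ (Ealg_subspace g h)).
move=> u v Su Sv; rewrite {1}/hitr DeltaM contr_eps_der; [|exact: Etens_Delta|exact: Etens_Delta].
by rewrite -/(hitr eps u) -/(hitr eps v) !hitr_eps.
Qed.

Lemma is_der_comm D D' : is_der D -> is_der D' ->
  is_der (fun u => D (D' u) - D' (D u)).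
Proof.
move=> [DL DS DM] [DL' DS' DM']; split.
- move=> c u v; rewrite DL' DL DL DL' scalerBr opprD addrACA; congr (_ + _).
- by move=> u Su; apply: (subspaceB (Ealg_subspace g h)); auto.
move=> u v Su Sv; have [Du Dv] := (DS u Su, DS v Sv).
have [Du' Dv'] := (DS' u Su, DS' v Sv).
rewrite (DM' u v Su Sv) (DM u v Su Sv) (linD DL) (linD DL').
rewrite (DM _ _ Du' Sv) (DM _ _ Su Dv') (DM' _ _ Du Sv) (DM' _ _ Su Dv).
rewrite mulrBl mulrBr.
rewrite !opprD [LHS](AC ((2*2)*(2*2)) ((1*5)*(4*8)*(2*7)*(3*6))) /=.
by rewrite !subrr !addr0.
Qed.

Lemma hitr_comm_br f u : functional f -> Ealg g h u ->
  hitr f (comm_br u h) = hitr (fun b => f (comm_br b h)) u +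
                      comm_br (hitr (fun b => f (b * g)) u) h.
Proof.
move=> ff Su; rewrite /hitr.
have f1 : functional (fun b => f (comm_br b h)).
  by move=> c v w; rewrite comm_brD comm_brZ ff.
have f2 := functional_mulr ff g.
have -> : Delta (comm_br u h) = comm_br (Delta u) (tns 1 h + tns h g).
  by rewrite /comm_br (linB DeltaL) !DeltaM Deltah.
move: (Delta u) (Etens_Delta Su); apply: span_min.
  split=> [|c v w /= Ev Ew] /=.
    by rewrite comm_br0 (lin0 (contrL ff)) (lin0 (contrL f1)) (lin0 (contrL f2)) comm_br0 addr0.
  rewrite comm_brD comm_brZ (contrL ff) (contrL f1) (contrL f2) Ev Ew.
  by rewrite comm_brD comm_brZ scalerDr addrACA.
move=> _ [a [b [Sa Sb ->]]] /=.
rewrite (comm_br_tns tnsB tnsM EC _ Sb) (linD (contrL ff)) !(contrE ff).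
by rewrite (contrE f1) (contrE f2) comm_brZ.
Qed.

Lemma contr_ext f f' t : functional f -> functional f' ->
  ETs t -> (forall b, Ealg g h b -> f b = f' b) -> contr f t = contr f' t.
Proof.
move=> ff ff' Et e; move: t Et; apply: span_min.
  split=> [|c v w /= Ev Ew] /=; first by rewrite (lin0 (contrL ff)) (lin0 (contrL ff')).
  by rewrite (contrL ff) (contrL ff') Ev Ew.
by move=> _ [a [b [_ Sb ->]]] /=; rewrite !contrE ?e.
Qed.

Lemma functionalMl c (f : A -> K) : functional f -> functional (fun b => c * f b).
Proof. by move=> ff d u v; rewrite ff mulrDr mulrCA. Qed.

Lemma contrMl c f t : functional f -> contr (fun b => c * f b) t = c *: contr f t.
Proof.
move=> ff; have fc := functionalMl c ff.
elim/tns_ind: t => [|d a b t IH].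
  by rewrite (lin0 (contrL ff)) (lin0 (contrL fc)) scaler0.
by rewrite (contrL ff) (contrL fc) (contrE ff) (contrE fc) IH scalerDr !scalerA mulrA [d * c]mulrC.
Qed.

Lemma hitr_ef0_comm_br u : Ealg g h u ->
  hitr (ef 0) (comm_br u h) = comm_br (hitr (ef 0) u) h + comm_br u h.
Proof.
move=> Su; have f0 := ef_fun 0; have Et := Etens_Delta Su.
rewrite (hitr_comm_br f0 Su); have -> : hitr (fun b => ef 0 (comm_br b h)) u = 0.
  have z0 : functional (fun b : A => 0 * eps b) by exact: functionalMl.
  have -> : (fun b => ef 0 (comm_br b h)) = (fun b => 0 * eps b).
    by apply: funext => b; rewrite ef_br0 mul0r.
  by rewrite /hitr (contrMl _ _ eps_fun) scale0r.
rewrite add0r -{3}[u]hitr_eps -comm_brD; congr (comm_br _ h); rewrite /hitr.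
have fe : functional (fun b => 1 * ef 0 b + eps b).
  by move=> c v w; rewrite f0 eps_fun !mul1r mulrDr addrACA.
rewrite (contr_ext (f' := fun b => 1 * ef 0 b + eps b)) //; first last.
- by move=> b Sb; rewrite (efM 0 Sb (Ealg_g g h)) eps_gval ef_g !mulr1 mul1r.
- exact: functional_mulr.
move: (Delta u) Et; apply: span_min.
  split=> [|c v w /= Ev Ew] /=.
    by rewrite (lin0 (contrL fe)) (lin0 (contrL f0)) (lin0 (contrL eps_fun)) addr0.
  by rewrite (contrL fe) (contrL f0) (contrL eps_fun) Ev Ew scalerDr addrACA.
by move=> _ [a [b [_ _ ->]]] /=; rewrite !contrE // mul1r scalerDl.
Qed.

Lemma hitr_efS_comm_br k u : (k <= 1)%N -> Ealg g h u ->
  hitr (ef k.+1) (comm_br u h) = k.+2%:R *: hitr (ef k) u + comm_br (hitr (ef k.+1) u) h.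
Proof.
move=> k1 Su; have fk := ef_fun k.+1.
rewrite (hitr_comm_br fk Su); congr (_ + comm_br _ h).
  have -> : (fun b => ef k.+1 (comm_br b h)) = (fun b => k.+2%:R * ef k b).
    by apply: funext => b; exact: ef_brS.
  by rewrite /hitr contrMl.
apply: contr_ext; [exact: functional_mulr|by []|exact: Etens_Delta|] => b Sb.
by rewrite (efM _ Sb (Ealg_g g h)) ef_g eps_gval mulr0 addr0 mulr1.
Qed.

Lemma ffact_rec n k : (n.+1 ^_ k.+1 = n ^_ k.+1 + k.+1 * n ^_ k)%N.
Proof.
rewrite ffactSS ffactnSr; have [kn|nk] := leqP k n.
  by rewrite [(n ^_ k * _)%N]mulnC -mulnDl addnS subnK.
by rewrite ffact_small // !muln0.
Qed.

(** On the series of the E_n t^(n+1)/(n+1)! the operator [hitr (ef k)] is the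
    vector field t^(k+1) d/dt. *)
Lemma hitr_ef_E k n : (k <= 2)%N ->
  hitr (ef k) (E n) = (n.+1 ^_ k.+1)%:R *: E (n - k).
Proof.
elim: n k => [|n IH] k k2.
  rewrite {1}/hitr -[E 0]/g Deltag (contrE (ef_fun k)) ef_g.
  by case: k k2 => [|k] _ //; rewrite ffact_small.
have SE := Ealg_E g h n; case: k k2 => [|k] k2.
  rewrite ad_iterS (hitr_ef0_comm_br SE) (IH 0) // !ffactn1 !subn0 comm_brZ -ad_iterS.
  by rewrite -[E n.+1 in X in _ + X]scale1r -scalerDl natr1.
rewrite ad_iterS (hitr_efS_comm_br k2 SE) (IH k) 1?ltnW // (IH k.+1) // comm_brZ.
rewrite subSS (ffact_rec n.+1) natrD natrM [RHS]scalerDl [RHS]addrC scalerA; congr (_ + _).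
have [kn|nk] := ltnP k n; last by rewrite ffact_small ?ltnS // !scale0r.
by rewrite -ad_iterS -subSn // subSS.
Qed.

(** ** Lowering operators *)

(** [Dop N] is a multiple of the vector field t^(N+1) d/dt, obtained from
    those for N = 1 and N = 2 by commutators with the first one.  It lowers the
    index of [annpow] by the weight of U_N, because a commutator lowers it by
    the sum of what its members do ([Dop_annpow]). *)
Definition Dop (N : nat) : A -> A :=
  if N is m.+2 then
    iter m (fun D u => hitr (ef 1) (D u) - D (hitr (ef 1) u)) (hitr (ef 2))
  else hitr (ef 1).

(** The commutator of t^2 d/dt and t^(N+1) d/dt is N-1 times t^(N+2) d/dt, up to
    sign. *)
Definition mu (N : nat) : K := \prod_(i < N - 2) (- i.+1%:R).

Lemma Dop_rec m u : Dop m.+3 u = hitr (ef 1) (Dop m.+2 u) - Dop m.+2 (hitr (ef 1) u).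
Proof. by []. Qed.

Lemma Dop_der N : is_der (Dop N).
Proof.
case: N => [|[|m]]; [exact: hitr_ef_der|exact: hitr_ef_der|].
elim: m => [|m IH]; first exact: hitr_ef_der.
exact: is_der_comm (hitr_ef_der 1) IH.
Qed.

Lemma mu_rec m : mu m.+3 = mu m.+2 * - m.+1%:R.
Proof. by rewrite /mu !subn2 big_ord_recr. Qed.

Lemma mu_neq0 N : (N <= p - 2)%N -> mu N != 0.
Proof.
move=> Np; apply/prodf_neq0 => i _; rewrite oppr_eq0 (natr_neq0 charKp) //=.
apply: leq_trans (leq_subr 2 p); apply: leq_trans Np.
by case: N i => [|[|N]] [i] //=; rewrite ?subn2 // ltnS => /ltnW.
Qed.

Lemma Dop_E N n : (0 < N)%N ->
  Dop N (E n) = (mu N * (n.+1 ^_ N.+1)%:R) *: E (n - N).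
Proof.
case: N => [|[|m]] // _; first by rewrite -[Dop 1]/(hitr (ef 1)) hitr_ef_E // /mu big_ord0 mul1r.
elim: m n => [|m IH] n; first by rewrite -[Dop 2]/(hitr (ef 2)) hitr_ef_E // /mu big_ord0 mul1r.
have [DL _ _] := Dop_der m.+2.
rewrite Dop_rec IH (linZ (hitr_lin (ef_fun 1))) !hitr_ef_E // (linZ DL) IH !scalerA.
have [nm|mn] := ltnP n m.+2.
  have z1 : (n.+1 ^_ m.+3 = 0)%N by rewrite ffact_small.
  have z2 : ((n - 1).+1 ^_ m.+3 = 0)%N.
    by rewrite ffact_small // ltnS; apply: leq_ltn_trans nm; exact: leq_subr.
  have z3 : (n.+1 ^_ m.+4 = 0)%N by rewrite ffact_small // ltnS ltnW.
  by rewrite z1 z2 z3 !mulr0 mul0r !scale0r subr0.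
case: n mn => // n mn.
have q1 : (n.+1 - m.+2 - 1 = n - m.+2)%N by rewrite -subnDA addn1 subSS.
have q2 : (n.+1 - 1 = n)%N by rewrite subn1.
rewrite q1 q2 [(n.+1 - m.+3)%N]subSS -scalerBl; congr (_ *: _).
set d := (n.+1 - m.+2)%N; have nd : n.+1 = (d + m.+2)%N by rewrite subnK.
have e1 : (n.+2 ^_ m.+4 = n.+2 ^_ m.+3 * d)%N by rewrite ffactnSr subSS.
have ab : (n.+2 ^_ m.+3)%:R * (d.+1 ^_ 2)%:R = (n.+2 ^_ m.+4)%:R * d.+1%:R :> K.
  by rewrite (ffactSS d 1) ffactn1 -!natrM e1 mulnCA mulnC.
have cd : (n.+2 ^_ 2)%:R * (n.+1 ^_ m.+3)%:R = (n.+2 ^_ m.+4)%:R * (d + m.+2)%:R :> K.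
  by rewrite -nd -!natrM (ffactSS n.+1 m.+3) (ffactSS n.+1 1) ffactn1 mulnAC.
rewrite -mulrA ab [X in _ - X]mulrCA cd mu_rec natrD -natr1 -[m.+2%:R]natr1.
by ring.
Qed.

Lemma der1 D : is_der D -> D 1 = 0.
Proof.
move=> [_ _ DM]; have := DM 1 1 (Ealg1 g h) (Ealg1 g h).
by rewrite !mulr1 mul1r => /eqP; rewrite -subr_eq subrr eq_sym => /eqP.
Qed.

Lemma derX D n u : is_der D -> Ealg g h u -> D (u ^+ n) = (u ^+ n.-1 * D u) *+ n.
Proof.
move=> derD Su; have [_ DS DM] := derD; elim: n => [|n IH]; first exact: der1.
rewrite exprS DM ?IH //; last exact: EalgX.
case: n {IH} => [|n]; first by rewrite mulr0n mulr0 addr0 expr0 mulr1 mul1r.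
rewrite mulrnAr mulrA -exprS [RHS]mulrS; congr (_ + _).
by rewrite (EalgC EC (DS _ Su) (EalgX n.+1 Su)).
Qed.

Local Notation x := (xg p g h).
Local Notation z := (zg p g h).
Local Notation U := (Ug p g h).

Lemma Dop_g N : (0 < N)%N -> Dop N g = 0.
Proof.
move=> N0; rewrite -[g]/(E 0) Dop_E // ffact_small ?mulr0 ?scale0r //.
Qed.

Lemma Dop_x N n : (0 < N)%N ->
  Dop N (x n) = (mu N * (n.+1 ^_ N.+1)%:R) *: x (n - N).
Proof.
move=> N0; have [_ _ DM] := Dop_der N.
rewrite DM; [|exact: Ealg_E|exact: Ealg_gi].
rewrite Dop_E // (derX _ (Dop_der N) (Ealg_g g h)) Dop_g // mulr0 mul0rn mulr0.
by rewrite addr0 -scalerAl.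
Qed.

Lemma Dop_x1 N : (1 < N)%N -> Dop N (x 1) = 0.
Proof. by move=> N1; rewrite Dop_x 1?ltnW // ffact_small // mulr0 scale0r. Qed.

Lemma Dop_z N n : (1 < N)%N -> Dop N (z n) = Dop N (x n).
Proof.
move=> N1; have [DL _ _] := Dop_der N.
rewrite (linB DL) (linZ DL) (derX _ (Dop_der N) (Ealg_xg p g h 1)) Dop_x1 //.
by rewrite mulr0 mul0rn scaler0 subr0.
Qed.

Lemma Dop_U_lt N i : (0 < i < N)%N -> Dop N (U i) = 0.
Proof.
move=> /andP[i0 iN]; have N1 : (1 < N)%N by exact: leq_ltn_trans iN.
rewrite /Ug; case: ifP => _; first exact: Dop_x1.
by rewrite Dop_z // Dop_x 1?ltnW // ffact_small // mulr0 scale0r.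
Qed.

Lemma Dop_U N : (0 < N)%N -> Dop N (U N) = (mu N * (N.+1)`!%:R) *: 1.
Proof.
move=> N0; have -> : Dop N (U N) = Dop N (x N).
  case: N N0 => [|[|N]] // _; exact: Dop_z.
by rewrite Dop_x // ffactnn subnn (xg0 p_gt3 _ gp).
Qed.

Lemma Dop_SN N u : SN p g h N u -> Dop N.+1 u = 0.
Proof.
have derD := Dop_der N.+1; have [DL _ DM] := derD.
elim=> {u} [|c u v _ IHu _ IHv|u Su IH|i u iN Su IH]; first exact: der1.
- by rewrite DL IHu IHv scaler0 addr0.
- rewrite DM ?IH ?Dop_g ?mul0r ?mulr0 ?addr0 //; first exact: SN_Ealg Su.
  exact: Ealg_g.
rewrite DM ?IH ?Dop_U_lt ?mul0r ?mulr0 ?addr0 //; first exact: SN_Ealg Su.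
exact: Ealg_U.
Qed.

Lemma Dop_UX N j t : SN p g h N t ->
  Dop N.+1 (U N.+1 ^+ j * t) =
  (mu N.+1 * (N.+2)`!%:R) *: ((U N.+1 ^+ j.-1 * t) *+ j).
Proof.
move=> St; have derD := Dop_der N.+1; have [DL _ DM] := derD.
have SU : Ealg g h (U N.+1) by exact: Ealg_U.
rewrite DM; [|exact: EalgX|exact: SN_Ealg St].
rewrite (Dop_SN St) mulr0 addr0 derX // Dop_U // -scalerAr mulr1.
by rewrite mulrnAl -scalerAl scalerMnr.
Qed.

(** ** Annihilation by products of functionals vanishing on the coradical *)

Definition kills_gX (f : A -> K) : Prop := functional f /\ forall t, f (g ^+ t) = 0.

(** In the convolution algebra of functionals, let J be the ideal of those which
    vanish on the powers of g: this is the annihilator of J^n. *)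
Fixpoint annpow (n : nat) (u : A) : Prop :=
  if n is m.+1 then forall f, kills_gX f -> annpow m (hitr f u) else u = 0.

Lemma annpow_subspace n : is_subspace (annpow n).
Proof.
elim: n => [|n [IH0 IHL]]; first by split=> [//|c u v /= -> ->]; rewrite scaler0 addr0.
split=> [f [ff _]|c u v Bu Bv f af] /=; first by rewrite (lin0 (hitr_lin ff)).
by rewrite (hitr_lin (proj1 af)); apply: IHL; [exact: Bu|exact: Bv].
Qed.

Lemma annpow_hitr n f u : kills_gX f -> annpow n u -> annpow n.-1 (hitr f u).
Proof.
case: n => [|n] af; last exact.
by move=> /= ->; case: af => ff _; rewrite (lin0 (hitr_lin ff)).
Qed.

Lemma kills_gX_ef k : kills_gX (ef k.+1).
Proof.
split=> // t; elim: t => [|t IH]; first by rewrite expr0 ef1.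
rewrite exprSr efM; [|exact/EalgX/Ealg_g|exact: Ealg_g].
by rewrite IH ef_g mul0r mulr0 addr0.
Qed.

Lemma kills_gX_tau : kills_gX tau.
Proof. by split=> // t; elim: t => [|t IH]; rewrite ?expr0 // exprSr tau_g. Qed.

Lemma Dop_annpow N n u : (0 < N)%N -> annpow n u -> annpow (n - wt N) (Dop N u).
Proof.
case: N => [|[|m]] // _; first by rewrite subn1; exact: annpow_hitr (kills_gX_ef 0).
rewrite wtSS; elim: m n u => [|m IH] n u Bu; first by rewrite subn1; exact: (annpow_hitr (kills_gX_ef 1) Bu).
rewrite Dop_rec; apply: (subspaceB (annpow_subspace _)).
  by rewrite subnS; apply: annpow_hitr (kills_gX_ef 0) _; exact: IH.
have -> : (n - m.+2 = n.-1 - m.+1)%N by rewrite -subn1 -subnDA add1n.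
by apply: IH; exact: annpow_hitr (kills_gX_ef 0) _.
Qed.

(** ** The coproduct respects the filtration *)

Local Notation FF := (FF p g h).
Local Notation FS := (FS p g h).

Definition FFtens n : set T :=
  lspan [set t | exists i j u v, [/\ (i + j <= n)%N, FF i u, FF j v & t = tns u v]].

Lemma FFtens_subspace n : is_subspace (FFtens n).
Proof. exact: span_subspace. Qed.

Lemma FFtens_tns n i j u v : (i + j <= n)%N -> FF i u -> FF j v ->
  FFtens n (tns u v).
Proof. by move=> ij Fu Fv; apply: mem_lspan; exists i, j, u, v. Qed.

Lemma FFtens_mono m n t : (m <= n)%N -> FFtens m t -> FFtens n t.
Proof.
move=> mn; move: t; apply: (span_min (FFtens_subspace n)) => _ [i [j [u [v [ij Fu Fv ->]]]]].
exact: FFtens_tns (leq_trans ij mn) Fu Fv.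
Qed.

Lemma FFtensM m n t u : FFtens m t -> FFtens n u -> FFtens (m + n) (t * u).
Proof.
move=> Ft; move: u; apply: span_min.
  exact: (preim_subspace (mulr_lin t) (FFtens_subspace _)).
move=> _ [i [j [a [b [ij Fa Fb ->]]]]] /=; move: t Ft; apply: span_min.
  exact: (preim_subspace (mull_lin (tns a b)) (FFtens_subspace _)).
move=> _ [i' [j' [a' [b' [ij' Fa' Fb' ->]]]]] /=; rewrite tnsM.
apply: (@FFtens_tns _ (i' + i) (j' + j)).
- by rewrite addnACA leq_add.
- exact: (FFM charKp p_gt3 EC gp).
- exact: (FFM charKp p_gt3 EC gp).
Qed.

Lemma FFtensX m k t : FFtens m t -> FFtens (k * m) (t ^+ k).
Proof.
move=> Ft; elim: k => [|k IH]; last by rewrite mulSn exprS; exact: FFtensM.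
by rewrite expr0 -tns1; apply: (@FFtens_tns _ 0 0) => //; exact: FF1.
Qed.

Lemma DeltaX u k : Delta (u ^+ k) = Delta u ^+ k.
Proof. by elim: k => [|k IH]; rewrite ?expr0 // !exprS DeltaM IH. Qed.

Lemma Delta_g_FF : FFtens 0 (Delta g).
Proof.
rewrite Deltag; apply: (@FFtens_tns _ 0 0) => //; rewrite -[g]expr1; exact: FF_gX.
Qed.

Lemma Delta_h_FF : FFtens 1 (Delta h).
Proof.
have Fh : FF 1 (h ^+ 1 * 1) by apply: (@FFh _ _ _ _ _ _ 1 0) => //; exact: FS1.
rewrite expr1 mulr1 in Fh.
rewrite Deltah; apply: (subspaceD (FFtens_subspace 1)).
  by apply: (@FFtens_tns _ 0 1) => //; exact: FF1.
by apply: (@FFtens_tns _ 1 0) => //; rewrite -[g]expr1; exact: FF_gX.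
Qed.

Lemma bell22 : bell g h 2 2 = g * g.
Proof. by rewrite bellS (@bell_gt _ _ g h 1 2) // comm_br0 add0r bell1. Qed.

Lemma Delta_gi : Delta (gi p g) = tns (gi p g) (gi p g).
Proof. by rewrite DeltaX Deltag (tnsX tnsM tns1). Qed.

Lemma Delta_x1 : Delta (x 1) = tns 1 (x 1) + tns (x 1) g.
Proof.
rewrite DeltaM Delta_E Delta_gi (ad_iter_tns tnsB tnsM EC) !big_ord_recl big_ord0 addr0.
rewrite mulrDl !tnsM bell1 bell22 -[E 0]/g (g_gi p_gt3 gp).
by rewrite -[g * g * _]mulrA (g_gi p_gt3 gp) mulr1.
Qed.

Lemma Delta_x2 : Delta (x 2) =
  tns 1 (x 2) + tns (x 1) (x 1 * g) *+ 3 + tns (x 2) (g * g).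
Proof.
have Tr := tns_linr tnsB (x 1).
have E1C : g * E 1 = E 1 * g by exact: (EC 0 1).
have b32 : bell g h 3 2 = (E 1 * g) *+ 3.
  rewrite bellS bell22 bell1 comm_brM -[comm_br g h]/(E 1) E1C.
  by rewrite -mulr2n -mulrSr.
have b33 : bell g h 3 3 = g * g * g.
  by rewrite bellS (@bell_gt _ _ g h 2 3) // comm_br0 add0r bell22.
rewrite DeltaM Delta_E Delta_gi (ad_iter_tns tnsB tnsM EC) !big_ord_recl big_ord0 addr0.
rewrite !mulrDl !tnsM bell1 b32 b33 -[E 0]/g (g_gi p_gt3 gp) addrA mulrnAl.
rewrite -[g * g * g * _]mulrA -[E 1 * g * _]mulrA (g_gi p_gt3 gp) !mulr1.
rewrite (xg_g p_gt3 EC gp); congr (_ + _ + _).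
by rewrite -[RHS]scaler_nat -(linZ Tr) scaler_nat.
Qed.

(** The constant 3/2 in z_2 = x_2 - 3/2 x_1^2 cancels the mixed terms of
    Delta(x_2) and Delta(x_1)^2 against each other. *)
Lemma Delta_z2 : Delta (z 2) = tns 1 (z 2) + tns (z 2) (g * g).
Proof.
have xgC : g * x 1 = x 1 * g by rewrite (EalgC EC (Ealg_g g h) (Ealg_xg p g h 1)).
rewrite /zg (linB DeltaL) (linZ DeltaL) DeltaX Delta_x2 Delta_x1.
rewrite (linB (tns_linr tnsB 1)) (linZ (tns_linr tnsB 1)).
rewrite (linB (tns_linl tnsB _)) (linZ (tns_linl tnsB _)).
have -> : (tns 1 (x 1) + tns (x 1) g) ^+ 2 = tns 1 (x 1 ^+ 2) +
    tns (x 1) (x 1 * g) *+ 2 + tns (x 1 ^+ 2) (g * g).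
  by rewrite expr2 mulrDr !mulrDl !tnsM !mul1r !mulr1 xgC -!expr2 mulr2n !addrA.
set Q := tns (x 1) (x 1 * g).
have cQ : zc K 2 *: (Q *+ 2) = Q *+ 3.
  rewrite -[Q *+ 2]scaler_nat scalerA (zc2 charKp p_gt3) divfK ?scaler_nat //.
  exact: (two_neq0 charKp p_gt3).
rewrite 2!scalerDr cQ 2!opprD.
rewrite [LHS](AC (3*3) ((1*4)*(3*6)*(2*5))) /=.
by rewrite subrr addr0.
Qed.

Lemma Delta_z_FF k : (0 < k)%N -> FFtens k.-1 (Delta (z k)).
Proof.
have sub n := FFtens_subspace n.
have Fx1 : FFtens 1 (Delta (x 1)).
  rewrite Delta_x1; apply: (subspaceD (sub 1)).
    by apply: (@FFtens_tns _ 0 1) => //; [exact: FF1|exact/FF_FS/FS_x1].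
  by apply: (@FFtens_tns _ 1 0); [|exact/FF_FS/FS_x1|rewrite -[g]expr1; exact: FF_gX].
have Fz2 : FFtens 1 (Delta (z 2)).
  have Fz : FF 1 (z 2) by apply: FF_FS; exact: (@FS_z K p charKp p_gt3 A g h 2 isT).
  rewrite Delta_z2; apply: (subspaceD (sub 1)).
    by apply: (@FFtens_tns _ 0 1) => //; exact: FF1.
  by apply: (@FFtens_tns _ 1 0) => //; rewrite -expr2; exact: FF_gX.
elim: k => [|[|k] IH] // _.
  by rewrite (zg1 charKp p_gt3) (lin0 DeltaL); case: (sub 0).
rewrite (zg_rec charKp p_gt3 EC gp (ltn0Sn k)) 2!(linD DeltaL) (linZ DeltaL) /=.
have IHk : FFtens k (Delta (z k.+1)) by exact: IH.
have M m n t u : FFtens m t -> FFtens n u -> (m + n = k.+1)%N -> FFtens k.+1 (t * u).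
  by move=> Ft Fu <-; exact: FFtensM.
apply: (subspaceD (sub k.+1)); first apply: (subspaceD (sub k.+1)).
- rewrite /comm_br (linB DeltaL) !DeltaM; apply: (subspaceB (sub k.+1)).
    by apply: (M _ _ _ _ IHk Delta_h_FF); rewrite addn1.
  by apply: (M _ _ _ _ Delta_h_FF IHk).
- by rewrite DeltaM; apply: (M _ _ _ _ IHk Fx1); rewrite addn1.
apply: (subspaceZ (sub k.+1)); rewrite DeltaM DeltaX.
by apply: (M (k * 1)%N 1%N) => //; [exact: FFtensX|rewrite muln1 addn1].
Qed.

Lemma Delta_FS n s : FS n s -> FFtens n (Delta s).
Proof.
elim=> {n s} [n|n c u v _ IHu _ IHv|n u _ IH|m n i u i0 mn _ IH].
- by rewrite Delta1 -tns1; apply: (@FFtens_tns _ 0 0) => //; exact: FF1.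
- by rewrite DeltaL; case: (FFtens_subspace n) => _ Ladd; exact: Ladd.
- by rewrite DeltaM -[n]addn0; exact: FFtensM IH Delta_g_FF.
rewrite DeltaM; apply: FFtens_mono mn _; apply: FFtensM IH _.
case: i i0 => [|[|i]] // _; last by rewrite wtSS; exact: (@Delta_z_FF i.+2).
rewrite /Ug /wt /= Delta_x1; apply: (subspaceD (FFtens_subspace 1)).
  by apply: (@FFtens_tns _ 0 1) => //; [exact: FF1|exact/FF_FS/FS_x1].
by apply: (@FFtens_tns _ 1 0); [|exact/FF_FS/FS_x1|rewrite -[g]expr1; exact: FF_gX].
Qed.

Lemma Delta_FF n u : FF n u -> FFtens n (Delta u).
Proof.
elim=> [c v w _ IHv _ IHw|r m s Fs rm].
  by rewrite DeltaL; case: (FFtens_subspace n) => _ Ladd; exact: Ladd.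
apply: FFtens_mono rm _; rewrite DeltaM DeltaX; apply: FFtensM (Delta_FS Fs).
by rewrite -[X in FFtens X]muln1; exact: FFtensX Delta_h_FF.
Qed.

Lemma FF0_gX u : FF 0 u -> lspan [set e : A | exists t, e = g ^+ t] u.
Proof.
have [_ Ladd] := span_subspace [set e : A | exists t, e = g ^+ t].
elim=> [c v w _ IHv _ IHw|r m s Fs]; first exact: Ladd.
rewrite leqn0 addn_eq0 => /andP[/eqP-> /eqP m0]; rewrite expr0 mul1r.
move: Fs m0; elim=> {m s} [n|n c v w _ IHv _ IHw|n v _ IH|m n i v i0 mn _ _] n0.
- by apply: mem_lspan; exists 0; rewrite expr0.
- by apply: Ladd; [exact: IHv|exact: IHw].
- move: v {IH}(IH n0); apply: span_min.
    exact: (preim_subspace (mull_lin g) (span_subspace _)).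
  by move=> _ [t ->] /=; apply: mem_lspan; exists t.+1; rewrite exprSr.
by move: mn; rewrite n0 leqn0 addn_eq0 /wt maxnE andbC.
Qed.

Lemma kills_gX_FF0 f u : kills_gX f -> FF 0 u -> f u = 0.
Proof.
move=> [ff f0] /FF0_gX; move: u; apply: span_min.
  by split=> [|c v w /= Ev Ew] /=; rewrite ?(functional0 ff) // ff Ev Ew mulr0 addr0.
by move=> _ [t ->]; exact: f0.
Qed.

Lemma hitr_FF0 f u : kills_gX f -> FF 0 u -> hitr f u = 0.
Proof.
move=> af; have [ff _] := af; move=> /Delta_FF; rewrite /hitr; move: (Delta u).
apply: span_min.
  split=> [|c v w /= Ev Ew] /=; first by rewrite (lin0 (contrL ff)).
  by rewrite (contrL ff) Ev Ew scaler0 addr0.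
move=> _ [i [j [a [b [ij Fa Fb ->]]]]] /=; rewrite contrE // (kills_gX_FF0 af) ?scale0r //.
by move: ij Fb; rewrite leqn0 addn_eq0 => /andP[_ /eqP->].
Qed.

Lemma hitr_FFS f n u : kills_gX f -> FF n.+1 u -> FF n (hitr f u).
Proof.
move=> af; have [ff _] := af; move=> /Delta_FF; rewrite /hitr; move: (Delta u).
have sub := FF_subspace p g h n.
apply: span_min; first exact: (preim_subspace (contrL ff) sub).
move=> _ [i [j [a [b [ij Fa Fb ->]]]]] /=; rewrite contrE //.
case: j ij Fb => [|j] ij Fb.
  by rewrite (kills_gX_FF0 af Fb) scale0r; case: sub.
apply: (subspaceZ sub); apply: FF_mono Fa.
by move: ij; rewrite addnS ltnS; apply: leq_trans; exact: leq_addr.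
Qed.

Lemma FF_annpow n u : FF n u -> annpow n.+1 u.
Proof.
elim: n u => [|n IH] u Fu f af; first exact: hitr_FF0.
by apply: IH; exact: hitr_FFS.
Qed.

(** ** The annihilator is contained in the filtration *)

(** An operator differentiating with respect to v acts on powers by falling
    factorials. *)
Lemma iter_lower (D : A -> A) v (S : set A) c k j t : lin D ->
  (forall j t, S t -> D (v ^+ j * t) = c *: ((v ^+ j.-1 * t) *+ j)) -> S t ->
  iter k D (v ^+ j * t) = (c ^+ k * (j ^_ k)%:R) *: (v ^+ (j - k) * t).
Proof.
move=> DL DS St; elim: k => [|k IH]; first by rewrite subn0 mulr1 scale1r.
rewrite iterS IH (linZ DL) DS // -scaler_nat !scalerA -subnS exprSr ffactnSr natrM.
by congr (_ *: _); ring.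
Qed.

Lemma fact_neq0 n : (n < p)%N -> n`!%:R != 0 :> K.
Proof.
elim: n => [|n IH] np; first exact: oner_neq0.
by rewrite factS natrM mulf_neq0 ?IH ?(natr_neq0 charKp) // ltnW.
Qed.

(** If an operator D lowers [annpow] by w and differentiates with respect to v of
    weight w, the top coefficient t_q of a polynomial in v lying in [annpow] is
    recovered by applying D q times.  It lies in [annpow] for an index smaller
    by q w, so in the filtration by induction, and v^q t_q can be removed. *)
Lemma peel (D : A -> A) v (S : set A) c w n : lin D -> c != 0 -> (0 < w)%N ->
  (forall j t, S t -> D (v ^+ j * t) = c *: ((v ^+ j.-1 * t) *+ j)) ->
  (forall m u, annpow m u -> annpow (m - w) (D u)) ->
  (forall m j u, FF m u -> FF (m + j * w) (v ^+ j * u)) ->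
  (forall m, (m < n)%N -> forall u, annpow m.+1 u -> FF m u) ->
  forall u, Dec p v S u -> annpow n.+1 u ->
  exists t, [/\ S t, annpow n.+1 t & FF n (u - t)].
Proof.
move=> DL c0 w0 DS DB Fv IHn _ [t St ->].
have sF := FF_subspace p g h n.
suff main q : (q < p)%N -> annpow n.+1 (\sum_(j < q.+1) v ^+ j * t j) ->
    annpow n.+1 (t 0) /\ FF n (\sum_(j < q.+1) v ^+ j * t j - t 0).
  have := main p.-1; rewrite (prednK (prime_gt0 (pcharf_prime charKp))) => mainp Bt.
  by have [B0 F0] := mainp (leqnn p) Bt; exists (t 0).
elim: q => [|q IH] qp.
  by rewrite big_ord_recl big_ord0 expr0 mul1r addr0 subrr; split=> //; case: sF.
rewrite big_ord_recr /=; set u := \sum_(j < _) _; set a := v ^+ q.+1 * _ => Bua.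
have iB k m y : annpow m y -> annpow (m - k * w) (iter k D y).
  elim: k => [|k IHk] By; first by rewrite subn0.
  by rewrite iterS mulSn addnC subnDA; exact/DB/IHk.
have iL k : lin (iter k D).
  by elim: k => [|k IHk] d y y' //; rewrite !iterS IHk DL.
have Fa : FF n a.
  have := iB q.+1 n.+1 (u + a) Bua.
  have -> : iter q.+1 D (u + a) = (c ^+ q.+1 * (q.+1)`!%:R) *: t q.+1.
    rewrite (linD (iL q.+1)) (lin_sum (iL q.+1)) big1 ?add0r => [|j _].
      by rewrite (iter_lower _ _ DL DS) // ffactnn subnn mul1r.
    by rewrite (iter_lower _ _ DL DS) // ffact_small // mulr0 scale0r.
  have d0 : c ^+ q.+1 * (q.+1)`!%:R != 0 by rewrite mulf_neq0 ?expf_neq0 ?fact_neq0.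
  case E1: (n.+1 - q.+1 * w)%N => [|m] /=.
    move/eqP; rewrite scaler_eq0 (negPf d0) /= => /eqP t0.
    by rewrite /a t0 mulr0; case: sF.
  move=> Bt; have nm : n = (m + q.+1 * w)%N.
    by apply: succn_inj; rewrite -addSn -E1 subnK // ltnW // -subn_gt0 E1.
  rewrite /a nm; apply: Fv; rewrite -[t q.+1](scalerK d0).
  apply: (subspaceZ (FF_subspace p g h m)); apply: IHn Bt.
  by rewrite nm -[X in (X < _)%N]addn0 ltn_add2l muln_gt0.
have Bu : annpow n.+1 u.
  by rewrite -[u](addrK a); apply: (subspaceB (annpow_subspace n.+1)) => //; exact: FF_annpow.
have [B0 F0] := IH (ltnW qp) Bu; split=> //.
by rewrite addrAC; exact: (subspaceD sF).
Qed.

Lemma annpow_FF n u : annpow n.+1 u -> FF n u.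
Proof.
elim/ltn_ind: n u => n IH u Bu.
have sF := FF_subspace p g h n.
have SNF N s : (N <= p - 2)%N -> SN p g h N s -> annpow n.+1 s -> FF n s.
  elim: N s => [|N IHN] s Np Ss Bs.
    have Gs := SN0_gX Ss; move: s Gs {Ss Bs}; apply: (span_min sF) => _ [t ->]; exact: FF_gX.
  have FU m j y : FF m y -> FF (m + j * wt N.+1) (Ug p g h N.+1 ^+ j * y).
    move=> Fy; rewrite addnC; apply: (FFM charKp p_gt3 EC gp) Fy; apply: FF_FS.
    elim: j => [|j IHj]; first exact: FS1.
    by rewrite mulSn exprS; apply: FSM IHj; exact: FS_U.
  have c0 : mu N.+1 * (N.+2)`!%:R != 0.
    rewrite mulf_neq0 ?mu_neq0 ?fact_neq0 //.
    by apply: leq_ltn_trans (_ : p - 1 < p)%N; [|rewrite subn1 prednK // p_gt0];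
       move: Np; case: (p) p_gt3 => [|[|q]] // _; rewrite subn2 subn1.
  have [DL _ _] := Dop_der N.+1.
  have w0 : (0 < wt N.+1)%N by exact: leq_maxl.
  have DB m y : annpow m y -> annpow (m - wt N.+1) (Dop N.+1 y) by exact: Dop_annpow.
  have [t [St Bt Fst]] := peel DL c0 w0 (@Dop_UX N) DB FU IH (SN_Dec charKp p_gt3 EC Ekp Np Ss) Bs.
  by rewrite -[s](subrK t); apply: (subspaceD sF) => //; exact: (IHN t (ltnW Np) St Bt).
have Fh m j y : FF m y -> FF (m + j * 1) (h ^+ j * y).
  by rewrite muln1; exact: FF_hl.
have Dh j t : Ealg g h t -> hitr tau (h ^+ j * t) = 1 *: ((h ^+ j.-1 * t) *+ j).
  by move=> St; rewrite scale1r hitr_tau_hX.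
have BR m y : annpow m y -> annpow (m - 1) (hitr tau y).
  by rewrite subn1; exact: (annpow_hitr kills_gX_tau).
have [t [St Bt Fut]] := peel (hitr_lin tau_fun) (oner_neq0 K) (ltn0Sn 0) Dh BR Fh IH
  (h_Dec hp A_ind u) Bu.
rewrite -[u](subrK t); apply: (subspaceD sF) => //.
apply: (SNF (p - 2)%N) Bt => //; exact: (Ealg_SN p_gt3 EC gp Ep0 St).
Qed.

(** ** Right coideals *)

Definition right_coideal (D : set A) : Prop :=
  is_subspace D /\ forall f u, functional f -> D u -> D (hitr f u).

Lemma gX_sum u : lspan [set e : A | exists t, e = g ^+ t] u ->
  exists a : nat -> K, u = \sum_(t < p) a t *: g ^+ t.
Proof.
move: u; apply: span_min.
  split=> [|c _ _ [a ->] [b ->]].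
    by exists (fun=> 0); rewrite big1 // => t _; rewrite scale0r.
  exists (fun t => c * a t + b t); rewrite scaler_sumr -big_split.
  by apply: eq_bigr => t _ /=; rewrite scalerDl scalerA.
move=> _ [t ->]; have p0 := prime_gt0 (pcharf_prime charKp).
exists (fun i => (i == t %% p)%N%:R).
rewrite (bigD1 (Ordinal (ltn_pmod t p0))) //= eqxx scale1r big1 ?addr0 => [|i].
  by rewrite (expr_mod _ gp).
by rewrite -val_eqE /= => /negPf ->; rewrite scale0r.
Qed.

Lemma ef0_gX t : ef 0 (g ^+ t) = t%:R.
Proof.
have eg : eps (g ^+ t) = 1 by elim: t => [|t IH]; rewrite ?expr0 // exprSr eps_g.
elim: t eg => [|t IH]; first by rewrite ef1.
rewrite exprSr eps_g => eg.
rewrite efM; [|exact/EalgX/Ealg_g|exact: Ealg_g].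
by rewrite IH // eg ef_g eps_gval mulr1 mul1r natr1.
Qed.

(** The powers g^t with t < p are eigenvectors of [hitr (ef 0)] for the distinct
    eigenvalues t. *)
Lemma right_coideal_gX D (a : nat -> K) q : right_coideal D -> (q <= p)%N ->
  D (\sum_(t < q) a t *: g ^+ t) -> forall t, (t < q)%N -> D (a t *: g ^+ t).
Proof.
move=> [sD DR]; elim: q a => // q IH a qp; rewrite big_ord_recr /=.
set u := \sum_(t < q) _ => Du.
have RL := hitr_lin (ef_fun 0).
have Rg (b : K) t : hitr (ef 0) (b *: g ^+ t) = (b * t%:R) *: g ^+ t.
  by rewrite (linZ RL) hitr_gX // ef0_gX scalerA.
have Dt t : (t < q)%N -> D (a t *: g ^+ t).
  move=> tq; have tq0 : t%:R - q%:R != 0 :> K.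
    rewrite -opprB oppr_eq0 -natrB 1?ltnW // (natr_neq0 charKp) //.
    by rewrite subn_gt0 tq (leq_ltn_trans (leq_subr _ _)).
  have : D (\sum_(t < q) (a t * (t%:R - q%:R)) *: g ^+ t).
    have -> : \sum_(t < q) (a t * (t%:R - q%:R)) *: g ^+ t =
        hitr (ef 0) (u + a q *: g ^+ q) - q%:R *: (u + a q *: g ^+ q).
      rewrite (linD RL) Rg scalerDr scalerA [q%:R * _]mulrC opprD addrACA subrr addr0.
      rewrite (lin_sum RL) scaler_sumr -sumrB; apply: eq_bigr => i _.
      by rewrite Rg scalerA [q%:R * _]mulrC -scalerBl mulrBr.
    by apply: (subspaceB sD); [exact: DR|exact: (subspaceZ sD)].
  move=> /(IH (fun t => a t * (t%:R - q%:R)) (ltnW qp)) Da.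
  have := subspaceZ sD (t%:R - q%:R)^-1 (Da t tq).
  by rewrite scalerA mulrCA mulVf // mulr1.
move=> t; rewrite ltnS leq_eqVlt => /orP[/eqP->|]; last exact: Dt.
rewrite -[_ *: _](addKr u) addrC; apply: (subspaceB sD) => //.
by apply: (subspace_sum sD) => i; exact: Dt.
Qed.

(** Contractions with functionals vanishing on the powers of g lower the
    filtration degree, so they kill a nonzero element of D of least degree,
    which is therefore a combination of powers of g. *)
Lemma right_coideal_grouplike D u : right_coideal D -> D u -> u <> 0 ->
  exists t, D (g ^+ t).
Proof.
move=> cD; have [sD DR] := cD.
have F0 y : FF 0 y -> D y -> y <> 0 -> exists t, D (g ^+ t).
  move=> /FF0_gX/gX_sum[a ->] /(right_coideal_gX cD (leqnn p)) Da nz.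
  have [[t at0]|az] := pselect (exists t : 'I_p, a t <> 0).
    exists t; have := subspaceZ sD (a t)^-1 (Da t (ltn_ord t)).
    by rewrite scalerA mulVf ?scale1r //; apply/eqP.
  case: nz; rewrite big1 // => t _; have [->|/eqP at0] := eqVneq (a t) 0.
    by rewrite scale0r.
  by case: az; exists t.
have [n Fu] := FF_exhaust charKp p_gt3 EC gp A_ind u.
elim: n u Fu => [|n IH] u Fu Du nz; first exact: F0 Fu Du nz.
have [[f [af fu]]|Rz] := pselect (exists f, kills_gX f /\ hitr f u <> 0).
  by apply: IH fu; [exact: hitr_FFS|apply: DR => //; case: af].
apply: (F0 u) => //; apply: annpow_FF => f af /=.
by have [//|Ru] := pselect (hitr f u = 0); case: Rz; exists f.
Qed.

(** The common kernel of all functionals is a right coideal, and the counit does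
    not vanish on the powers of g. *)
Lemma functionals_separate u : (forall f : A -> K, functional f -> f u = 0) -> u = 0.
Proof.
move=> u0; have [//|nz] := pselect (u = 0).
have [|t] := @right_coideal_grouplike [set v | forall f : A -> K, functional f -> f v = 0] u _ u0 nz.
- split=> [|f v ff v0 f' ff'].
    split=> [f ff|c v w v0 w0 f ff]; first exact: functional0.
    by rewrite ff v0 // w0 // mulr0 addr0.
  apply: (v0 (fun y => f' (hitr f y))) => c y y'.
  by rewrite (hitr_lin ff) ff'.
move=> /(_ _ eps_fun); have -> : eps (g ^+ t) = 1.
  by elim: t => [|t IH]; rewrite ?expr0 // exprSr eps_g.
by move/eqP; rewrite oner_eq0.
Qed.

(** ** Contraction of the other factor *)

(** The actions on the two sides commute, so that in the induction one functional
    acts on the left after all the others have acted on the right.  For n = 0,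
    the value of a functional at u is the counit of its left action on u. *)
Lemma annpow_hitl n u : (forall f, kills_gX f -> annpow n (hitl f u)) -> annpow n.+1 u.
Proof.
elim: n u => [|n IH] u BL f af; have [ff f0] := af.
  apply: functionals_separate => f' ff'.
  pose psi y := f' (hitr f y).
  have fpsi : functional psi by move=> c y y'; rewrite /psi (hitr_lin ff) ff'.
  have apsi : kills_gX psi.
    by split=> // t; rewrite /psi hitr_gX // f0 scale0r (functional0 ff').
  by rewrite -[LHS]/(psi u) -(eps_hitl _ fpsi) (BL _ apsi) (functional0 eps_fun).
apply: IH => f' af'; rewrite hitl_hitr //; last by case: af'.
exact: BL.
Qed.

End Coalgebra.

(** * Coradical filtrations *)

Section Contraction.
Variables (K : fieldType) (A : algType K).

Definition contr_r (f : A -> K) (t : tensor A A) : A := tlift (fun a b => f b *: a) t.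
Definition contr_l (f : A -> K) (t : tensor A A) : A := tlift (fun a b => f a *: b) t.

Variable f : A -> K.
Hypothesis ff : functional f.

Lemma contr_r_bilinear : @bilinear_map K A A A (fun a b => f b *: a).
Proof.
split=> [c a a' b|c a b b']; first by rewrite scalerDr !scalerA mulrC.
by rewrite ff scalerDl scalerA.
Qed.

Lemma contr_l_bilinear : @bilinear_map K A A A (fun a b => f a *: b).
Proof.
split=> [c a a' b|c a b b']; last by rewrite scalerDr !scalerA mulrC.
by rewrite ff scalerDl scalerA.
Qed.

Lemma contr_r_lin : lin (contr_r f).
Proof. exact: (tlift_linear contr_r_bilinear). Qed.

Lemma contr_l_lin : lin (contr_l f).
Proof. exact: (tlift_linear contr_l_bilinear). Qed.

Lemma contr_rE a b : contr_r f (a \ox b) = f b *: a.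
Proof. exact: (tlift_tens contr_r_bilinear). Qed.

Lemma contr_lE a b : contr_l f (a \ox b) = f a *: b.
Proof. exact: (tlift_tens contr_l_bilinear). Qed.

Lemma tswap_lin : lin (@tswap K A A).
Proof.
have [tl tr] := tens_bilinear A A.
by apply: tlift_linear; split=> *; rewrite ?tl ?tr.
Qed.

Lemma tswapK t : tswap (@tswap K A A t) = t.
Proof.
apply: (tlift_ext (f := @tswap K A A \o @tswap K A A) (f' := id)) => [c u v||a b] //=.
  by rewrite (tswap_lin c u v); exact: tswap_lin.
by rewrite !tswap_tens.
Qed.

Lemma contr_r_swap t : contr_r f (tswap t) = contr_l f t.
Proof.
apply: (tlift_ext (f := contr_r f \o @tswap K A A) (f' := contr_l f)) => [c u v||a b] /=.
- by rewrite (tswap_lin c u v); exact: contr_r_lin.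
- exact: contr_l_lin.
by rewrite tswap_tens contr_rE contr_lE.
Qed.

End Contraction.

Lemma tens_sub_swap (K : fieldType) (A : algType K) (U V : set A) t :
  tens_sub U V t -> tens_sub V U (tswap t).
Proof.
move: t; apply: span_min.
  exact: (preim_subspace (@tswap_lin K A) (span_subspace _)).
move=> _ [u [v [Uu Vv ->]]] /=; rewrite tswap_tens.
by apply: mem_lspan; exists v, u.
Qed.

Lemma coradical_cop (K : fieldType) (A : algType K) (Delta : A -> tensor A A) :
  coradical (cop Delta) = coradical Delta.
Proof.
have E : subcoalgebra (cop Delta) = subcoalgebra Delta.
  apply: funext => U; apply: propext; split=> -[sU DU]; split=> // u /DU.
    by move/tens_sub_swap; rewrite /cop tswapK.
  exact: tens_sub_swap.
by rewrite /coradical /simple_subcoalgebra E.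
Qed.

Section CoradicalFiltration.
Variables (K : fieldType) (A : algType K) (g : A) (Delta : A -> tensor A A).
Variables (eps : A -> K) (chi : is_character eps).
Local Notation TA := (tensor_alg chi).
Variable F : nat -> set A.
Local Notation annpow := (@annpow K A TA g Delta (@contr_r K A)).
Hypothesis DeltaL : lin Delta.
Hypothesis Delta_gX : forall t, Delta (g ^+ t) = (g ^+ t) \ox (g ^+ t).
Hypothesis gX_neq0 : forall t, g ^+ t <> 0.
Hypothesis F_subspace : forall n, is_subspace (F n).
Hypothesis F_mono : forall m n, (m <= n)%N -> F m `<=` F n.
Hypothesis F_gX : forall t, F 0 (g ^+ t).
Hypothesis F0_gX : F 0 `<=` lspan [set e | exists t, e = g ^+ t].
Hypothesis Delta_F : forall n u, F n u -> lspan [set t | exists i j a b,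
  [/\ (i + j <= n)%N, F i a, F j b & t = a \ox b]] (Delta u).
Hypothesis F_ann : forall n, F n = annpow n.+1.
Hypothesis F_ann_l : forall n u,
  (forall f, kills_gX g f -> annpow n (contr_l f (Delta u))) -> annpow n.+1 u.
Hypothesis grouplike : forall D u,
  @right_coideal K A TA Delta (@contr_r K A) D ->
  D u -> u <> 0 -> exists t, D (g ^+ t).

Lemma line_gX t v : lspan [set g ^+ t] v -> exists c, v = c *: g ^+ t.
Proof.
move: v; apply: span_min.
  split=> [|c _ _ [a ->] [b ->]]; first by exists 0; rewrite scale0r.
  by exists (c * a + b); rewrite scalerDl scalerA.
by move=> _ ->; exists 1; rewrite scale1r.
Qed.

Lemma simple_line_gX t : simple_subcoalgebra Delta (lspan [set g ^+ t]).
Proof.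
have Lg : lspan [set g ^+ t] (g ^+ t) by exact: mem_lspan.
split.
- split; first exact: span_subspace.
  move=> u /line_gX[c ->]; rewrite (linZ DeltaL) Delta_gX.
  apply: (subspaceZ (span_subspace _)); apply: mem_lspan.
  by exists (g ^+ t), (g ^+ t).
- by exists (g ^+ t).
move=> V [sV _] VL; have [[v Vv vn0]|V0] := pselect (exists2 v, V v & v <> 0).
  right; apply/seteqP; split=> //; apply: (span_min sV) => _ ->.
  have [c cv] := line_gX (VL _ Vv).
  have c0 : c != 0 by apply/eqP => c0; apply: vn0; rewrite cv c0 scale0r.
  by rewrite -[g ^+ t](scalerK c0) -cv; exact: (subspaceZ sV).
left; apply/seteqP; split=> [v Vv|_ ->]; last by case: sV.
by have [//|vn0] := pselect (v = 0); case: V0; exists v.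
Qed.

(** A simple subcoalgebra is a right coideal, so it contains some g^t, and then
    it is the line spanned by g^t. *)
Lemma coradicalE : coradical Delta = F 0.
Proof.
apply/seteqP; split.
  apply: (span_min (F_subspace 0)) => v [U [[sU DU] [u Uu un0] simU] Uv].
  have [|t Ut] := @grouplike U u _ Uu un0.
    split=> // f w ff Uw; rewrite /hitr; move: (Delta w) (DU w Uw).
    apply: span_min; first exact: (preim_subspace (contr_r_lin ff) sU).
    move=> _ [a [b [Ua Ub ->]]] /=; rewrite contr_rE //.
    exact: (subspaceZ sU).
  have [sl _ _] := simple_line_gX t.
  have lU : lspan [set g ^+ t] `<=` U by apply: (span_min sU) => _ ->.
  have [l0|lE] := simU _ sl lU.
    have : lspan [set g ^+ t] (g ^+ t) by exact: mem_lspan.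
    by rewrite l0 => /gX_neq0.
  move: Uv; rewrite -lE => /line_gX[c ->].
  exact: (subspaceZ (F_subspace 0)).
move=> u /F0_gX; move: u; apply: (span_min (span_subspace _)) => _ [t ->].
apply: mem_lspan; exists (lspan [set g ^+ t]); first exact: simple_line_gX.
exact: mem_lspan.
Qed.

Lemma kills_gX_F0 f u : kills_gX g f -> F 0 u -> f u = 0.
Proof.
move=> [ff f0] /F0_gX; move: u; apply: span_min.
  by split=> [|c v w /= Ev Ew] /=; rewrite ?(functional0 ff) // ff Ev Ew mulr0 addr0.
by move=> _ [t ->]; exact: f0.
Qed.

(** Contraction of the second factor with a functional vanishing on F_0 kills
    the summand C (x) F_0. *)
Lemma contr_wedge f n t : kills_gX g f ->
  lspan (tens_sub (F n) setT `|` tens_sub setT (F 0)) t -> F n (contr_r f t).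
Proof.
move=> af; have [ff _] := af; have sub := F_subspace n.
have pre := preim_subspace (contr_r_lin ff) sub.
move: t; apply: span_min => // t [].
  move: t; apply: span_min => // _ [a [b [Fa _ ->]]] /=.
  by rewrite contr_rE //; exact: (subspaceZ sub).
move: t; apply: span_min => // _ [a [b [_ Fb ->]]] /=.
by rewrite contr_rE // (kills_gX_F0 af Fb) scale0r; case: sub.
Qed.

Lemma F_wedge n u : F n.+1 u ->
  lspan (tens_sub (F n) setT `|` tens_sub setT (F 0)) (Delta u) /\
  lspan (tens_sub (F n) setT `|` tens_sub setT (F 0)) (cop Delta u).
Proof.
move=> /Delta_F; rewrite /cop; move: (Delta u) => t Dt.
set W := lspan _; have sW : is_subspace W by exact: span_subspace.
have Wt a b i j : (i + j <= n.+1)%N -> F i a -> F j b -> W (a \ox b).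
  case: j => [|j] ij Fa Fb.
    by apply: mem_lspan; right; apply: mem_lspan; exists a, b.
  apply: mem_lspan; left; apply: mem_lspan; exists a, b; split=> //.
  have iN : (i <= n)%N by move: ij; rewrite addnS ltnS; apply: leq_trans; exact: leq_addr.
  exact: F_mono Fa.
split; move: t Dt; apply: span_min.
- exact: sW.
- by move=> _ [i [j [a [b [ij Fa Fb ->]]]]]; exact: Wt ij Fa Fb.
- exact: (preim_subspace (@tswap_lin K A) sW).
move=> _ [i [j [a [b [ij Fa Fb ->]]]]] /=; rewrite tswap_tens.
by apply: Wt Fb Fa; rewrite addnC.
Qed.

(** One inclusion is the filteredness of the coproduct; for the other one, an
    element of the n+1-st term is sent to F n by every functional in question,
    acting on the right, or on the left for the opposite coproduct. *)
Lemma coradical_filtration_eq n :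
  coradical_filtration (cop Delta) n = F n /\ coradical_filtration Delta n = F n.
Proof.
have C0 := coradicalE; have C0' : coradical (cop Delta) = F 0 by rewrite coradical_cop.
elim: n => [|n [IH' IH]] //; split; rewrite /= ?IH ?IH' ?C0 ?C0'; apply/seteqP.
  split=> u; last by case/F_wedge.
  move=> Cu; rewrite F_ann; apply: F_ann_l => f af; rewrite -F_ann -contr_r_swap.
    exact: contr_wedge af Cu.
  by case: af.
split=> u; last by case/F_wedge.
move=> Cu; rewrite F_ann => f af.
by have := contr_wedge af Cu; rewrite F_ann.
Qed.

End CoradicalFiltration.

(** * Functionals from the representation *)

Section RepresentationFunctionals.
Variables (K : fieldType) (A : algType K) (g h : A).
Variable rep : A -> 'M[K]_4.
Hypothesis repL : lin rep.
Hypothesis repM : {morph rep : u v / u * v}.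
Hypothesis rep1 : rep 1 = 1.
Hypothesis repg : rep g = rep_g K.
Hypothesis reph : rep h = rep_h K.
Local Notation o0 := (@Ordinal 4 0 isT).
Local Notation o1 := (@Ordinal 4 1 isT).
Local Notation o2 := (@Ordinal 4 2 isT).
Local Notation o3 := (@Ordinal 4 3 isT).

Lemma mulmx_deltaE (M : 'M[K]_4) k l i j :
  (M * delta_mx k l) i j = M i k *+ (j == l).
Proof.
rewrite [LHS]mxE (bigD1 k) //= big1 => [|i' /negPf ki]; last by rewrite mxE ki mulr0.
by rewrite mxE eqxx addr0 mulr_natr.
Qed.

Lemma delta_mulmxE (M : 'M[K]_4) k l i j :
  (delta_mx k l * M) i j = M l j *+ (i == k).
Proof.
rewrite [LHS]mxE (bigD1 l) //= big1 => [|i' /negPf ki]; last first.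
  by rewrite mxE ki andbF mul0r.
by rewrite mxE eqxx andbT addr0 mulr_natl.
Qed.

Lemma rep_mulg u i j : rep (u * g) i j = rep u i j + rep u i o1 *+ (j == o0).
Proof. by rewrite repM repg /rep_g mulrDr mulr1 mxE mulmx_deltaE. Qed.

Lemma rep_mulh u i j :
  rep (u * h) i j = - (rep u i o2 *+ (j == o1) + rep u i o3 *+ (j == o2)).
Proof. by rewrite repM reph /rep_h mulrN mulrDr 2!mxE !mulmx_deltaE. Qed.

Lemma rep_hmul u i j :
  rep (h * u) i j = - (rep u o1 j *+ (i == o2) + rep u o2 j *+ (i == o3)).
Proof. by rewrite repM reph /rep_h mulNr mulrDl 2!mxE !delta_mulmxE. Qed.

Lemma rep_functional i j : functional (fun u => rep u i j).
Proof. by move=> c u v; rewrite repL !mxE. Qed.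

Definition rep_eps u := rep u o3 o3.
Definition rep_tau u := - rep u o3 o2.
(** The factors (k+1)! make commutation with h send [rep_ef k.+1] to k+2 times
    [rep_ef k], which are the structure constants of vector fields on a line. *)
Definition rep_ef (k : nat) (u : A) : K :=
  match k with
  | 0 => rep u o1 o0
  | 1 => 2%:R * rep u o2 o0
  | 2 => 6%:R * rep u o3 o0
  | _ => 0
  end.

Lemma rep_eps1 : rep_eps 1 = 1.
Proof. by rewrite /rep_eps rep1 mxE. Qed.

Lemma rep_eps_g u : rep_eps (u * g) = rep_eps u.
Proof. by rewrite /rep_eps rep_mulg addr0. Qed.

Lemma rep_eps_h u : rep_eps (u * h) = 0.
Proof. by rewrite /rep_eps rep_mulh addr0 oppr0. Qed.

Lemma rep_tau_functional : functional rep_tau.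
Proof. by move=> c u v; rewrite /rep_tau repL !mxE opprD mulrN. Qed.

Lemma rep_tau1 : rep_tau 1 = 0.
Proof. by rewrite /rep_tau rep1 mxE oppr0. Qed.

Lemma rep_tau_g u : rep_tau (u * g) = rep_tau u.
Proof. by rewrite /rep_tau rep_mulg addr0. Qed.

Lemma rep_tau_h u : rep_tau (u * h) = rep_eps u.
Proof. by rewrite /rep_tau rep_mulh add0r opprK. Qed.

Lemma rep_ef_functional k : functional (rep_ef k).
Proof.
case: k => [|[|[|k]]] c u v /=; rewrite ?repL ?mxE //.
- by rewrite mulrDr mulrCA.
- by rewrite mulrDr mulrCA.
- by rewrite mulr0 addr0.
Qed.

Lemma rep_ef1 k : rep_ef k 1 = 0.
Proof. by case: k => [|[|[|k]]] //=; rewrite rep1 mxE // mulr0. Qed.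

Lemma rep_ef_g k : rep_ef k g = (k == 0%N)%:R.
Proof.
by case: k => [|[|[|k]]] //=; rewrite repg !mxE /= ?add0r ?addr0 ?mulr0.
Qed.

Lemma rep_ef_br0 u : rep_ef 0 (comm_br u h) = 0.
Proof.
by rewrite /comm_br /= (functionalB (rep_functional _ _)) rep_mulh rep_hmul addr0 subrr.
Qed.

Lemma rep_ef_brS k u : (k <= 1)%N ->
  rep_ef k.+1 (comm_br u h) = k.+2%:R * rep_ef k u.
Proof.
case: k => [|[|k]] //= _;
  rewrite /comm_br (functionalB (rep_functional _ _)) rep_mulh rep_hmul /=.
  by rewrite !addr0 oppr0 opprK add0r.
by rewrite !addr0 oppr0 opprK !add0r mulrA -natrM.
Qed.

(** E_k, k >= 1, acts by a strictly lower triangular matrix supported on the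
    first column, and g acts as 1 up to such a matrix. *)
Lemma rep_Ealg u : Ealg g h u ->
  (forall i j, j != o0 -> rep u i j = rep_eps u *+ (i == j)) /\
  rep u o0 o0 = rep_eps u.
Proof.
have repE k : rep (ad_iter g h k) = ad_iter (rep_g K) (rep_h K) k.
  elim: k => [|k IH]; first exact: repg.
  by rewrite !ad_iterS (morph_comm_br repL repM) IH reph.
elim=> {u} [|c u v _ [IHu IHu0] _ [IHv IHv0]|k u _ [IH IH0]].
- by rewrite rep_eps1 rep1; split=> [i j _|]; rewrite mxE.
- have -> : rep_eps (c *: u + v) = c * rep_eps u + rep_eps v by exact: rep_functional.
  rewrite repL; split=> [i j j0|].
    by rewrite !mxE IHu // IHv // mulrnDl mulrnAr.
  by rewrite !mxE IHu0 IHv0.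
case: k => [|k].
  rewrite -[ad_iter g h 0]/g rep_eps_g; split=> [i j j0|].
    by rewrite rep_mulg (negPf j0) addr0 IH.
  by rewrite rep_mulg /= (IH o0 o1) //= addr0.
have [c _ [l [l0 El]]] := rep_E_delta K (ltn0Sn k).
have F i j : rep (u * ad_iter g h k.+1) i j = c * (rep u i l *+ (j == o0)).
  by rewrite repM repE El -scalerAr mxE mulmx_deltaE.
rewrite /rep_eps; split=> [i j j0|]; first by rewrite !F (negPf j0) mulr0 mul0rn.
by rewrite !F (IH o0 l) // eq_sym (negPf l0) mulr0.
Qed.

Lemma rep_efM k u v : Ealg g h u -> Ealg g h v ->
  rep_ef k (u * v) = rep_ef k u * rep_eps v + rep_eps u * rep_ef k v.
Proof.
move=> /rep_Ealg[Ru _] /rep_Ealg[_ Rv].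
have H i : i != o0 -> rep (u * v) i o0 = rep u i o0 * rep_eps v + rep_eps u * rep v i o0.
  move=> i0; rewrite repM [LHS]mxE (bigD1 o0) //= Rv; congr (_ + _).
  rewrite (bigD1 i) //= Ru // eqxx big1 ?addr0 // => j /andP[j0 ji].
  by rewrite Ru // eq_sym (negPf ji) mul0r.
case: k => [|[|[|k]]] /=; rewrite ?H // ?mulr0 ?mul0r ?addr0 //.
- by rewrite mulrDr mulrA mulrCA.
- by rewrite mulrDr mulrA mulrCA.
Qed.

End RepresentationFunctionals.

(** * The coradical filtration of the quotient *)

Section Final.
Variables (K : fieldType) (p : nat) (charKp : p \in [pchar K]) (p_gt3 : (3 < p)%N).
Local Notation A := (Tp charKp).
Local Notation g := (x_p charKp).
Local Notation h := (y_p charKp).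
Local Notation chi := (counit_p_character charKp).
Local Notation TA := (tensor_alg chi).
Local Notation pi := (aproj (ideal_p charKp) \o aproj (ideal_I K)).
Local Notation Delta := (@comul_p K p charKp).

Lemma pi_surj x : pi (arepr (arepr x)) = x :> A.
Proof. by rewrite /= !areprK. Qed.

Lemma Tp_ind (P : A -> Prop) : P 1 ->
  (forall c u v, P u -> P v -> P (c *: u + v)) ->
  (forall u, P u -> P (u * g)) -> (forall u, P u -> P (u * h)) -> forall u, P u.
Proof.
move=> P1 PL Pg Ph x; rewrite -[x]pi_surj; move: (arepr (arepr x)).
apply: freealg_ind => [|c u v Pu Pv|u Pu|u Pu]; first exact: P1.
- by rewrite (pi_lin charKp); exact: PL.
- by rewrite (piM charKp); exact: Pg.
- by rewrite (piM charKp); exact: Ph.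
Qed.

Lemma comul_p_lin : lin (Delta : A -> TA).
Proof.
move=> c x y; rewrite -[x]pi_surj -[y]pi_surj -(pi_lin charKp) !comul_pE.
exact: coprod_eval_lin.
Qed.

Lemma comul_pM : {morph (Delta : A -> TA) : x y / x * y}.
Proof.
move=> x y; rewrite -[x]pi_surj -[y]pi_surj -(piM charKp) !comul_pE.
exact: coprod_evalM.
Qed.

Lemma comul_p1 : Delta 1 = 1 :> TA.
Proof.
by apply: etrans (comul_pE charKp 1) _;
  exact: (@alg_eval1 K TA (coprod_letter chi g h)).
Qed.

Lemma comul_pg : Delta g = g \ox g.
Proof.
by apply: etrans (comul_pE charKp (gT K)) _;
  exact: (@alg_eval_letter K TA (coprod_letter chi g h) false).
Qed.

Lemma comul_ph : Delta h = 1 \ox h + h \ox g.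
Proof.
by apply: etrans (comul_pE charKp (hT K)) _;
  exact: (@alg_eval_letter K TA (coprod_letter chi g h) true).
Qed.

Definition rep_letter (b : bool) : 'M[K]_4 := if b then rep_h K else rep_g K.
Definition rep_p : A -> 'M[K]_4 := lift_p rep_letter.

Let rC : forall i j, ad_iter (rep_letter false) (rep_letter true) i *
   ad_iter (rep_letter false) (rep_letter true) j =
   ad_iter (rep_letter false) (rep_letter true) j *
   ad_iter (rep_letter false) (rep_letter true) i := @rep_EC K.
Let rg := rep_g_exp charKp p_gt3.
Let rE := rep_E_last K p_gt3.
Let rh := rep_h_exp K p_gt3.
Let rEk k (kp : (0 < k <= p - 2)%N) :
  ad_iter (rep_letter false) (rep_letter true) k ^+ p = 0.
Proof. by apply: rep_E_exp => //; case/andP: kp. Qed.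

Let repL : lin rep_p := lift_p_lin rC rg rE rh rEk.
Let repM : {morph rep_p : x y / x * y} := lift_pM rC rg rE rh rEk.
Let rep1 : rep_p 1 = 1 := lift_p1 charKp rC rg rE rh rEk.
Let repg : rep_p g = rep_g K := lift_px charKp rC rg rE rh rEk.
Let reph : rep_p h = rep_h K := lift_py charKp rC rg rE rh rEk.

Let tB : @bilinear_map K A A TA (@tens K A A) := tens_bilinear A A.
Let tM := tensor_algM chi.
Let t1 : (1 \ox 1 : TA) = 1 := erefl.
Let tI : forall P : TA -> Prop,
  P 0 -> (forall c a b t, P t -> P (c *: (a \ox b : TA) + t)) -> forall t, P t :=
  @tens_ind K A A.

Local Notation contr := (@contr_r K A).
Local Notation contl := (@contr_l K A).
Let EC := E_pC charKp.
Let gp := x_p_exp charKp.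
Let Ep0 := E_p_last charKp.
Let hp := y_p_exp charKp.
Let Ekp := @E_p_exp K p charKp.
Let contrL : forall f, functional f -> lin (contr f : TA -> A) := @contr_r_lin K A.
Let contlL : forall f, functional f -> lin (contl f : TA -> A) := @contr_l_lin K A.
Let contrE := @contr_rE K A.
Let contlE := @contr_lE K A.
Local Notation eps := (rep_eps rep_p).
Local Notation tau := (rep_tau rep_p).
Local Notation ef := (rep_ef rep_p).
Let eps_fun : functional eps := rep_functional repL _ _.
Let tau_fun : functional tau := rep_tau_functional repL.
Let ef_fun : forall k, functional (ef k) := rep_ef_functional repL.
Let eps1 := rep_eps1 rep1.
Let eps_g := rep_eps_g repM repg.
Let eps_h := rep_eps_h repM reph.
Let tau1 := rep_tau1 rep1.
Let tau_g := rep_tau_g repM repg.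
Let tau_h := rep_tau_h repM reph.
Let ef1 := rep_ef1 rep1.
Let efM := rep_efM repL repM rep1 repg reph.
Let ef_g := rep_ef_g repg.
Let ef_br0 := rep_ef_br0 repL repM reph.
Let ef_brS := rep_ef_brS repL repM reph.

Lemma comul_p_gX t : Delta (g ^+ t) = (g ^+ t) \ox (g ^+ t).
Proof.
apply: etrans (tnsX tM t1 g g t); rewrite -comul_pg.
exact: (DeltaX comul_p1 comul_pM).
Qed.

Lemma x_p_exp_neq0 t : g ^+ t <> 0.
Proof.
have : eps (g ^+ t) = 1.
  elim: t => [|t IH]; first exact: eps1.
  by rewrite exprSr -IH; exact: eps_g.
move=> eg g0; move: eg; rewrite g0 (functional0 eps_fun) => /eqP.
by rewrite eq_sym oner_eq0.
Qed.

Lemma coradical_filtration_FF n :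
  coradical_filtration (cop Delta) n = FF p g h n /\
  coradical_filtration Delta n = FF p g h n.
Proof.
apply: (coradical_filtration_eq (chi := chi) (g := g)).
- exact: comul_p_lin.
- exact: comul_p_gX.
- exact: x_p_exp_neq0.
- exact: FF_subspace.
- by move=> k m km u; exact: FF_mono.
- exact: FF_gX.
- by move=> u; exact: FF0_gX.
- exact: (Delta_FF charKp p_gt3 tB tM t1 EC gp comul_p_lin comul_p1 comul_pM
    comul_pg comul_ph).
- move=> k; apply/seteqP; split=> u.
    exact: (FF_annpow charKp p_gt3 tB tM t1 EC gp comul_p_lin comul_p1 comul_pM
      comul_pg comul_ph contrL contrE).
  exact: (annpow_FF charKp p_gt3 tB tM t1 tI EC gp Ep0 hp Ekp Tp_ind comul_p_lin
    comul_p1 comul_pM comul_pg comul_ph contrL contrE eps_fun eps1 eps_g eps_h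
    tau_fun tau1 tau_g tau_h ef_fun ef1 efM ef_g ef_br0 ef_brS).
- exact: (annpow_hitl charKp p_gt3 tB tM t1 tI EC gp Ep0 hp Ekp Tp_ind comul_p_lin
    comul_p1 comul_pM comul_pg comul_ph contrL contlL contrE contlE eps_fun eps1
    eps_g eps_h tau_fun tau1 tau_g tau_h ef_fun ef1 efM ef_g ef_br0 ef_brS).
exact: (right_coideal_grouplike charKp p_gt3 tB tM t1 tI EC gp Ep0 hp Ekp Tp_ind
  comul_p_lin comul_p1 comul_pM comul_pg comul_ph contrL contrE eps_fun eps1
  eps_g eps_h tau_fun tau1 tau_g tau_h ef_fun ef1 efM ef_g ef_br0 ef_brS).
Qed.

Lemma monomial_pE r l s t : monomial_p charKp r l s t = monomial p g h r l s t.
Proof.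
have xE_xg m : xE charKp m = xg p g h m by rewrite /xE E_pE.
have zE_zg m : zE charKp m = zg p g h m by rewrite /zE !xE_xg.
exact: (congr2 (fun x z : nat -> A =>
    h ^+ r * (\prod_(q <- l) z q.1 ^+ q.2) * x 1%N ^+ s * g ^+ t)
  (funext xE_xg) (funext zE_zg)).
Qed.

Lemma filt_F_FF n : @filt_F K p charKp n = FF p g h n.
Proof.
have monE : monomial_p charKp = monomial p g h.
  by do 4!apply: funext => ?; exact: monomial_pE.
apply: etrans (congr1 (fun M : nat -> seq (nat * nat) -> nat -> nat -> A =>
  lspan [set e | exists r l s t,
    [/\ z_indices l, (monomial_weight r l s <= n)%N & e = M r l s t]]) monE) _.
exact: esym (FF_mon_span charKp p_gt3 EC n).
Qed.

End Final.

Theorem corollary5p17 (K : fieldType) (p : nat)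
    (charKp : (p \in [pchar K]%R)) (p_gt3 : (3 < p)%N) :
  forall n : nat,
    coradical_filtration (cop (@comul_p K p charKp)) n = @filt_F K p charKp n /\
    coradical_filtration (@comul_p K p charKp) n = @filt_F K p charKp n.
Proof.
move=> n; have := coradical_filtration_FF charKp p_gt3 n.
by rewrite -filt_F_FF.
Qed.
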